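(* Let $K$ be an algebraically closed field and $1\le f\le[n/2]$. Then (1) $\dim_K\mathrm{End}_{KSp(V)}\bigl(V^{\otimes n}/V^{\otimes n}\mathbb B_n^{(f)}\bigr)$ is independent of $K$; (2) the natural homomorphism $\varphi_{f,K}:\mathbb B_n/\mathbb B_n^{(f)}\to\mathrm{End}_{KSp(V)}\bigl(V^{\otimes n}/V^{\otimes n}\mathbb B_n^{(f)}\bigr)$ induced by the right action of $\mathbb B_n$ is surjective.
   Context: Setup: $m,n$ positive integers, $i'=2m+1-i$; $V$ a $K$-space with basis $v_1,\dots,v_{2m}$, skew form with $\langle v_i,v_j\rangle=\langle v_{i'},v_{j'}\rangle=0$, $\langle v_i,v_{j'}\rangle=\delta_{ij}=-\langle v_{j'},v_i\rangle$ ($1\le i,j\le m$); $v_i^*=v_{i'}$ ($i\le m$), $v_i^*=-v_{i'}$ ($i>m$). $Sp(V)$ acts diagonally on $V^{\otimes n}$. $\mathbb B_n=\mathbb B_n(-2m)$ is the Brauer algebra over $K$ with generators $s_i,e_i$ ($1\le i\le n-1$), acting on the right of $V^{\otimes n}$ by $(v_{i_1}\otimes\cdots\otimes v_{i_n})s_j=-(\cdots\otimes v_{i_{j+1}}\otimes v_{i_j}\otimes\cdots)$, $(v_{i_1}\otimes\cdots\otimes v_{i_n})e_j=-v_{i_1}\otimes\cdots\otimes v_{i_{j-1}}\otimes(\sum_{k=1}^{2m}v_k\otimes v_k^* )\otimes v_{i_{j+2}}\otimes\cdots$; this commutes with $Sp(V)$. $\mathbb B_n^{(f)}$ is the two-sided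 ideal generated by $e_1e_3\cdots e_{2f-1}$; $V^{\otimes n}/V^{\otimes n}\mathbb B_n^{(f)}$ is an $Sp(V)$-$(\mathbb B_n/\mathbb B_n^{(f)})$-bimodule.
   Formalization: The action of e_j is taken with the factor ⟨v_{i_j}, v_{i_{j+1}}⟩, missing from the formula given in the setup; without it e_j² = 0 instead of −2m e_j, and e_j does not commute with Sp(V). *)

(* Defs.v *)
From HB Require Import structures.
From mathcomp Require Import all_boot all_order all_algebra.
Set Implicit Arguments. Unset Strict Implicit. Unset Printing Implicit Defensive.
Import GRing.Theory.
Local Open Scope ring_scope.

(* Indices are 0-based: basis vectors v_0,...,v_{2m-1} of V, i' = 2m-1-i,
   tensor positions 0..n-1.  A basis vector v_{I 0} (x) ... (x) v_{I (n-1)}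
   of V^{(x) n} is indexed by I : idx m n.  V^{(x) n} is modelled by row
   vectors 'rV_(dimT m n); linear operators by square matrices acting on the
   right of row vectors (v |-> v *m A). *)

Definition idx (m n : nat) := {ffun 'I_n -> 'I_(m.*2)}.
Definition dimT (m n : nat) := #|{: idx m n}|.
Definition ixT {m n : nat} (i : 'I_(dimT m n)) : idx m n := enum_val i.

Definition dualI {m : nat} (a : 'I_(m.*2)) : 'I_(m.*2) := rev_ord a.

Section Ops.
Variables (K : fieldType) (m n : nat).

(* sign: dual(v_a) = eps a * v_{dualI a} *)
Definition eps (a : 'I_(m.*2)) : K := if (a < m)%N then 1 else -1.

Definition form (a b : 'I_(m.*2)) : K := eps a * (b == dualI a)%:R.

Definition Jmx : 'M[K]_(m.*2) := \matrix_(a, b) form a b.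

(* Sp(V), with V = row vectors, g acting by v |-> v *m g *)
Definition isSp (g : 'M[K]_(m.*2)) : Prop := g *m Jmx *m g^T = Jmx.

Definition tensmx (g : 'M[K]_(m.*2)) : 'M[K]_(dimT m n) :=
  \matrix_(i, j) \prod_(k : 'I_n) g (ixT i k) (ixT j k).

(* s_j (positions j, j+1): e_I s_j = - e_{I with entries j, j+1 swapped} *)
Definition smx (j : nat) : 'M[K]_(dimT m n) :=
  \matrix_(i, i') (- ([forall k : 'I_n, forall k' : 'I_n,
         ((val k == j) && (val k' == j.+1)) ==>
           ((ixT i' k == ixT i k') && (ixT i' k' == ixT i k))]
     && [forall k : 'I_n, ((val k != j) && (val k != j.+1)) ==>
           (ixT i' k == ixT i k)])%:R).

(* e_j : e_I e_j = - <v_{I j}, v_{I (j+1)}> *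
         (... (x) (sum_c v_c (x) dual(v_c)) (x) ...) *)
Definition emx (j : nat) : 'M[K]_(dimT m n) :=
  \matrix_(i, i') (- ((\sum_(k : 'I_n) \sum_(k' : 'I_n | (val k == j) && (val k' == j.+1))
         form (ixT i k) (ixT i k')
       * (eps (ixT i' k) * (ixT i' k' == dualI (ixT i' k))%:R))
     * [forall k : 'I_n, ((val k != j) && (val k != j.+1)) ==>
           (ixT i' k == ixT i k)]%:R)).

(* generators of B_n: (j, false) = s_{j+1}, (j, true) = e_{j+1} (1-based) *)
Definition gen := ('I_(n.-1) * bool)%type.
Definition genmx (x : gen) : 'M[K]_(dimT m n) :=
  if x.2 then emx (val x.1) else smx (val x.1).
Definition wordmx (w : seq gen) : 'M[K]_(dimT m n) :=
  foldr (fun x A => genmx x *m A) 1%:M w.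

(* image of e_1 e_3 ... e_{2f-1} *)
Definition Efmx (f : nat) : 'M[K]_(dimT m n) :=
  foldr (fun i A => emx (i.*2) *m A) 1%:M (iota 0 f).

(* membership in V^{(x) n} B_n^{(f)} (B_n^{(f)} = span of a E b) *)
Definition inW (f : nat) (v : 'rV[K]_(dimT m n)) : Prop :=
  exists l : seq ('rV[K]_(dimT m n) * (seq gen * seq gen)),
    v = \sum_(p <- l) p.1 *m wordmx p.2.1 *m Efmx f *m wordmx p.2.2.

(* linear endomorphisms of V^{(x) n}/W are represented by A with W A <= W;
   the KSp(V)-endomorphisms are those commuting with Sp(V) modulo W *)
Definition isSpEndQ (f : nat) (A : 'M[K]_(dimT m n)) : Prop :=
  (forall v, inW f v -> inW f (v *m A)) /\
  (forall g, isSp g -> forall v, inW f (v *m (A *m tensmx g - tensmx g *m A))).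

Definition nullQ (f : nat) (A : 'M[K]_(dimT m n)) : Prop :=
  forall v, inW f (v *m A).

Definition inBimg (B : 'M[K]_(dimT m n)) : Prop :=
  exists l : seq (K * seq gen), B = \sum_(p <- l) p.1 *: wordmx p.2.

End Ops.

(* dimension of the quotient space P / Q (Q <= P subspaces of vT) *)
Definition qdim (K : fieldType) (vT : lmodType K) (P Q : vT -> Prop) (d : nat) : Prop :=
  exists b : d.-tuple vT,
    (forall i, P (tnth b i)) /\
    (forall x, P x -> exists c : 'I_d -> K, Q (x - \sum_i c i *: tnth b i)) /\
    (forall c : 'I_d -> K, Q (\sum_i c i *: tnth b i) -> forall i, c i = 0).

Definition dimEndQ (K : fieldType) (m n f d : nat) : Prop :=
  qdim (@isSpEndQ K m n f) (@nullQ K m n f) d.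

Definition phi_surj (K : fieldType) (m n f : nat) : Prop :=
  forall A, isSpEndQ f A -> exists B, @inBimg K m n B /\ nullQ f (A - B).

(* Main.v *)
Require Import Defs.
From HB Require Import structures.
From mathcomp Require Import all_boot all_order all_algebra.
From mathcomp Require Import all_fingroup zify ring.
Import Defs.
Set Implicit Arguments. Unset Strict Implicit. Unset Printing Implicit Defensive.
Import GRing.Theory.

(** Write M = V^(x)n and W = M B^(f).  By duality an endomorphism A of M/W becomes an element F
of V^(x)n (x) V^(x)n = V^(x)2n that is Sp(V)-invariant modulo V^(x)n (x) W.

V^(x)2n has a characteristic-free basis indexed by pairs (w, t): w is a lattice word of length 2n
adding and removing boxes of partitions with at most m rows, and t is a symplectic
Gelfand-Tsetlin pattern of the final shape.  The basis tensor y_w(e_t) is the image of a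
product of exterior powers under the equivariant map that w prescribes: added boxes become
comultiplications, removed boxes insertions of the dual tensor.  The branching rule shows that there
are (2m)^(2n) such pairs.  Independence follows by evaluating at an extremal word, where only a product
of minors of g in Sp(V) survives, and these products are separated by their degrees along a
polynomial curve of unipotent symplectic matrices.

If the part of w lying in the factor W removes at least f boxes, then y_w lies in
V^(x)n (x) W; all elements of W vanish on words with fewer than f letters from the second
half of the basis of V.  Comparing coefficients for all g, F is, modulo V^(x)n (x) W, a unique
combination of the y_w with empty final shape and fewer than f removals in W.  These words do not
depend on K, which gives the dimension, and expanding y_w over perfect matchings of the 2n points
shows that it comes from the Brauer algebra. *)

(** * Partitions, interlacing and the count of symplectic patterns *)

Section Partitions.
Variables (m B : nat).

(** The characteristic is arbitrary, so nothing can be averaged or split off: an endomorphism of M/W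
    is not known to have a lift commuting with Sp(V), and F is invariant only modulo W. The basis is
    therefore made compatible with W: words are read from the last letter, so the suffix lying in
    the factor W is itself a lattice word, and its number of removals can be compared with [f].

    Spanning is not shown by straightening; it follows from independence and the count of pairs.
    Independence rests on a triangularity in two stages. The letter sum in each column is bounded
    below, and at the bound a determinant appears; [enc] then orders the words of equal letter sum.
    Since invariance modulo W compares g with the identity, the minors are only known to sum to a
    constant in g, so for nonempty final shapes they have to be separated from constants as well.
    The hypothesis on K enters through the curve: an identity between values at all points becomes
    one between polynomials. *)

Definition part := {ffun 'I_m.+1 -> 'I_B.+1}.
Definition ext (p : part) (r : nat) : nat := oapp (fun i => val (p i)) 0 (insub r).

Definition inter (nu lam : nat -> nat) : bool :=
  [forall r : 'I_m.+1, lam r.+1 <= nu r <= lam r].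
Definition incr (lam : nat -> nat) (r s : nat) : nat := lam s + (s == r).
Definition decr (lam : nat -> nat) (r s : nat) : nat := lam s - (s == r).
Definition decreasing (lam : nat -> nat) := forall s, lam s.+1 <= lam s.

Lemma interP nu lam :
  reflect (forall r, r < m.+1 -> lam r.+1 <= nu r <= lam r) (inter nu lam).
Proof.
apply: (iffP forallP) => [h r ltr|h r]; last exact: h.
exact: (h (Ordinal ltr)).
Qed.

Lemma eq_inter nu nu' lam lam' :
  (forall r, r < m.+1 -> nu r = nu' r) -> (forall r, r < m.+2 -> lam r = lam' r) ->
  inter nu lam = inter nu' lam'.
Proof.
move=> e1 e2; apply: eq_forallb => r.
by rewrite e1 // !e2 //; have := ltn_ord r; lia.
Qed.

Lemma ext_ge p r : m < r -> ext p r = 0.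
Proof. by move=> h; rewrite /ext insubF //; apply/negbTE; rewrite -leqNgt. Qed.

Lemma ext_ord p (r : 'I_m.+1) : ext p r = p r.
Proof. by rewrite /ext valK. Qed.

Lemma ext_inj p q : (forall r, r < m.+1 -> ext p r = ext q r) -> p = q.
Proof. by move=> h; apply/ffunP => r; apply: val_inj; rewrite /= -!ext_ord h. Qed.

(** If [nu] interlaces [lam], adding a box to row [r.+1] of [lam] and removing one from row [r] of
    [nu] are both allowed exactly when [lam r.+1 < nu r]; row 0 of [lam] gives the extra term.
    Otherwise both sides count the rows where [nu r = lam r + 1] is the only violation. *)
Lemma inter_sum_incr nu lam : decreasing nu -> decreasing lam -> nu m = 0 ->
  \sum_(r < m.+1) inter nu (incr lam r) =
  inter nu lam + \sum_(r < m.+1) ((0 < nu r) && inter (decr nu r) lam).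
Proof.
move=> dn dl nm; case: (boolP (inter nu lam)) => [/interP h|hn].
  rewrite big_ord_recl [in RHS]big_ord_recr /=.
  have -> : inter nu (incr lam 0).
    by apply/interP => r /h; rewrite /incr; lia.
  rewrite nm /= addn0; congr (_ + _); apply: eq_bigr => r _ /=.
  rewrite /bump /= add1n; have ltr := ltn_ord r.
  congr (nat_of_bool _); apply/interP/andP => [h1|[h1 /interP h2] s lts].
    have := h1 r; rewrite /incr eqxx /= => h3; split; first by lia.
    apply/interP => s lts; have := h s lts; rewrite /decr.
    by case: (ltngtP s r) => [||->]; lia.
  have := h s lts; have := h2 s lts; have := h2 r; rewrite /decr /incr eqxx.
  by case: (ltngtP s r) => [||->]; lia.
rewrite add0n; apply: eq_bigr => r _; congr (nat_of_bool _).
apply/interP/andP => [h|[h1 /interP h] s lts].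
  have e : nu r = (lam r).+1.
    apply/eqP; apply: contraR hn => hr; apply/interP => s lts.
    have := h s lts; rewrite /incr; case: (s =P r) hr => [->|]; lia.
  split; first by rewrite e.
  apply/interP => s lts; have := h s lts; have := dl s; rewrite /decr /incr.
  by case: (s =P r) e => [->|]; lia.
have e : nu r = (lam r).+1.
  apply/eqP; apply: contraR hn => hr; apply/interP => t ltt.
  by have := h t ltt; rewrite /decr; case: (t =P r) hr => [->|]; lia.
have := h s lts; have := dn s; rewrite /decr /incr.
case: (s =P r) e => [->|]; case: (s.+1 =P r) => [<-|]; lia.
Qed.

(** If [nu] interlaces [lam], row [r] matches row [r], both conditions being [nu r < lam r].
    Otherwise row [r.+1] of [lam] matches row [r] of [nu], where [lam r.+1 = nu r + 1] is the only
    violation. *)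
Lemma inter_sum_decr nu lam : decreasing nu -> decreasing lam -> lam m.+1 = 0 ->
  \sum_(r < m.+1) ((0 < lam r) && inter nu (decr lam r)) =
  \sum_(r < m.+1) inter (incr nu r) lam.
Proof.
move=> dn dl lm; case: (boolP (inter nu lam)) => [/interP h|hn].
  apply: eq_bigr => r _; congr (nat_of_bool _); have ltr := ltn_ord r.
  apply/andP/interP => [[h1 /interP h2] s lts|h1].
    have := h s lts; have := h2 s lts; rewrite /decr /incr.
    by case: (s =P r) => [->|]; lia.
  have := h1 r ltr; rewrite /incr eqxx => h3; split; first by lia.
  apply/interP => s lts; have := h s lts; rewrite /decr.
  by case: (s =P r) h3 => [->|]; case: (s.+1 =P r); lia.
rewrite big_ord_recl [in RHS]big_ord_recr /=.
have -> : (0 < lam 0) && inter nu (decr lam 0) = false.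
  apply/negP => /andP[h1 /interP h]; case/negP: hn; apply/interP => s lts.
  by have := h s lts; rewrite /decr; lia.
have -> : inter (incr nu m) lam = false.
  apply/negP => /interP h; case/negP: hn; apply/interP => s lts.
  by have := h s lts; rewrite /incr; case: (s =P m) => [->|]; rewrite ?lm; lia.
rewrite addn0 add0n; apply: eq_bigr => r _; congr (nat_of_bool _).
rewrite /bump /= add1n; have ltr := ltn_ord r.
apply/andP/interP => [[h1 /interP h] s lts|h].
  have e : lam r.+1 = (nu r).+1.
    apply/eqP; apply: contraR hn => hr; apply/interP => t ltt.
    have := h t ltt; rewrite /decr.
    by case: (t =P r) hr => [->|ne] hr; [lia | case: (t =P r.+1) => [->|]; lia].
  have := h s lts; have := h r.+1; have := h r; have := dl r; rewrite /decr /incr.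
  by case: (s =P r) e => [->|ne] e; [lia | case: (s =P r.+1) => [->|]; lia].
have e : lam r.+1 = (nu r).+1.
  apply/eqP; apply: contraR hn => hr; apply/interP => t ltt.
  have := h t ltt; rewrite /incr; case: (t =P r) hr => [->|]; lia.
split; first by rewrite e.
apply/interP => s lts; have := h s lts; have := h r.+1; have := h r; have := dn r; rewrite /decr /incr.
by case: (s =P r) e => [->|ne] e; [lia | case: (s =P r.+1) => [->|]; lia].
Qed.

Definition respects (T : (nat -> nat) -> nat) := forall lam lam' : nat -> nat,
  (forall r, r < m.+2 -> lam r = lam' r) -> T lam = T lam'.

(** When [T] counts patterns, [tot] is one branching step and [pieri] the effect of tensoring with
    the vector representation. *)
Definition tot (T : (nat -> nat) -> nat) (lam : nat -> nat) : nat :=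
  \sum_(p : part | inter (ext p) lam) T (ext p).
Definition pieri (T : (nat -> nat) -> nat) (lam : nat -> nat) : nat :=
  \sum_(r < m.+1) T (incr lam r) + \sum_(r < m.+1 | 0 < lam r) T (decr lam r).

(** [inord] wraps to 0 when row [r] already has length [B]; the hypotheses [lam 0 < B] below exclude
    this. *)
Definition up (r : nat) (q : part) : part := [ffun s : 'I_m.+1 => inord (incr (ext q) r s)].
Definition dn (r : nat) (q : part) : part := [ffun s : 'I_m.+1 => inord (decr (ext q) r s)].

Lemma ext_le q s : ext q s <= B.
Proof. by rewrite /ext; case: insub => //= i; rewrite -ltnS ltn_ord. Qed.

Lemma ext_ffun (f : nat -> nat) s : s < m.+1 -> f s <= B ->
  ext [ffun s : 'I_m.+1 => inord (f s)] s = f s.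
Proof.
move=> lts fs; rewrite -[s in LHS]/(val (Ordinal lts)) ext_ord ffunE inordK //.
Qed.

Lemma ext_up r q s : r < m.+1 -> ext q r < B -> ext (up r q) s = incr (ext q) r s.
Proof.
move=> ltr qr; case: (ltnP s m.+1) => hs; last first.
  by rewrite /incr !ext_ge //; case: (s =P r) => //; lia.
rewrite ext_ffun // /incr; have := ext_le q s; case: (s =P r) => [->|]; lia.
Qed.

Lemma ext_dn r q s : ext (dn r q) s = decr (ext q) r s.
Proof.
case: (ltnP s m.+1) => hs; last by rewrite /decr !ext_ge.
by rewrite ext_ffun // /decr; have := ext_le q s; lia.
Qed.

Lemma up_dn r p : r < m.+1 -> 0 < ext p r -> up r (dn r p) = p.
Proof.
move=> ltr pr; apply: ext_inj => s lts; rewrite ext_up //.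
  by rewrite /incr ext_dn /decr; case: (s =P r) => [->|]; lia.
by rewrite ext_dn /decr eqxx; have := ext_le p r; lia.
Qed.

Lemma dn_up r p : r < m.+1 -> ext p r < B -> dn r (up r p) = p.
Proof.
move=> ltr pr; apply: ext_inj => s lts; rewrite ext_dn /decr ext_up // /incr; lia.
Qed.

Lemma decreasing_le lam s t : decreasing lam -> s <= t -> lam t <= lam s.
Proof.
move=> d; elim: t => [|t IH]; first by rewrite leqn0 => /eqP->.
rewrite leq_eqVlt => /orP[/eqP->//|]; rewrite ltnS => /IH h; exact: leq_trans (d t) h.
Qed.

Lemma reindex_up T lam r : respects T -> decreasing lam -> lam 0 < B -> r < m.+1 ->
  \sum_(p : part | (0 < ext p r) && inter (decr (ext p) r) lam) T (ext p) =
  \sum_(q : part | inter (ext q) lam) T (incr (ext q) r).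
Proof.
move=> rT dl l0 ltr; rewrite (reindex_onto (up r) (dn r)) /=; last first.
  by move=> p /andP[h _]; apply: up_dn.
have key q : ext q r < B -> (0 < ext (up r q) r) && inter (decr (ext (up r q)) r) lam
    && (dn r (up r q) == q) = inter (ext q) lam.
  move=> qr; rewrite dn_up // eqxx andbT ext_up // {1}/incr eqxx addn1 /=.
  by apply: eq_inter => // s lts; rewrite /decr ext_up // /incr; lia.
have key2 q : B <= ext q r -> ((0 < ext (up r q) r) && inter (decr (ext (up r q)) r) lam
    && (dn r (up r q) == q) = false) * (inter (ext q) lam = false).
  move=> qr; split.
    rewrite /up -[r in ext _ r]/(val (Ordinal ltr)) ext_ord ffunE /inord /insubd insubF //=.
    by rewrite /incr eqxx; have := ext_le q r; lia.
  by apply/negP => /interP /(_ r ltr); have := decreasing_le dl (leq0n r); lia.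
apply: congr_big => // [q|q].
  by case: (ltnP (ext q r) B) => h; [rewrite key | rewrite !key2].
case: (ltnP (ext q r) B) => h; last by rewrite key2.
by rewrite key // => _; apply: rT => s _; rewrite ext_up.
Qed.

Lemma reindex_dn T lam r : respects T -> decreasing lam -> lam 0 < B -> r < m.+1 ->
  \sum_(p : part | inter (incr (ext p) r) lam) T (ext p) =
  \sum_(q : part | inter (ext q) lam && (0 < ext q r)) T (decr (ext q) r).
Proof.
move=> rT dl l0 ltr; rewrite (reindex_onto (dn r) (up r)) /=; last first.
  move=> p /interP/(_ r ltr); rewrite /incr eqxx => h; apply: dn_up => //.
  by have := decreasing_le dl (leq0n r); lia.
apply: congr_big => // [q|q _]; last by apply: rT => s _; rewrite ext_dn.
case: (posnP (ext q r)) => h.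
  rewrite andbF; apply/negbTE/negP => /andP[_ /eqP e].
  have := @ext_up r (dn r q) r ltr; rewrite e /incr ext_dn /decr h; lia.
rewrite up_dn // eqxx !andbT; apply: eq_inter => // s lts.
by rewrite /incr ext_dn /decr; case: (s =P r) => [->|]; lia.
Qed.

Lemma sum_cond_const (I : finType) (P : pred I) c :
  \sum_(i | P i) c = (\sum_i P i) * c.
Proof. by rewrite big_mkcond big_distrl /=; apply: eq_bigr => i _; rewrite mulnbl. Qed.

(** A commutation relation: the two interlacing identities trade a box moved in [lam] for a box
    moved in the interlacing partition, and the unmatched term of [inter_sum_incr] becomes
    [tot T lam]. *)
Lemma pieri_tot T lam : respects T ->
  (forall p : part, T (ext p) != 0 -> decreasing (ext p) /\ ext p m = 0) ->
  decreasing lam -> lam m.+1 = 0 -> lam 0 < B ->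
  pieri (tot T) lam = tot T lam + tot (pieri T) lam.
Proof.
move=> rT sT dl lm l0.
have E1 : \sum_(r < m.+1) tot T (incr lam r) =
   tot T lam + \sum_(r < m.+1) \sum_(q : part | inter (ext q) lam) T (incr (ext q) r).
  rewrite /tot (exchange_big_dep xpredT) //= [X in X + _]big_mkcond /=.
  under [X in _ + X]eq_bigr => r _ do rewrite -reindex_up // ?ltn_ord //.
  rewrite [X in _ + X](exchange_big_dep xpredT) //= -big_split /=.
  apply: eq_bigr => p _; rewrite !sum_cond_const.
  case: (eqVneq (T (ext p)) 0) => [->|/sT[dp pm]]; first by rewrite !muln0; case: ifP.
  by rewrite inter_sum_incr // mulnDl mulnbl.
have E2 : \sum_(r < m.+1 | 0 < lam r) tot T (decr lam r) =
   \sum_(r < m.+1) \sum_(q : part | inter (ext q) lam && (0 < ext q r)) T (decr (ext q) r).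
  under [RHS]eq_bigr => r _ do rewrite -reindex_dn // ?ltn_ord //.
  rewrite /tot (exchange_big_dep xpredT) //= [RHS](exchange_big_dep xpredT) //=.
  apply: eq_bigr => p _; rewrite !sum_cond_const.
  case: (eqVneq (T (ext p)) 0) => [->|/sT[dp pm]]; first by rewrite !muln0.
  by congr (_ * _); rewrite inter_sum_decr.
rewrite /pieri E1 E2 -addnA; congr (_ + _).
rewrite /tot /pieri big_split /= exchange_big; congr (_ + _).
rewrite (exchange_big_dep (fun q => inter (ext q) lam)) => [|r q _ /andP[]//].
apply: eq_bigr => q hq.
by apply: eq_bigl => r; rewrite hq.
Qed.

(* [gtc i lam] counts the symplectic Gelfand-Tsetlin patterns with [2 i] rows and top row [lam]. *)
Fixpoint gtc (i : nat) (lam : nat -> nat) : nat :=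
  if i is i'.+1 then (lam i == 0) * tot (tot (gtc i')) lam
  else [forall r : 'I_m.+2, lam r == 0].

Lemma tot_respects T : respects (tot T).
Proof. by move=> lam lam' e; apply: eq_bigl => p; apply: eq_inter. Qed.

Lemma gtc_respects i : i <= m -> respects (gtc i).
Proof.
case: i => [|i] hi lam lam' e /=.
  by congr (nat_of_bool _); apply: eq_forallb => r; rewrite e.
by rewrite (tot_respects _ e) e //; lia.
Qed.

Lemma tot_neq0 T lam : tot T lam != 0 ->
  exists2 p : part, inter (ext p) lam & T (ext p) != 0.
Proof.
rewrite sum_nat_eq0 negb_forall => /existsP[p]; rewrite negb_imply => /andP[h1 h2].
by exists p.
Qed.

Lemma inter_decreasing nu lam : inter nu lam -> forall s, s <= m -> lam s.+1 <= lam s.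
Proof. by move=> /interP h s hs; have := h s; lia. Qed.

Lemma gtc_supp i lam : gtc i lam != 0 -> lam i = 0 /\ (forall s, s <= m -> lam s.+1 <= lam s).
Proof.
case: i => [|i] /=.
  case: forallP => // h _.
  have h' s : s < m.+2 -> lam s = 0 by move=> lts; apply/eqP; exact: (h (Ordinal lts)).
  by split=> [|s hs]; rewrite !h' //; lia.
rewrite muln_eq0 negb_or eqb0 negbK => /andP[/eqP h /tot_neq0[p ip _]]; split=> //.
exact: inter_decreasing ip.
Qed.

Lemma ext_decreasing (p : part) : (forall s, s <= m -> ext p s.+1 <= ext p s) -> decreasing (ext p).
Proof.
move=> h s; case: (leqP s m) => hs; first exact: h.
by rewrite (@ext_ge p s.+1) //; lia.
Qed.

Lemma inter_ext_decreasing lam (p : part) : decreasing lam -> inter (ext p) lam -> decreasing (ext p).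
Proof.
move=> dl /interP h; apply: ext_decreasing => s hs.
case: (ltnP s m) => hs'; last by rewrite (@ext_ge p s.+1).
by have := h s; have := h s.+1; lia.
Qed.

Lemma pieri_gtc_overflow i lam : i <= m -> decreasing lam -> 0 < lam i ->
  pieri (gtc i) lam = (lam i == 1) * gtc i (decr lam i).
Proof.
move=> im dl li.
have z mu : 0 < mu i -> gtc i mu = 0.
  by move=> h; apply/eqP/negPn/negP => /gtc_supp[]; lia.
rewrite /pieri big1 ?add0n => [|r _]; last by rewrite z // /incr; lia.
rewrite (bigD1 (Ordinal (im : i < m.+1))) //= big1 ?addn0 => [|r /andP[_ ner]]; last first.
  have {}ner : r != i :> nat by apply: contraNneq ner => h; apply/eqP/val_inj.
  by rewrite z // /decr; move: ner; rewrite eq_sym => /negbTE->; rewrite subn0.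
case: (lam i =P 1) => [_|h]; first by rewrite mul1n.
by rewrite z // /decr eqxx; lia.
Qed.

(** Dimension count for the vector representation of Sp(2i) tensored with the module of highest
    weight [lam]. Each rank has two interlacing steps, so two uses of [pieri_tot] raise the factor
    by 2. Shapes with one row too many occur on both sides and cancel. *)
Lemma pieri_gtc i lam : i <= m -> decreasing lam -> lam i = 0 -> lam 0 < B ->
  pieri (gtc i) lam = i.*2 * gtc i lam.
Proof.
elim: i lam => [|i IH] lam im dl li l0.
  rewrite mul0n /pieri [X in _ + X]big1 ?addn0 => [|r]; last first.
    by have := decreasing_le dl (leq0n r); lia.
  rewrite big1 // => r _; apply/eqP; rewrite eqb0; apply/forallPn.
  have h : r < m.+2 by have := ltn_ord r; lia.
  by exists (Ordinal h); rewrite /incr /= eqxx addn1.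
set S := tot (tot (gtc i)).
have im' : i <= m by lia.
have lm : lam m.+1 = 0 by have := decreasing_le dl (_ : i.+1 <= m.+1); lia.
have -> : gtc i.+1 lam = S lam by rewrite /= li eqxx mul1n.
(* A box added in row [i.+1] is killed by the row bound of [gtc i.+1] but survives in [S]. *)
have e1 : pieri S lam = pieri (gtc i.+1) lam + S (incr lam i.+1).
  rewrite /pieri addnAC; congr (_ + _); last first.
    apply: eq_bigr => r _ /=; rewrite (_ : decr lam r i.+1 = 0) ?eqxx ?mul1n //.
    by rewrite /decr li.
  have hi : i.+1 < m.+1 by [].
  rewrite (bigD1 (Ordinal hi)) //= addnC; congr (_ + _).
  rewrite [RHS](bigD1 (Ordinal hi)) //= [incr lam i.+1 i.+1]/incr eqxx addn1 mul0n add0n.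
  apply: eq_bigr => r ner; rewrite /incr li.
  have {}ner : r != i.+1 :> nat by apply: contraNneq ner => h; apply/eqP/val_inj.
  have -> : (i.+1 == r :> nat) = false by lia.
  by rewrite mul1n.
have dp (mu : nat -> nat) (p : part) : decreasing mu -> mu 0 < B -> inter (ext p) mu ->
    [/\ decreasing (ext p), ext p m.+1 = 0 & ext p 0 < B].
  move=> dm m0 ip; split; first exact: inter_ext_decreasing ip.
    by rewrite ext_ge.
  by have /interP/(_ 0) := ip; lia.
have e2 : pieri S lam = S lam + tot (pieri (tot (gtc i))) lam.
  apply: pieri_tot => //; first exact: tot_respects.
  move=> p /tot_neq0[q iq /gtc_supp[qi _]].
  have d : decreasing (ext p) by apply: ext_decreasing; exact: inter_decreasing iq.
  by split=> //; have /interP/(_ i) := iq; have := decreasing_le d (im : i.+1 <= m); lia.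
have e3 (p : part) : inter (ext p) lam -> pieri (tot (gtc i)) (ext p) =
   tot (gtc i) (ext p) + (i.*2 * tot (gtc i) (ext p) +
     \sum_(q : part | inter (ext q) (ext p)) (ext q i == 1) * gtc i (decr (ext q) i)).
  move=> ip; have [d1 d2 d3] := dp _ _ dl l0 ip.
  rewrite pieri_tot //; first last.
  - move=> q /gtc_supp[qi hq]; have d : decreasing (ext q) by apply: ext_decreasing.
    by split=> //; have := decreasing_le d im'; lia.
  - exact: gtc_respects.
  congr (_ + _); rewrite /tot big_distrr -big_split /=; apply: eq_bigr => q iq.
  have [q1 q2 q3] := dp _ _ d1 d3 iq.
  case: (posnP (ext q i)) => qi; first by rewrite IH // qi mul0n addn0.
  rewrite pieri_gtc_overflow // (_ : gtc i (ext q) = 0) ?muln0 //.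
  by apply/eqP/negPn/negP => /gtc_supp[]; lia.
have e4 : \sum_(p : part | inter (ext p) lam)
     \sum_(q : part | inter (ext q) (ext p)) (ext q i == 1) * gtc i (decr (ext q) i)
   = S (incr lam i.+1).
  pose good (p q : part) := inter (incr (ext q) i) (ext p) && (ext q i == 0).
  have -> : \sum_(p : part | inter (ext p) lam)
     \sum_(q : part | inter (ext q) (ext p)) (ext q i == 1) * gtc i (decr (ext q) i)
    = \sum_(p : part | inter (ext p) lam) \sum_(q | good p q) gtc i (ext q).
    apply: eq_bigr => p ip; have [d1 d2 d3] := dp _ _ dl l0 ip.
    under [LHS]eq_bigr => q _ do rewrite mulnbl.
    rewrite -big_mkcondr /= (reindex_onto (up i) (dn i)) /=; last first.
      by move=> q /andP[_ /eqP qi]; rewrite up_dn ?qi.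
    apply: congr_big => // [q|q]; last first.
      move=> /andP[/andP[_ h] /eqP e]; apply: gtc_respects => // s _.
      by rewrite -[in RHS]e ext_dn.
    rewrite /good; case: (ltnP (ext q i) B) => qi.
      rewrite dn_up // eqxx andbT ext_up // [incr (ext q) i i]/incr eqxx addn1 eqSS; congr (_ && _).
      by apply: eq_inter => // s _; rewrite ext_up.
    rewrite (_ : inter (incr _ _) _ = false) /=; last first.
      by apply/negP => /interP/(_ i); rewrite /incr eqxx; have := decreasing_le d1 (leq0n i); lia.
    apply/negbTE/negP => /andP[/andP[_ /eqP h] /eqP e].
    by have := congr1 (fun q => ext q i) e; rewrite /= ext_dn /decr eqxx h; lia.
  rewrite (exchange_big_dep xpredT) //= /S /tot [RHS](exchange_big_dep xpredT) //=.
  apply: eq_bigr => q _.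
  case: (eqVneq (gtc i (ext q)) 0) => [->|/gtc_supp[qi dq]]; first by rewrite !big1.
  have {}dq := ext_decreasing dq.
  (* Both conditions force [ext p i] to be positive and [ext p i.+1] to be 0, and they agree in the
     other rows. *)
  apply: eq_bigl => p; rewrite /good qi eqxx andbT.
  apply/andP/andP => -[/interP h1 /interP h2]; split; apply/interP => s hs;
    have := h1 s hs; have := h2 s hs; have := h1 i im'; have := h2 i im';
    have := h1 i.+1; have := h2 i.+1; rewrite /incr !eqxx;
    case: (s =P i) => [->|ne1]; try (case: (s =P i.+1) => [->|ne2]);
    have := dl i; have := dl i.+1; have := dq i; lia.
apply/eqP; rewrite -(eqn_add2r (S (incr lam i.+1))) -e1 e2 /tot (eq_bigr _ e3).
rewrite !big_split /= e4 -big_distrr /= doubleS !mulSn /S /tot; by rewrite !addnA.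
Qed.

End Partitions.

Lemma big_tuple_cons (R : Type) (idx : R) (op : Monoid.com_law idx) (T : finType) n
    (F : seq T -> R) :
  \big[op/idx]_(t : n.+1.-tuple T) F t =
  \big[op/idx]_(x : T) \big[op/idx]_(t : n.-tuple T) F (x :: t).
Proof.
rewrite pair_big /= (reindex (fun p : T * n.-tuple T => cons_tuple p.1 p.2)) //=.
exists (fun t => (thead t, behead_tuple t)) => [[x t] _|t _] /=.
  by congr (_, _); apply: val_inj.
by apply: val_inj; rewrite /= [in RHS](tuple_eta t).
Qed.

Lemma big_tuple0 (R : Type) (idx : R) (op : Monoid.com_law idx) (T : finType)
    (F : seq T -> R) : \big[op/idx]_(t : 0.-tuple T) F t = F [::].
Proof.
rewrite (big_pred1 [tuple]) // => t; rewrite (tuple0 t); exact/esym/eqP.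
Qed.

(** * Lattice words and the dimension of the tensor power *)

Section Lattice.
Variable m : nat.
Local Notation L := 'I_(m.*2).

(* Words are read from the last letter to the first: [a < m] adds a box to row [a], its dual
   removes one, and [lat] requires every intermediate shape to be a partition. *)
Fixpoint sh (w : seq L) : nat -> nat :=
  if w is a :: w' then
    (if a < m then incr (sh w') a else decr (sh w') (rev_ord a)) else fun=> 0.

Fixpoint lat (w : seq L) : bool :=
  if w is a :: w' then
    lat w' && (if a < m then (a == 0 :> nat) || (sh w' a < sh w' a.-1)
               else sh w' (rev_ord a).+1 < sh w' (rev_ord a))
  else true.

Lemma lat_sh w : lat w -> decreasing (sh w) /\ sh w m = 0.
Proof.
elim: w => [|a w IH] //= /andP[/IH[d z]].
case: (ltnP a m) => am h; split.
- move=> s; rewrite /incr; case: (s.+1 =P a :> nat) => [e|]; last by have := d s; lia.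
  by rewrite -e /= in h; have := d s; lia.
- by rewrite /incr z; lia.
- move=> s; rewrite /decr /=; have := d s; case: (s =P m.*2 - a.+1) => [->|]; last lia.
  by move: h => /=; lia.

- by rewrite /decr z.
Qed.

Lemma sh_le_size w s : sh w s <= size w.
Proof. by elim: w => [|a w IH] //=; case: ifP => _; rewrite /incr /decr; lia. Qed.

Lemma big_letter (F : nat -> nat) :
  \sum_(a < m.*2) F a = \sum_(r < m) F r + \sum_(r < m) F (m.*2 - r.+1).
Proof.
rewrite -(big_mkord xpredT F) (@big_cat_nat _ _ _ m) //=; last by lia.
congr (_ + _); first by rewrite big_mkord.
rewrite big_nat_rev /= -[X in \sum_(X <= _ < _) _]add0n big_addn -addnn addnK big_mkord.
by apply: eq_bigr => r _; congr F; have := ltn_ord r; lia.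
Qed.

(** This is [pieri_gtc] with letters as moves: a letter destroying the partition shape contributes 0
    there, since [gtc] vanishes off partitions. *)
Lemma sum_lat_cons B w : lat w -> size w < B ->
  \sum_(a : L) lat (a :: w) * gtc m B m (sh (a :: w)) = m.*2 * gtc m B m (sh w).
Proof.
move=> lw sw; have [d z] := lat_sh lw.
have b0 : sh w 0 < B by apply: leq_ltn_trans sw; apply: sh_le_size.
rewrite -(pieri_gtc (leqnn m) d z b0) /= lw /=.
pose F (a : nat) := (if a < m then (a == 0) || (sh w a < sh w a.-1)
               else sh w (m.*2 - a.+1).+1 < sh w (m.*2 - a.+1)) *
   gtc m B m (if a < m then incr (sh w) a else decr (sh w) (m.*2 - a.+1)).
transitivity (\sum_(a < m.*2) F a); first by apply: eq_bigr => a _; rewrite /F; case: ifP.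
rewrite big_letter /pieri; congr (_ + _).
  rewrite big_ord_recr /= (_ : gtc m B m (incr (sh w) m) = 0) ?addn0; last first.
    by apply/eqP/negPn/negP => /gtc_supp[]; rewrite /incr eqxx; lia.
  apply: eq_bigr => r _; rewrite /F ltn_ord.
  case: (boolP (_ || _)) => [_|]; first by rewrite mul1n.
  case: r => -[|r] ltr //= h.
  apply/esym/eqP; rewrite mul0n; apply/negPn/negP => /gtc_supp[_ /(_ r)].
  by rewrite /incr; have := d r; lia.
rewrite [RHS]big_mkcond [RHS]big_ord_recr /= z /= addn0; apply: eq_bigr => r _.
have ltr := ltn_ord r; rewrite /F (_ : m.*2 - r.+1 < m = false); last by lia.
rewrite (_ : m.*2 - (m.*2 - r.+1).+1 = r); last by lia.
case: (posnP (sh w r)) => h; first by rewrite h.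
case: ltnP => h1; first by rewrite mul1n.
apply/esym/eqP; rewrite mul0n; apply/negPn/negP => /gtc_supp[_ /(_ r)].
by rewrite /decr eqxx; lia.
Qed.

Lemma ext0 B s : ext ([ffun=> ord0] : part m B) s = 0.
Proof. by rewrite /ext; case: insub => //= i; rewrite ffunE. Qed.

Lemma gtc0 B i lam : i <= m -> (forall s, lam s = 0) -> gtc m B i lam = 1.
Proof.
elim: i lam => [|i IH] lam hi l0 /=.
  by rewrite (_ : [forall r : 'I_m.+2, lam r == 0]) //; apply/forallP => r; rewrite l0.
rewrite l0 eqxx mul1n /tot.
have e (mu : nat -> nat) p : (forall s, mu s = 0) ->
    inter m (ext p) mu = (p == [ffun=> ord0] :> part m B).
  move=> m0; apply/interP/eqP => [h|-> r ltr]; last by rewrite ext0 !m0.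
  by apply: ext_inj => r ltr; have := h r ltr; rewrite ext0 !m0; lia.
rewrite (big_pred1 [ffun=> ord0]) => [|p]; last by rewrite e.
rewrite (big_pred1 [ffun=> ord0]) => [|p]; last by rewrite e // => s; exact: ext0.
by apply: IH => [|s]; [lia | exact: ext0].
Qed.

Theorem sum_lat_gtc B N : N < B ->
  \sum_(w : N.-tuple L | lat w) gtc m B m (sh w) = m.*2 ^ N.
Proof.
elim: N => [|N IH] ltN; rewrite big_mkcond /=.
  by rewrite (big_tuple0 _ (fun w => if lat w then gtc m B m (sh w) else 0)) /= gtc0.
rewrite (big_tuple_cons _ _ (fun w => if lat w then gtc m B m (sh w) else 0)).
rewrite exchange_big /= expnS -IH ?big_distrr /=; last by lia.
rewrite [RHS]big_mkcond /=; apply: eq_bigr => w _.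
case: (boolP (lat w)) => lw; last by rewrite big1 // => a _; rewrite /= (negbTE lw).
rewrite -sum_lat_cons ?size_tuple //; last by lia.
by apply: eq_bigr => a _; rewrite mulnbl /= lw.
Qed.
End Lattice.

Section Patterns.
Variables m B : nat.

(** The list holds the rows of the pattern below [lam], from the top down, two per rank. *)
Fixpoint gtpat (i : nat) (lam : nat -> nat) (t : seq (part m B)) : bool :=
  match i, t with
  | 0, [::] => [forall r : 'I_m.+2, lam r == 0]
  | i'.+1, p :: q :: t' =>
      [&& lam i == 0, inter m (ext p) lam, inter m (ext q) (ext p) & gtpat i' (ext q) t']
  | _, _ => false
  end.

Lemma card_gtpat i lam : \sum_(t : i.*2.-tuple (part m B)) gtpat i lam t = gtc m B i lam.
Proof.
elim: i lam => [|i IH] lam; first by rewrite (big_tuple0 _ (fun t => gtpat 0 lam t : nat)).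
rewrite (big_tuple_cons _ _ (fun t => gtpat i.+1 lam t : nat)) /= /tot big_distrr /=.
rewrite [RHS]big_mkcond /=; apply: eq_bigr => p _.
rewrite (big_tuple_cons _ _ (fun t => gtpat i.+1 lam (p :: t) : nat)) /=.
case: ifP => h1; last by rewrite !big1 // => q _; rewrite ?big1 // => t _; rewrite andbF.
rewrite big_distrr [RHS]big_mkcond /=; apply: eq_bigr => q _.
case: ifP => h2; last by rewrite big1 // => t _; rewrite andbF.
by rewrite -IH big_distrr /=; apply: eq_bigr => t _; rewrite mulnbl; case: eqP.
Qed.
End Patterns.

Local Open Scope ring_scope.

(** * Multilinear and alternating functions of lists of vectors *)

Section Multilinear.
Variables (K : fieldType) (V : lmodType K) (F : seq V -> K).

Definition multilinear := forall c1 c2 a x y,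
  F (c1 ++ (a *: x + y) :: c2) = a * F (c1 ++ x :: c2) + F (c1 ++ y :: c2).
Definition alternating := forall c1 c2 x, F (c1 ++ x :: x :: c2) = 0.

Hypothesis lF : multilinear.

Lemma mlin0 c1 c2 : F (c1 ++ 0 :: c2) = 0.
Proof.
have := lF c1 c2 1 0 0; rewrite scaler0 addr0 mul1r => /esym/eqP.
by rewrite -subr_eq0 addrK => /eqP.
Qed.

Lemma mlinZ c1 c2 a x : F (c1 ++ (a *: x) :: c2) = a * F (c1 ++ x :: c2).
Proof. by rewrite -[a *: x]addr0 lF mlin0 addr0. Qed.

Lemma mlinD c1 c2 x y : F (c1 ++ (x + y) :: c2) = F (c1 ++ x :: c2) + F (c1 ++ y :: c2).
Proof. by rewrite -{1}[x]scale1r lF mul1r. Qed.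

Lemma mlin_sum c1 c2 (J : Type) (r : seq J) (P : pred J) (a : J -> K) (x : J -> V) :
  F (c1 ++ (\sum_(i <- r | P i) a i *: x i) :: c2) =
  \sum_(i <- r | P i) a i * F (c1 ++ x i :: c2).
Proof.
elim: r => [|i r IH]; first by rewrite !big_nil mlin0.
by rewrite !big_cons; case: ifP => // _; rewrite lF IH.
Qed.

Fixpoint coefs (T : Type) (al : V -> T -> K) (c : seq V) (f : seq T) : K :=
  match c, f with x :: c', a :: f' => al x a * coefs al c' f' | _, _ => 1 end.

Lemma mlin_expand (T : finType) (E : T -> V) (al : V -> T -> K) pre c :
  (forall x, x = \sum_a al x a *: E a) ->
  F (pre ++ c) = \sum_(f : (size c).-tuple T) coefs al c f * F (pre ++ map E f).
Proof.
move=> hE; elim: c pre => [|x c IH] pre.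
  by rewrite (big_tuple0 _ (fun f => coefs al [::] f * F (pre ++ map E f))) /= mul1r.
rewrite (big_tuple_cons _ _ (fun f => coefs al (x :: c) f * F (pre ++ map E f))) /=.
rewrite {1}[x]hE mlin_sum; apply: eq_bigr => a _.
rewrite -cat_rcons IH big_distrr /=; apply: eq_bigr => f _.
by rewrite cat_rcons mulrA.
Qed.

Hypothesis aF : alternating.

Lemma alt_swap c1 c2 x y : F (c1 ++ x :: y :: c2) = - F (c1 ++ y :: x :: c2).
Proof.
have h z : F (c1 ++ z :: (x + y) :: c2) = F (c1 ++ z :: x :: c2) + F (c1 ++ z :: y :: c2).
  by rewrite -!(cat_rcons z) mlinD.
have := aF c1 c2 (x + y); rewrite mlinD !h !aF add0r addr0 => /eqP.
by rewrite addr_eq0 => /eqP.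
Qed.

Lemma alt_dup c1 c2 c3 x : F (c1 ++ x :: c2 ++ x :: c3) = 0.
Proof.
elim: c2 c1 => [|y c2 IH] c1 /=; first exact: aF.
by rewrite alt_swap -cat_rcons IH oppr0.
Qed.

Lemma alt_uniq (T : eqType) (E : T -> V) (f : seq T) : F (map E f) != 0 -> uniq f.
Proof.
rewrite -[map E f]cat0s; elim: f {1}[::] => [|a f IH] pre //=.
rewrite -cat_rcons => /[dup] h /IH ->; rewrite andbT; apply/negP => /splitPr e.
by move: h; case: e => f1 f2; rewrite map_cat cat_rcons alt_dup eqxx.
Qed.
End Multilinear.

Section AdjacentTranspositions.
Variable k : nat.

Lemma adjacent_perm_ind (P : 'S_k -> Prop) :
  P 1%g -> (forall s t, P s -> P t -> P (s * t)%g) ->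
  (forall i j : 'I_k, val j = (val i).+1 -> P (tperm i j)) -> forall s, P s.
Proof.
move=> P1 PM Pa.
(* Induction on the distance: with l just before j, the transposition (i j) is the conjugate of (i
   l) by the adjacent (l j). *)
have Pt d (i j : 'I_k) : val j = (val i + d)%N -> P (tperm i j).
  elim: d i j => [|d IH] i j /= e.
    by rewrite (_ : j = i) ?tperm1 //; apply: val_inj; rewrite /= e addn0.
  have lt : (i + d < k)%N by have := ltn_ord j; lia.
  pose l := Ordinal lt; have Plj : P (tperm l j) by apply: Pa; rewrite /= e addnS.
  case: (posnP d) => d0.
    by apply: Pa; rewrite /= e d0 addn1.
  have li : l != i by apply/eqP => /(congr1 val) /=; lia.
  have ji : j != i by apply/eqP => /(congr1 val) /=; lia.
  have -> : tperm i j = (tperm l j * tperm i l * tperm l j)%g.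
    by rewrite -{1}(tpermV l j) -mulgA -/(conjg _ _) tpermJ tpermL tpermD.
  by apply: (PM) => //; apply: (PM) => //; apply: IH.
have Pt2 (i j : 'I_k) : P (tperm i j).
  case: (leqP i j) => h; first by apply: (Pt (j - i)%N); rewrite /=; lia.
  by rewrite tpermC; apply: (Pt (i - j)%N); rewrite /=; lia.
move=> s; have [ts -> _] := prod_tpermP s.
by elim: ts => [|t ts IH]; rewrite ?big_nil ?big_cons //; apply: (PM).
Qed.

Lemma map_tperm_adjacent (T : Type) (f : 'I_k -> T) (i j : 'I_k) : val j = (val i).+1 ->
  exists c1 c2, [seq f x | x <- enum 'I_k] = c1 ++ f i :: f j :: c2 /\
    [seq f (tperm i j x) | x <- enum 'I_k] = c1 ++ f j :: f i :: c2.
Proof.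
move=> e; have ltj := ltn_ord j.
have [p1 [p2 ee]] : exists p1 p2, enum 'I_k = p1 ++ i :: j :: p2.
  exists (take i (enum 'I_k)), (drop i.+2 (enum 'I_k)).
  rewrite -{1}(cat_take_drop i (enum 'I_k)); congr (_ ++ _).
  rewrite (drop_nth i) ?size_enum_ord ?nth_ord_enum //; congr (_ :: _).
  by rewrite -e (drop_nth i) ?size_enum_ord ?nth_ord_enum.
have := enum_uniq 'I_k; rewrite ee cat_uniq /= !inE !negb_or.
case/and4P=> _ /and3P[i1 j1 _] /andP[_ i2] /andP[j2 _].
exists (map f p1), (map f p2); rewrite !map_cat /= tpermL tpermR.
split=> //; congr (_ ++ _ :: _ :: _); apply/eq_in_map => x hx;
  rewrite tpermD //; apply: contraTneq hx => <- //.
Qed.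

Lemma alt_perm (K : fieldType) (V : lmodType K) (F : seq V -> K) (f : 'I_k -> V) (s : 'S_k) :
  multilinear F -> alternating F ->
  F [seq f (s x) | x <- enum 'I_k] = (-1) ^+ s * F [seq f x | x <- enum 'I_k].
Proof.
move=> lF aF; move: s f; apply: adjacent_perm_ind.
- by move=> f; rewrite odd_perm1 mul1r; congr F; apply: eq_map => x; rewrite perm1.
- move=> s t hs ht f; rewrite odd_permM signr_addb -mulrA.
  rewrite -[X in _ = _ * X](ht f) -(hs (fun x => f (t x))).
  by congr F; apply: eq_map => x; rewrite permM.
- move=> i j /= e f; have [c1 [c2 [-> ->]]] := map_tperm_adjacent f e.
  rewrite odd_tperm (_ : (i != j)%g = true) ?expr1 ?mulN1r; first exact: alt_swap.
  by apply/eqP => /(congr1 val) /=; lia.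
Qed.
End AdjacentTranspositions.

(** * The symplectic form and the dual tensor *)

Section SymplecticForm.
Variables (K : fieldType) (m : nat).
Local Notation L := 'I_(m.*2).

Lemma dualIK : involutive (@dualI m).
Proof. exact: rev_ordK. Qed.

Lemma val_dualI (a : L) : dualI a = (m.*2.-1 - a)%N :> nat.
Proof. by rewrite /=; case: a => a /= lta; lia. Qed.

Lemma eps_dual (a : L) : eps K (dualI a) = - eps K a.
Proof.
rewrite /eps /=; case: a => a /= lta; case: ltnP => h1; case: ltnP => h2; rewrite ?opprK //; lia.
Qed.

Lemma epsM (a : L) : eps K a * eps K a = 1.
Proof. by rewrite /eps; case: ifP => _; rewrite ?mulrNN mul1r. Qed.

Lemma form_dual (a b : L) : form K a b = eps K a * (a == dualI b)%:R.
Proof. by rewrite /form -[b == _](inj_eq (inv_inj dualIK)) dualIK eq_sym. Qed.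

Lemma form_skew (a b : L) : form K b a = - form K a b.
Proof.
rewrite form_dual /form; case: (b =P dualI a) => [->|_]; last by rewrite !mulr0 oppr0.
by rewrite eps_dual mulNr.
Qed.

Lemma JmxT : (Jmx K m)^T = - Jmx K m.
Proof. by apply/matrixP => a b; rewrite !mxE form_skew. Qed.

Lemma JmxK : Jmx K m *m Jmx K m = - 1%:M.
Proof.
apply/matrixP => a b; rewrite !mxE (bigD1 (dualI a)) //= big1 ?addr0 => [|c nc]; last first.
  by rewrite !mxE {1}/form (negbTE nc) mulr0 mul0r.
rewrite !mxE /form eqxx mulr1 dualIK eps_dual mulrA mulrN epsM mulN1r eq_sym.
by case: eqP.
Qed.

Lemma isSp_tr (g : 'M[K]_(m.*2)) : isSp g -> g^T *m Jmx K m *m g = Jmx K m.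
Proof.
rewrite /isSp => h.
have h1 : g *m (- (Jmx K m *m g^T *m Jmx K m)) = 1%:M.
  by rewrite mulmxN !mulmxA h JmxK opprK.
have := mulmx1C h1; rewrite mulNmx => h2.
have : Jmx K m *m (- (Jmx K m *m g^T *m Jmx K m *m g)) = Jmx K m *m 1%:M by rewrite h2.
by rewrite mulmxN !mulmxA JmxK !mulNmx mul1mx opprK mulmx1.
Qed.

Lemma isSp_J : isSp (Jmx K m).
Proof. by rewrite /isSp JmxT mulmxN JmxK mulNmx mul1mx opprK. Qed.

(** Chosen so that sum_k v_k (x) v_k^* equals sum_b [dv b] (x) v_b. *)
Definition dv (b : L) : 'rV[K]_(m.*2) := \row_a form K a b.
Definition ev (a : L) : 'rV[K]_(m.*2) := delta_mx 0 a.

Lemma evE a b : ev a 0 b = (b == a)%:R.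
Proof. by rewrite mxE. Qed.

Lemma ev_expand (x : 'rV[K]_(m.*2)) : x = \sum_a x 0 a *: ev a.
Proof. exact: row_sum_delta. Qed.

Lemma dv_ev b : dv b = - eps K b *: ev (dualI b).
Proof.
apply/rowP => a; rewrite !mxE form_dual -eps_dual.
by case: eqP => [->|]; rewrite ?mulr0.
Qed.

(** Invariance of the dual tensor under g, read off at the letter [b] of its second factor. *)
Lemma dv_act (g : 'M[K]_(m.*2)) b : isSp g ->
  \sum_a g a b *: (dv a *m g) = dv b.
Proof.
move=> /isSp_tr h.
have e a : dv a = row a (Jmx K m)^T by apply/rowP => c; rewrite !mxE.
have -> : dv b = row b (g^T *m (Jmx K m)^T *m g).
  by rewrite JmxT mulmxN mulNmx h -JmxT e.
rewrite -mulmxA row_mul mulmx_sum_row; apply: eq_bigr => a _.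
by rewrite row_mul e !mxE.
Qed.
End SymplecticForm.

(** * Tensors attached to a single column *)

Section ColumnTensors.
Variables (K : fieldType) (m : nat).
Local Notation L := 'I_(m.*2).
Local Notation V := 'rV[K]_(m.*2).

(* Contraction by the [b]-th coordinate; [pre] holds the vectors already passed, hence the sign. *)
Fixpoint ad (F : seq V -> K) (pre c : seq V) (b : L) : K :=
  if c is x :: c' then x 0 b * F (pre ++ c') - ad F (rcons pre x) c' b else 0.

(* A history lists, latest step first, the column acted on and whether it grows.
   [Z j s] maps the exterior power [/\^k V], [k] the height of column [j], to tensors:
   growing steps are comultiplications, the others insert [sum_k v_k (x) v_k^*]. *)
Fixpoint Z (j : nat) (s : seq (nat * bool)) (c : seq V) (I : seq L) : K :=
  match s, I with
  | [::], [::] => (nilp c)%:R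
  | p :: s', b :: I' =>
      if p.1 != j then Z j s' c I'
      else if p.2 then ad (fun c' => Z j s' c' I') [::] c b
      else Z j s' (rcons c (dv K b)) I'
  | _, _ => 0
  end.

Lemma eq_ad F G pre c b : (forall c, F c = G c) -> ad F pre c b = ad G pre c b.
Proof. by move=> e; elim: c pre => [|x c IH] pre //=; rewrite e IH. Qed.

Lemma adZ F k pre c b : ad (fun c => F c * k) pre c b = ad F pre c b * k.
Proof. by elim: c pre => [|x c IH] pre /=; rewrite ?mul0r // IH mulrBl mulrA. Qed.

Lemma ad_lin_pre F p1 p2 c b a x y : multilinear F ->
  ad F (p1 ++ (a *: x + y) :: p2) c b = a * ad F (p1 ++ x :: p2) c b + ad F (p1 ++ y :: p2) c b.
Proof.
move=> lF; elim: c p2 => [|z c IH] p2 /=; first by rewrite mulr0 addr0.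
by rewrite -!catA !cat_cons lF !rcons_cat !rcons_cons IH; ring.
Qed.

Lemma ad_multilinear F pre b : multilinear F -> multilinear (fun c => ad F pre c b).
Proof.
move=> lF c1 c2 a x y; elim: c1 pre => [|z c1 IH] pre /=.
  by rewrite -!cats1 ad_lin_pre // !mxE; ring.
by rewrite !catA lF IH; ring.
Qed.

Lemma ad_alt_pre F p1 p2 c b x : alternating F -> ad F (p1 ++ x :: x :: p2) c b = 0.
Proof.
move=> aF; elim: c p2 => [|z c IH] p2 //=.
by rewrite -!catA !cat_cons aF !rcons_cat !rcons_cons IH; ring.
Qed.

Lemma ad_alternating F pre b : alternating F -> alternating (fun c => ad F pre c b).
Proof.
move=> aF c1 c2 x; elim: c1 pre => [|z c1 IH] pre /=.
  have -> : rcons (rcons pre x) x = pre ++ [:: x; x] by rewrite -!cats1 -catA.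
  by rewrite ad_alt_pre // cat_rcons; ring.
by rewrite !catA aF IH; ring.
Qed.

Lemma ad_ev_neq0 F pre (c : seq L) b : ad F pre (map (@ev K m) c) b != 0 ->
  exists c1 c2, c = c1 ++ b :: c2 /\ F (pre ++ map (@ev K m) (c1 ++ c2)) != 0.
Proof.
elim: c pre => [|x c IH] pre /=; first by rewrite eqxx.
rewrite evE; case: (eqVneq b x) => [<-|_].
  rewrite mul1r; case: (eqVneq (F (pre ++ map (@ev K m) c)) 0) => [->|h _]; last first.
    by exists [::], c.
  rewrite sub0r oppr_eq0 => /IH[c1 [c2 [-> h]]]; exists (b :: c1), c2; split=> //.
  by move: h; rewrite cat_rcons.
rewrite mul0r sub0r oppr_eq0 => /IH[c1 [c2 [-> h]]]; exists (x :: c1), c2; split=> //.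
by move: h; rewrite cat_rcons.
Qed.

Lemma Z_multilinear j s I : multilinear (fun c => Z j s c I).
Proof.
elim: s I => [|[j' d] s IH] [|b I] c1 c2 a x y //=; rewrite ?mulr0 ?addr0 //.
  by case: c1 => [|? ?]; rewrite /= mulr0 addr0.
case: ifP => _; first exact: IH; case: ifP => _; last by rewrite !rcons_cat !rcons_cons IH.
exact: ad_multilinear.
Qed.

Lemma Z_alternating j s I : alternating (fun c => Z j s c I).
Proof.
elim: s I => [|[j' d] s IH] [|b I] c1 c2 x //=; first by case: c1.
case: ifP => _; first exact: IH; case: ifP => _; last by rewrite rcons_cat !rcons_cons IH.
exact: ad_alternating.
Qed.

Fixpoint colsum (j : nat) (s : seq (nat * bool)) (I : seq L) : nat :=
  match s, I with
  | p :: s', b :: I' => (p.1 == j) * b + colsum j s' I'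
  | _, _ => 0
  end.

Lemma rcons_dv F c b : multilinear F ->
  F (rcons (map (@ev K m) c) (dv K b)) = - eps K b * F (map (@ev K m) (rcons c (dualI b))).
Proof. by move=> lF; rewrite -cats1 dv_ev mlinZ // map_rcons -cats1. Qed.

(** A letter read at a growing step leaves the column, while a letter [b] read at a shrinking step
    brings in [dualI b]; a letter and its dual add up to 2m-1, and the column must be empty at the
    end. *)
Lemma Z_homogeneous j s (c : seq L) I : Z j s (map (@ev K m) c) I != 0 ->
  colsum j s I = (sumn (map val c) + count_mem (j, false) s * m.*2.-1)%N.
Proof.
elim: s c I => [|[j' d] s IH] c [|b I] //=; rewrite ?eqxx //.
  by case: c => //=; rewrite eqxx.
case: (eqVneq j' j) => [->|nj] /=; last by rewrite !xpair_eqE (negbTE nj) /= !add0n; apply: IH.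
case: d => /=; rewrite !xpair_eqE eqxx /=.
  move=> /ad_ev_neq0[c1 [c2 [-> /= /IH ->]]].
  by rewrite !map_cat /= !sumn_cat /=; lia.
rewrite (rcons_dv _ _ (Z_multilinear j s I)) mulf_eq0 negb_or => /andP[_ /IH ->].
rewrite map_rcons sumn_rcons /=.
have : (b < m.*2)%N by []. lia.
Qed.

Lemma Z_uniq j s (c : seq L) I : Z j s (map (@ev K m) c) I != 0 -> uniq c.
Proof. exact: (alt_uniq (Z_multilinear j s I) (Z_alternating j s I)). Qed.
End ColumnTensors.
Arguments Z_multilinear {K m} j s I.
Arguments Z_alternating {K m} j s I.

Lemma sumn_uniq (s : seq nat) : uniq s ->
  (sumn (iota 0 (size s)) <= sumn s)%N /\
  (sumn s = sumn (iota 0 (size s)) -> all (fun x => x < size s)%N s).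
Proof.
move: {2}(size s) (erefl (size s)) => k; elim: k s => [|k IH] s.
  by case: s.
move=> sk us; have [x xs xk] : exists2 x, x \in s & (k <= x)%N.
  apply/hasP/negPn/negP => /hasPn h.
  have hs : {subset s <= iota 0 k} by move=> x /h; rewrite mem_iota -ltnNge.
  by have := uniq_leq_size us hs; rewrite size_iota sk ltnn.
have p := perm_to_rem xs; have e := perm_sumn p.
have sr : size (rem x s) = k by rewrite size_rem // sk.
have [h1 h2] := IH _ sr (rem_uniq x us).
rewrite sk -addn1 iotaD sumn_cat e /= add0n addn0; rewrite sr in h1 h2; split; first by lia.
move=> e2; rewrite (perm_all _ p) /= (_ : (x < k + 1)%N); last by lia.
by apply: sub_all (h2 _) => [y|]; lia.
Qed.

(** * Minors at the extremal letter sum *)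

Section TopComponent.
Variables (K : fieldType) (m : nat) (x0 : 'I_(m.*2)).
Local Notation L := 'I_(m.*2).
Local Notation V := 'rV[K]_(m.*2).

Definition nl (a : nat) : L := nth x0 (enum 'I_(m.*2)) a.
Definition can (k : nat) : seq V := [seq ev K (nl a) | a <- iota 0 k].

Lemma val_nl a : (a < m.*2)%N -> nl a = a :> nat.
Proof. exact: nth_enum_ord. Qed.

Lemma coefs_prod (T : Type) (al : V -> T -> K) (y0 : T) c (f : seq T) : size f = size c ->
  coefs al c f = \prod_(r < size c) al (nth 0 c r) (nth y0 f r).
Proof.
elim: c f => [|x c IH] [|a f] //=; first by rewrite big_ord0.
by move=> [e]; rewrite big_ord_recl /= IH.
Qed.

Definition minor (c : seq V) : K :=
  \det (\matrix_(r < size c, a < size c) (nth 0 c r) 0 (nl a)).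

(** In the expansion over basis vectors the surviving indices are distinct by alternation, so they
    sum to at least 0 + 1 + ... + (k-1), k being the length of [c]. *)
Lemma Z_ge j s (c : seq V) I : Z j s c I != 0 ->
  (sumn (iota 0 (size c)) + count_mem (j, false) s * m.*2.-1 <= colsum j s I)%N.
Proof.
have -> : Z j s c I = (fun c : seq V => Z j s c I) ([::] ++ c) by [].
rewrite (mlin_expand (Z_multilinear j s I) (E := @ev K m) (al := fun (x : V) (a : L) => x 0 a));
  last exact: ev_expand.
case: (pickP (fun f : (size c).-tuple L => Z j s (map (@ev K m) f) I != 0)) => [f hf _|h].
  have um : uniq (map val f) by rewrite map_inj_uniq ?(Z_uniq hf) //; exact: val_inj.
  have [+ _] := sumn_uniq um.
  by rewrite size_map size_tuple (Z_homogeneous hf) leq_add2r.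
rewrite big1 ?eqxx // => f _; have := h f; move/negbFE/eqP => /= ->; exact: mulr0.
Qed.

(** At the minimal letter sum the surviving indices are distinct with minimal sum, hence a
    permutation of the first k letters; the signs of these permutations assemble the determinant. *)
Lemma Z_top j s (c : seq V) I : (size c <= m.*2)%N ->
  colsum j s I = (sumn (iota 0 (size c)) + count_mem (j, false) s * m.*2.-1)%N ->
  Z j s c I = minor c * Z j s (can (size c)) I.
Proof.
move=> kc cs; have -> : Z j s c I = (fun c : seq V => Z j s c I) ([::] ++ c) by [].
rewrite (mlin_expand (Z_multilinear j s I) (E := @ev K m) (al := fun (x : V) (a : L) => x 0 a));
  last exact: ev_expand.
pose h (p : 'S_(size c)) := [tuple nl (p r) | r < size c].
have nlI (a b : nat) : (a < size c)%N -> (b < size c)%N -> nl a = nl b -> a = b.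
  by move=> ha hb /(congr1 val) /=; rewrite !val_nl //; lia.
have hI : injective h.
  move=> p q /(congr1 (fun t => tnth t)) e; apply/permP => r; apply: val_inj.
  by apply: nlI; rewrite ?ltn_ord //; have := congr1 (@^~ r) e; rewrite !tnth_mktuple.
rewrite (bigID (fun f => f \in [set h p | p in [set: 'S_(size c)]])) /= [X in _ + X]big1 ?addr0.
  have hn p (r : 'I_(size c)) : nth x0 (h p) r = nl (p r) by rewrite -tnth_nth tnth_mktuple.
  rewrite big_imset; last by move=> p q _ _; exact: hI.
  rewrite /minor mulr_suml [LHS](eq_bigl xpredT) => [|p]; last by rewrite inE.
  apply: eq_bigr => p _; rewrite (coefs_prod _ x0) ?size_tuple //.
  rewrite (eq_bigr (fun r : 'I_(size c) => c`_r 0 (nl (p r)))); last first.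
    by move=> r _; congr (_ 0 _); exact: hn.
  under [in RHS]eq_bigr => r _ do rewrite mxE.
  rewrite mulrC -[RHS]mulrA [RHS]mulrCA [RHS]mulrC; congr (_ * _).
  rewrite /= -map_comp (alt_perm (fun r : 'I_(size c) => ev K (nl r)) p
     (Z_multilinear j s I) (Z_alternating j s I)).
  by congr (_ * _); rewrite /can -val_enum_ord -map_comp.
move=> f hf; apply/eqP; rewrite mulf_eq0; apply/orP; right; apply/negPn/negP => hZ.
have uf := Z_uniq hZ.
have um : uniq (map val f) by rewrite map_inj_uniq //; exact: val_inj.
have [_ h2] := sumn_uniq um.
have {h2} : all (fun x => x < size c)%N (map val f).
  have sz : size (map val f) = size c by rewrite size_map size_tuple.
  rewrite sz in h2; apply: h2; have := Z_homogeneous hZ; rewrite cs.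
  by move/eqP; rewrite eqn_add2r => /eqP.
rewrite all_map => /all_tnthP /= hlt.
case/negP: hf; apply/imsetP.
have gI : injective (fun r => Ordinal (hlt r)).
  move=> r r' /(congr1 val) /= e; apply/val_inj/eqP => /=.
  rewrite -(nth_uniq x0 _ _ uf) ?size_tuple ?ltn_ord //.
  by rewrite -!tnth_nth; apply/eqP/val_inj.
exists (perm gI); first by rewrite inE.
apply: eq_from_tnth => r; rewrite tnth_mktuple permE /=.
by apply: val_inj; rewrite /= val_nl //; apply: leq_trans (hlt r) kc.
Qed.
End TopComponent.

(** * Products of column tensors and their equivariance *)

Section TableauTensors.
Variables (K : fieldType) (m M : nat).
Local Notation L := 'I_(m.*2).
Local Notation V := 'rV[K]_(m.*2).

Definition ytens (s : seq (nat * bool)) (W : nat -> seq V) (I : seq L) : K :=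
  \prod_(j < M) Z j s (W j) I.

Definition upd (W : nat -> seq V) (j : nat) (c : seq V) : nat -> seq V :=
  fun k => if k == j then c else W k.

Lemma eq_ytens s W W' I : (forall j, (j < M)%N -> W j = W' j) -> ytens s W I = ytens s W' I.
Proof. by move=> e; apply: eq_bigr => j _; rewrite e. Qed.

Lemma ytens_upd s W j c I : (j < M)%N ->
  ytens s (upd W j c) I = Z j s c I * \prod_(k < M | k != j :> nat) Z k s (W k) I.
Proof.
move=> jM; rewrite /ytens (bigD1 (Ordinal jM)) //= {1}/upd eqxx; congr (_ * _).
have nk k : (k != Ordinal jM) = (k != j :> nat) by rewrite -(inj_eq val_inj).
by apply: eq_big => // k; rewrite nk /upd => /negbTE->.
Qed.

Lemma ytens_multilinear s W j I : (j < M)%N -> multilinear (fun c => ytens s (upd W j c) I).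
Proof.
move=> jM c1 c2 a x y; rewrite !ytens_upd // (Z_multilinear j s I); ring.
Qed.

Lemma ytens_add j s W b I : (j < M)%N ->
  ytens ((j, true) :: s) W (b :: I) = ad (fun c => ytens s (upd W j c) I) [::] (W j) b.
Proof.
move=> jM; rewrite (eq_ad _ _ _ (fun c => ytens_upd s W c I jM)) adZ.
rewrite /ytens (bigD1 (Ordinal jM)) //= eqxx /=; congr (_ * _).
have nk k : (k != Ordinal jM) = (k != j :> nat) by rewrite -(inj_eq val_inj).
by apply: eq_big => // k; rewrite nk /= eq_sym => ->.
Qed.

Lemma ytens_rem j s W b I : (j < M)%N ->
  ytens ((j, false) :: s) W (b :: I) = ytens s (upd W j (rcons (W j) (dv K b))) I.
Proof.
move=> jM; rewrite ytens_upd // /ytens (bigD1 (Ordinal jM)) //= eqxx /=; congr (_ * _).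
have nk k : (k != Ordinal jM) = (k != j :> nat) by rewrite -(inj_eq val_inj).
by apply: eq_big => // k; rewrite nk /= eq_sym => ->.
Qed.

Lemma ytens_nil W : ytens [::] W [::] = [forall j : 'I_M, nilp (W j)]%:R.
Proof.
rewrite /ytens; case: forallP => /= [h|h]; first by rewrite big1 // => j _; rewrite h.
apply/eqP; rewrite prodf_seq_eq0; apply/hasP.
have /existsP[j hj] : [exists j : 'I_M, ~~ nilp (W j)] by rewrite -negb_forall; apply/forallP.
by exists j; rewrite ?mem_index_enum //= (negbTE hj).
Qed.

Section Equivariance.
Variable g : 'M[K]_(m.*2).

Fixpoint gw (I' I : seq L) : K :=
  match I', I with b' :: I1, b :: I2 => g b' b * gw I1 I2 | _, _ => 1 end.

Definition tact (N : nat) (F : seq L -> K) (I : seq L) : K :=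
  \sum_(I' : N.-tuple L) F I' * gw I' I.

Lemma ad_tact N (F : seq L -> seq V -> K) G I pre c b :
  (forall c, \sum_(I' : N.-tuple L) F I' c * gw I' I = G (map (mulmxr g) c)) ->
  \sum_b' \sum_(I' : N.-tuple L) ad (F I') pre c b' * (g b' b * gw I' I) =
  ad G (map (mulmxr g) pre) (map (mulmxr g) c) b.
Proof.
move=> hF; elim: c pre => [|x c IH] pre /=.
  by rewrite big1 // => b' _; rewrite big1 // => I' _; rewrite mul0r.
rewrite -map_rcons -IH -map_cat -hF mxE mulr_suml -sumrB.
apply: eq_bigr => b' _; rewrite mulr_sumr -sumrB; apply: eq_bigr => I' _; ring.
Qed.

(** Contractions commute with every matrix g ([ad_tact]); symplecticity enters at the insertions,
    through [dv_act]. *)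
Lemma ytens_equivariant s W I : isSp g -> size I = size s -> all (fun p => p.1 < M)%N s ->
  tact (size s) (ytens s W) I = ytens s (fun j => map (mulmxr g) (W j)) I.
Proof.
move=> sg; elim: s W I => [|[j d] s IH] W [|b I] //=.
  rewrite /tact (big_tuple0 _ (fun I' => ytens [::] W I' * gw I' [::])) /= mulr1 => _ _.
  by rewrite !ytens_nil; congr (nat_of_bool _)%:R; apply: eq_forallb => j; rewrite /nilp size_map.
move=> [sI] /andP[jM hs].
have eU c : ytens s (fun k => map (mulmxr g) (upd W j c k)) I =
            ytens s (upd (fun k => map (mulmxr g) (W k)) j (map (mulmxr g) c)) I.
  by apply: eq_ytens => k _; rewrite /upd; case: eqP.
rewrite /tact (big_tuple_cons _ _ (fun I' => ytens ((j, d) :: s) W I' * gw I' (b :: I))) /=.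
case: d.
  rewrite ytens_add // -[[::]]/(map (mulmxr g) [::]).
  rewrite -(@ad_tact (size s) (fun I' c => ytens s (upd W j c) I') _ I); last first.
    by move=> c; rewrite -eU -IH.
  by apply: eq_bigr => b' _; apply: eq_bigr => I' _; rewrite ytens_add.
rewrite ytens_rem // -[dv K b](dv_act _ sg) -cats1 (mlin_sum (ytens_multilinear _ _ _ jM)).
apply: eq_bigr => b' _; rewrite cats1.
have -> : rcons (map (mulmxr g) (W j)) (dv K b' *m g) =
          map (mulmxr g) (rcons (W j) (dv K b')) by rewrite map_rcons.
rewrite -eU -IH // /tact mulr_sumr; apply: eq_bigr => I' _.
by rewrite ytens_rem //; ring.
Qed.
End Equivariance.
End TableauTensors.

(** * Column heights of a partition *)

Section Heights.
Variable m : nat.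
Implicit Types lam : nat -> nat.

Definition height lam (j : nat) : nat := count (fun r => j < lam r)%N (iota 0 m).

Lemma height_le lam j : (height lam j <= m)%N.
Proof. by rewrite -[X in (_ <= X)%N](size_iota 0 m) count_size. Qed.

Lemma ltn_height lam j r : decreasing lam -> (r < m)%N -> (r < height lam j)%N = (j < lam r)%N.
Proof.
rewrite /height => d; elim: m => [|k IH] //; rewrite ltnS => hr.
rewrite -[k.+1]addn1 iotaD count_cat /= add0n addn0.
case: (boolP (j < lam k)%N) => h.
  have -> : count (fun r => j < lam r)%N (iota 0 k) = k.
    rewrite -[RHS](size_iota 0 k); apply/eqP; rewrite -all_count; apply/allP => t.
    rewrite mem_iota add0n => /andP[_ /ltnW ht]; exact: leq_trans h (decreasing_le d ht).
  by rewrite addn1 ltnS hr; apply/esym/(leq_trans h)/decreasing_le.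
rewrite addn0; move: hr; rewrite leq_eqVlt => /orP[/eqP->|hr]; last exact: IH.
rewrite (negbTE h) -[X in (X < _)%N](size_iota 0 k); apply/negbTE.
by rewrite -leqNgt count_size.
Qed.

Lemma height_eq lam j k : decreasing lam -> (k <= m)%N ->
  (forall r, (r < m)%N -> (j < lam r)%N = (r < k)%N) -> height lam j = k.
Proof.
move=> d km h; have hm := height_le lam j.
apply/eqP; rewrite eqn_leq; apply/andP; split; rewrite leqNgt; apply/negP => hlt.
  by have := ltn_height j d (leq_trans hlt hm); rewrite h ?hlt ?ltnn //; lia.
by have := ltn_height j d (leq_trans hlt km); rewrite h ?hlt ?ltnn //; lia.
Qed.

Lemma height_incr lam i j : (i < m)%N -> decreasing lam -> decreasing (incr lam i) ->
  height (incr lam i) j = (height lam j + (j == lam i))%N /\ height lam (lam i) = i.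
Proof.
move=> im d d'; have hi : height lam (lam i) = i.
  apply: height_eq => // [|r rm]; first exact: ltnW.
  apply/idP/idP => h; rewrite ltnNge; apply/negP => h1.
    by have := decreasing_le d h1; lia.
  by have := decreasing_le d' (ltnW h); rewrite /incr; lia.
split=> //; have hm := height_le lam j; case: eqP => [->|ne].
  rewrite hi addn1; apply: height_eq => // r rm; rewrite /incr.
  have hr : (lam i < lam r)%N = (r < i)%N by rewrite -(ltn_height _ d) // hi.
  by case: (r =P i) hr => [->|]; lia.
rewrite addn0; apply: height_eq => // r rm; rewrite (ltn_height _ d) // /incr.
by case: (r =P i) => [->|]; lia.
Qed.

Lemma height_decr lam i j : (i < m)%N -> decreasing lam -> decreasing (decr lam i) ->
  (lam i.+1 < lam i)%N ->
  height lam j = (height (decr lam i) j + (j == (lam i).-1))%N /\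
  height (decr lam i) (lam i).-1 = i.
Proof.
move=> im d d' h; have e r : incr (decr lam i) i r = lam r.
  by rewrite /incr /decr; case: (r =P i) => [->|]; lia.
have d2 : decreasing (incr (decr lam i) i) by move=> r; rewrite !e; exact: d.
have [h1 h2] := height_incr j im d' d2; move: h1 h2.
have -> : decr lam i i = (lam i).-1 by rewrite /decr eqxx subn1.
by move=> <- ->; split=> //; apply: eq_count => r; rewrite e.
Qed.
End Heights.

(** * Leading words of the tensors *)

Section Leading.
Variables (K : fieldType) (m M : nat) (x0 : 'I_(m.*2)).
Local Notation L := 'I_(m.*2).
Local Notation V := 'rV[K]_(m.*2).

(** Columns are numbered from 0: a box added to a row of length l falls in column l, a box removed
    from it lies in column l-1. *)
Fixpoint hist (w : seq L) : seq (nat * bool) :=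
  if w is a :: w' then
    (if (a < m)%N then (sh w' a, true) else ((sh w' (dualI a)).-1, false)) :: hist w'
  else [::].

Definition rems (w : seq L) : nat := count (fun a : L => m <= a)%N w.

Lemma size_hist w : size (hist w) = size w.
Proof. by elim: w => //= a w ->. Qed.

Lemma hist_cols w : (size w <= M)%N -> lat w -> all (fun p => p.1 < M)%N (hist w).
Proof.
elim: w => [|a w IH] //= sw /andP[lw la]; rewrite IH ?andbT //; last exact: ltnW.
case: ifP la => am la /=; apply: leq_trans sw; rewrite ltnS; first exact: sh_le_size.
exact: leq_trans (leq_pred _) (sh_le_size w _).
Qed.

Lemma count_rem_hist w : count (fun p => ~~ p.2) (hist w) = rems w.
Proof.
elim: w => [|a w IH] //=; rewrite IH; congr (_ + _)%N.
by rewrite [(m <= a)%N]leqNgt; case: (a < m)%N.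
Qed.

Definition Wcan (lam : nat -> nat) (j : nat) : seq V := can K x0 (height m lam j).

(* Base [m.*2], the head being the most significant digit. *)
Fixpoint enc (w : seq L) : nat := if w is a :: w' then a * m.*2 ^ size w' + enc w' else 0.

Lemma enc_lt w : (enc w < m.*2 ^ size w)%N.
Proof.
elim: w => [|a w IH] //=; have : (a < m.*2)%N by [].
by rewrite expnS; move: (m.*2 ^ size w)%N IH => e; nia.
Qed.

Lemma enc_inj w w' : size w = size w' -> enc w = enc w' -> w = w'.
Proof.
elim: w w' => [|a w IH] [|a' w'] //= [sw]; rewrite sw => e.
have l1 := enc_lt w; have l2 := enc_lt w'; rewrite sw in l1.
have ea : a = a' :> nat.
  by apply/eqP; rewrite eqn_leq; apply/andP; split; rewrite leqNgt; apply/negP;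
    move: (m.*2 ^ size w')%N l1 l2 e => E; nia.
by rewrite (IH w') // ?(val_inj ea) //; move: e; rewrite ea => /addnI.
Qed.

Lemma ad_last F pre (c : seq L) b : b \notin c ->
  ad F pre (map (@ev K m) (rcons c b)) b = (-1) ^+ size c * F (pre ++ map (@ev K m) c).
Proof.
elim: c pre => [|x c IH] pre /=; first by rewrite evE eqxx !mul1r subr0.
rewrite inE negb_or => /andP[nx nc]; rewrite IH // evE (negbTE nx) mul0r sub0r.
by rewrite cat_rcons exprS mulN1r mulNr.
Qed.

Lemma can_rcons k : can K x0 k.+1 = map (@ev K m) (rcons (map (nl x0) (iota 0 k)) (nl x0 k)).
Proof. by rewrite /can -[k.+1]addn1 iotaD map_cat map_rcons -cats1 -map_comp. Qed.

Lemma can_map k : can K x0 k = map (@ev K m) (map (nl x0) (iota 0 k)).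
Proof. by rewrite /can -map_comp. Qed.

Lemma nl_inj k l : (k < m.*2)%N -> (l < m.*2)%N -> nl x0 k = nl x0 l -> k = l.
Proof. by move=> hk hl /(congr1 val) /=; rewrite !val_nl. Qed.

Lemma nl_val (a : L) : nl x0 a = a.
Proof. by apply: val_inj; rewrite /= val_nl. Qed.

Lemma mem_nl_iota (b : L) k : (k <= m.*2)%N -> (b \in map (nl x0) (iota 0 k)) = (b < k)%N.
Proof.
move=> km; apply/mapP/idP => [[r]|h]; last by exists (val b); rewrite ?mem_iota ?nl_val.
by rewrite mem_iota add0n => /andP[_ rk] ->; rewrite val_nl //; lia.
Qed.

(** If [a] adds a box, the column is v_0, ..., v_a, so only letters up to [a] can be contracted. If
    it removes one from row i = [dualI a], the column v_0, ..., v_(i-1) is joined by a multiple of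
    v_(dualI b), and alternation forces [dualI b] to be at least i, that is, [b] at most [a]. At
    [b = a] the canonical columns of [w] remain, up to a unit. *)
Lemma leading_step a w : lat (a :: w) -> (size w < M)%N ->
  exists2 sg : K, sg != 0 &
  forall b I, size I = size w -> (ytens M (hist (a :: w)) (Wcan (sh (a :: w))) (b :: I) != 0 ->
    (b <= a)%N) /\
    ytens M (hist (a :: w)) (Wcan (sh (a :: w))) (a :: I) = sg * ytens M (hist w) (Wcan (sh w)) I.
Proof.
move=> /[dup] /lat_sh [d' z'] /= /andP[/lat_sh [d z] la] sM.
rewrite /= in d' z'; have hm := height_le m.
case: (ltnP a m) la d' z' => am la d' z'.
  have jM : (sh w a < M)%N by apply: leq_ltn_trans sM; apply: sh_le_size.
  have hj j := height_incr j am d d'.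
  have Wj : Wcan (incr (sh w) a) (sh w a) = can K x0 a.+1.
    by rewrite /Wcan (hj _).1 (hj 0%N).2 eqxx addn1.
  have eW I : ytens M (hist w) (upd (Wcan (incr (sh w) a)) (sh w a) (can K x0 a)) I
     = ytens M (hist w) (Wcan (sh w)) I.
    apply: eq_ytens => j _; rewrite /upd /Wcan; case: eqP => [->|/eqP/negbTE ne].
      by rewrite (hj 0%N).2.
    by rewrite (hj _).1 ne addn0.
  exists ((-1) ^+ a) => [|b I sI]; first by rewrite signr_eq0.
  rewrite !ytens_add // Wj; split=> [|]; last first.
    rewrite can_rcons nl_val ad_last ?size_map ?size_iota -?can_map ?eW //.
    by rewrite mem_nl_iota ?ltnn //; lia.
  rewrite can_map => /ad_ev_neq0[c1 [c2 [e _]]].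
  have : b \in map (nl x0) (iota 0 a.+1) by rewrite e mem_cat inE eqxx orbT.
  by rewrite mem_nl_iota //; lia.
change (m.*2 - a.+1)%N with (nat_of_ord (dualI a)) in *.
have lta := ltn_ord a; set i := dualI a in la d' z' *; have im : (i < m)%N by rewrite /i /=; lia.
have jM : ((sh w i).-1 < M)%N.
  by apply: leq_ltn_trans sM; apply: leq_trans (leq_pred _) (sh_le_size _ _).
have hj j := height_decr j im d d' la.
have Wj : Wcan (decr (sh w) i) (sh w i).-1 = can K x0 i by rewrite /Wcan (hj 0%N).2.
have eW I : ytens M (hist w) (upd (Wcan (decr (sh w) i)) (sh w i).-1 (can K x0 i.+1)) I
   = ytens M (hist w) (Wcan (sh w)) I.
  apply: eq_ytens => j _; rewrite /upd /Wcan; case: eqP => [->|/eqP/negbTE ne].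
    by rewrite (hj _).1 (hj 0%N).2 eqxx addn1.
  by rewrite (hj _).1 ne addn0.
exists (- eps K a) => [|b I sI].
  by rewrite oppr_eq0 /eps; case: ifP => _; rewrite ?oppr_eq0 oner_eq0.
rewrite !ytens_rem // Wj; split=> [|]; last first.
  rewrite can_map (rcons_dv _ _ (ytens_multilinear _ _ _ jM)); congr (_ * _).
  by rewrite -/i -[X in rcons _ X](nl_val i) -can_rcons eW.
rewrite can_map (rcons_dv _ _ (ytens_multilinear _ _ _ jM)) mulf_eq0 negb_or => /andP[_].
rewrite ytens_upd // mulf_eq0 negb_or => /andP[/Z_uniq + _].
rewrite rcons_uniq mem_nl_iota => [/andP[+ _]|]; last by lia.
by have := ltn_ord b; rewrite /i /=; lia.
Qed.

Lemma leading_word w : lat w -> (size w <= M)%N -> ytens M (hist w) (Wcan (sh w)) w != 0.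
Proof.
elim: w => [|a w IH] lw sw.
  rewrite ytens_nil; case: forallP => [_|[]]; first exact: oner_neq0.
  move=> j; rewrite /Wcan (_ : height m _ _ = 0%N) //.
  by rewrite /height /= (eq_count (a2 := pred0)) ?count_pred0 // => r; rewrite ltn0.
have [sg sg0 /(_ a w erefl)[_ ->]] := leading_step lw sw.
rewrite mulf_neq0 // IH //; [by case/andP: lw | exact: ltnW].
Qed.

Lemma leading_enc w I : lat w -> (size w <= M)%N -> size I = size w ->
  ytens M (hist w) (Wcan (sh w)) I != 0 -> (enc I <= enc w)%N.
Proof.
elim: w I => [|a w IH] [|b I] //= lw sw [sI] h.
have [sg sg0 H] := leading_step lw sw.
have [/(_ h) hb _] := H b I sI; have [_ e2] := H a I sI.
have eb := enc_lt I; rewrite sI in eb; rewrite sI.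
move: hb; rewrite leq_eqVlt => /orP[/eqP/val_inj ba|ba].
  move: h; rewrite ba -/(hist (a :: w)) -/(sh (a :: w)) e2 mulf_eq0 negb_or => /andP[_ h].
  by rewrite leq_add2l IH //; [case/andP: lw | exact: ltnW].
by move: (m.*2 ^ size w)%N eb => E; nia.
Qed.
End Leading.

(** * Evaluation at words of small letter sum *)

Section Evaluation.
Variables (K : fieldType) (m M : nat) (x0 : 'I_(m.*2)).
Local Notation L := 'I_(m.*2).
Local Notation V := 'rV[K]_(m.*2).
Local Notation yw := (fun w W I => ytens M (hist w) W I).
Local Notation Wc := (Wcan K x0).

Definition tsum (I : seq L) : nat := sumn (map val I).

Lemma sum_colsum s (I : seq L) : size I = size s -> all (fun p => p.1 < M)%N s ->
  (\sum_(j < M) colsum j s I = tsum I)%N.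
Proof.
elim: s I => [|[j d] s IH] [|b I] //= => [_ _|[sI] /andP[jM hs]]; first by rewrite big1.
rewrite big_split /= IH //; congr (_ + _)%N.
rewrite (bigD1 (Ordinal jM)) //= eqxx mul1n big1 ?addn0 // => k.
by rewrite -(inj_eq val_inj) /= eq_sym => /negbTE->.
Qed.

Lemma val_can k : (k <= m.*2)%N -> map val (map (nl x0) (iota 0 k)) = iota 0 k.
Proof.
move=> km; rewrite -map_comp -[RHS]map_id; apply/eq_in_map => r.
by rewrite mem_iota add0n /= => h; rewrite val_nl //; lia.
Qed.

Lemma size_can k : size (can K x0 k) = k.
Proof. by rewrite size_map size_iota. Qed.

Definition colmin (w : seq L) (j : nat) : nat :=
  (sumn (iota 0 (height m (sh w) j)) + count_mem (j, false) (hist w) * m.*2.-1)%N.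

Lemma height_le2 lam j : (height m lam j <= m.*2)%N.
Proof. by have := height_le m lam j; lia. Qed.

Lemma colsum_can w I : ytens M (hist w) (Wc (sh w)) I != 0 ->
  forall j : 'I_M, colsum j (hist w) I = colmin w j.
Proof.
move=> h j; rewrite /colmin -(val_can (height_le2 (sh w) j)).
apply: (@Z_homogeneous K); move: h; rewrite /ytens prodf_seq_neq0 => /allP/(_ j).
by rewrite mem_index_enum -can_map => /(_ isT).
Qed.

Lemma tsum_lat w : lat w -> (size w <= M)%N -> tsum w = (\sum_(j < M) colmin w j)%N.
Proof.
move=> lw sw; rewrite -(sum_colsum _ (hist_cols sw lw)) ?size_hist //.
by apply: eq_bigr => j _; apply: colsum_can; apply: leading_word.
Qed.

Lemma tsum_can w I : lat w -> (size w <= M)%N -> size I = size w ->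
  ytens M (hist w) (Wc (sh w)) I != 0 -> tsum I = tsum w.
Proof.
move=> lw sw sI h; rewrite (tsum_lat lw sw) -(sum_colsum _ (hist_cols sw lw)) ?size_hist //.
by apply: eq_bigr => j _; apply: colsum_can.
Qed.

(** The bounds [colmin] add up to [tsum w]. So either some column sum of [I] is below its bound and
    both sides vanish, or all are equal to their bounds and [Z_top] applies in every column. *)
Lemma ytens_top w (W : nat -> seq V) I : lat w -> (size w <= M)%N -> size I = size w ->
  (forall j, size (W j) = height m (sh w) j) -> (tsum I <= tsum w)%N ->
  ytens M (hist w) W I =
  (\prod_(j < M) minor x0 (W j)) * ytens M (hist w) (Wc (sh w)) I.
Proof.
move=> lw sw sI hW; rewrite (tsum_lat lw sw) -(sum_colsum _ (hist_cols sw lw)) ?size_hist // => hs.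
case: (boolP [exists j : 'I_M, colsum j (hist w) I < colmin w j]%N) => [/existsP[[j jM] /= hj]|].
  have z (c : seq V) : size c = height m (sh w) j -> Z j (hist w) c I = 0 :> K.
    move=> hc; apply/eqP/negPn/negP => /Z_ge; rewrite hc leqNgt => /negP; exact.
  have y0 U : (forall k, size (U k) = height m (sh w) k) -> ytens M (hist w) U I = 0 :> K.
    by move=> hU; rewrite /ytens (bigD1 (Ordinal jM)) //= z // mul0r.
  by rewrite !y0 ?mulr0 // => k; rewrite size_can.
rewrite negb_exists => /forallP h.
have {}h (j : 'I_M) : (colmin w j <= colsum j (hist w) I)%N by have := h j; rewrite -leqNgt.
have e (j : 'I_M) : colsum j (hist w) I = colmin w j.
  apply/eqP; rewrite eqn_leq h andbT -subn_eq0; apply/eqP; move: j.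
  have : (\sum_(j < M) (colsum j (hist w) I - colmin w j) == 0)%N.
    by rewrite sumnB // subn_eq0.
  by rewrite sum_nat_eq0 => /forallP hj j; have := hj j; rewrite implyTb => /eqP.
rewrite /ytens -big_split; apply: eq_bigr => j _ /=.
by rewrite (Z_top x0 _ (I := I)) ?hW ?height_le2 // e.
Qed.
End Evaluation.

(** * A polynomial curve of unipotent symplectic matrices *)

Section Curve.
Variables (m : nat) (x0 : 'I_(m.*2)) (N : nat).
Local Notation L := 'I_(m.*2).

(* The order on letters for which symplectic tableaux are semistandard: v_1 < v_1' < v_2 < v_2' ... *)
Definition kidx (a : L) : nat := if (a < m)%N then a.*2 else (dualI a).*2.+1.

(* The exponents are spread so that the degrees of products of minors of [unip] determine
   the tableau indexing the rows. *)
Definition wt (i : nat) (a : L) : nat :=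
  if (i.*2 < kidx a)%N then (N ^ ((m - i) * m.*2 - kidx a))%N else 0%N.

Section Ring.
Variables (R : comNzRingType) (t : R).

(** A version of [Jmx] over rings: [unip] is used over polynomials to read degrees and over K to get
    elements of Sp(V). *)
Definition jm : 'M[R]_(m.*2) :=
  \matrix_(a, b) ((if (a < m)%N then 1 else -1) * (b == dualI a)%:R).

Definition pcol (i : nat) : 'cV[R]_(m.*2) :=
  \col_a (if (i.*2 < kidx a)%N then t ^+ wt i a else 0).
Definition pcol0 (i : nat) : 'cV[R]_(m.*2) :=
  \col_a (if (i.*2.+1 < kidx a)%N then t ^+ wt i a else 0).

(** The first correction puts [pcol i] into column [i]; the second restores symplecticity. [pcol0]
    drops the entry at the dual of [i], which would otherwise be counted twice and vanish in
    characteristic 2. *)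
Definition elem (i : nat) : 'M[R]_(m.*2) :=
  1%:M + pcol i *m delta_mx 0 (nl x0 i)
       - delta_mx (dualI (nl x0 i)) 0 *m ((pcol0 i)^T *m jm).

Fixpoint unip (k : nat) : 'M[R]_(m.*2) := if k is k'.+1 then elem (m - k)%N *m unip k' else 1%:M.
End Ring.

Lemma map_jm (R R' : comNzRingType) (f : {rmorphism R -> R'}) : map_mx f (jm R) = jm R'.
Proof.
apply/matrixP => a b; rewrite !mxE rmorphM /= rmorph_nat.
by case: ifP => _; rewrite ?rmorphN rmorph1.
Qed.

Lemma map_unip (R R' : comNzRingType) (f : {rmorphism R -> R'}) t k :
  map_mx f (unip t k) = unip (f t) k.
Proof.
elim: k => [|k IH] /=; first exact: map_mx1.
rewrite map_mxM IH; congr (_ *m _).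
have e1 i : map_mx f (pcol t i) = pcol (f t) i.
  by apply/matrixP => a b; rewrite !mxE; case: ifP; rewrite ?rmorphXn ?rmorph0.
have e2 i : map_mx f (pcol0 t i) = pcol0 (f t) i.
  by apply/matrixP => a b; rewrite !mxE; case: ifP; rewrite ?rmorphXn ?rmorph0.
by rewrite /elem map_mxB map_mxD !map_mxM /= -map_trmx !map_delta_mx map_jm map_mx1 e1 e2.
Qed.

Lemma kidx_dual (i : L) : (i < m)%N -> kidx i = i.*2 /\ kidx (dualI i) = i.*2.+1.
Proof.
move=> im; rewrite /kidx im; split=> //; rewrite dualIK ifF //.
by rewrite /=; case: i im => i /= h1 h2; lia.
Qed.

Lemma kidx_dual_lt (a : L) (i : nat) : (i.*2 <= kidx a)%N = (i.*2 <= kidx (dualI a))%N.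
Proof.
have h := ltn_ord a; rewrite /kidx; case: (ltnP a m) => am; case: (ltnP (dualI a) m);
  rewrite /= => am'; lia.
Qed.

Section Symplectic.
Variables (K : fieldType) (t : K) (i : nat).
Hypothesis im : (i < m)%N.
Local Notation J := (Jmx K m).
Local Notation a := (delta_mx (nl x0 i) 0 : 'cV[K]_(m.*2)).
Local Notation b := (delta_mx (dualI (nl x0 i)) 0 : 'cV[K]_(m.*2)).

(** Skewness would not suffice in characteristic 2; instead the terms at [c] and [dualI c]
    cancel. *)
Lemma J_alternating (x : 'cV[K]_(m.*2)) : x^T *m J *m x = 0.
Proof.
apply/matrixP => r s; rewrite mxE [RHS]mxE.
have e c : (x^T *m J) r c = - (eps K c * x (dualI c) 0).
  rewrite mxE (bigD1 (dualI c)) //= big1 ?addr0 => [|d nd]; last first.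
    by rewrite !mxE form_dual (negbTE nd) !mulr0.
  by rewrite !mxE form_dual eqxx mulr1 eps_dual mulrN mulrC (ord1 r).
rewrite (bigID (fun c : L => c < m)%N) /= [X in _ + X](reindex_inj (inv_inj (@dualIK m))) /=.
rewrite [X in _ + X](eq_bigl (fun c : L => c < m)%N) => [|c]; last first.
  by have := ltn_ord c; rewrite /=; lia.
rewrite -big_split big1 //= => c _; rewrite !e dualIK eps_dual (ord1 s); ring.
Qed.

Lemma val_i : nl x0 i = i :> nat.
Proof. by rewrite val_nl //; lia. Qed.

Lemma kidx_i : kidx (nl x0 i) = i.*2 /\ kidx (dualI (nl x0 i)) = i.*2.+1.
Proof. by have := @kidx_dual (nl x0 i); rewrite val_i => /(_ im). Qed.

Lemma tr_a : a^T = delta_mx 0 (nl x0 i).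
Proof. by rewrite trmx_delta. Qed.

Lemma aJ : a^T *m J = b^T.
Proof.
apply/matrixP => r c; rewrite tr_a -rowE !mxE /form /eps val_i im mul1r (ord1 r) eqxx andbT.
by rewrite eq_sym.
Qed.

Lemma bJ : b^T *m J = - a^T.
Proof. by rewrite -aJ -mulmxA JmxK mulmxN mulmx1. Qed.

Lemma pcolE : pcol t i = pcol0 t i + t ^+ wt i (dualI (nl x0 i)) *: b.
Proof.
apply/matrixP => r c; rewrite !mxE (ord1 c) eqxx andbT.
have [k1 k2] := kidx_i.
case: (eqVneq r (dualI (nl x0 i))) => [->|ne].
  by rewrite k2 !ltnSn ltnn mulr1 add0r.
rewrite mulr0 addr0; suff -> : (i.*2 < kidx r)%N = (i.*2.+1 < kidx r)%N by [].
rewrite [RHS]ltn_neqAle; suff -> : i.*2.+1 != kidx r by [].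
apply: contra ne => /eqP h; apply/eqP/val_inj => /=; rewrite val_i.
move: h; rewrite /kidx; case: ifP => // _; rewrite /=; have := ltn_ord r; lia.
Qed.

Lemma pcol0_a : (pcol0 t i)^T *m a = 0.
Proof.
apply/matrixP => r c; rewrite [RHS]mxE mxE big1 // => d _; rewrite !mxE.
case: (eqVneq d (nl x0 i)) => [->|_]; last by rewrite mulr0.
by rewrite kidx_i.1 ltnNge leqnSn mul0r.
Qed.

(** With [elem] = 1 + n the product is J + nJ - (nJ)^T + nJn^T. The matrix nJ is symmetric by
    [pcolE], and nJn^T vanishes because all the inner pairings in it are zero. *)
Lemma elem_Sp : isSp (elem t i).
Proof.
rewrite /isSp; set n := pcol t i *m delta_mx 0 (nl x0 i) - b *m ((pcol0 t i)^T *m J).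
have -> : elem t i = 1%:M + n by rewrite /elem addrA.
set P0 := pcol0 t i in n *; set P := pcol t i in n *.
have nJ : n *m J = P *m b^T + b *m P0^T.
  by rewrite mulmxBl -tr_a -(mulmxA P) aJ -(mulmxA b) -(mulmxA P0^T) JmxK mulmxN mulmx1 mulmxN opprK.
have Jn : J *m n^T = - (n *m J)^T by rewrite trmx_mul JmxT mulNmx opprK.
have z1 : b^T *m a = 0.
  rewrite -aJ; have := J_alternating a; by [].
have z2 : b^T *m (J *m P0) = 0.
  rewrite mulmxA bJ mulNmx; have := congr1 trmx pcol0_a.
  by rewrite trmx_mul trmxK trmx0 => ->; rewrite oppr0.
have nT : n^T = a *m P^T + J *m P0 *m b^T.
  by rewrite /n linearB /= -tr_a !trmx_mul !trmxK JmxT !mulNmx opprK.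
have nJn : n *m J *m n^T = 0.
  rewrite nJ nT mulmxDl !mulmxDr -!mulmxA.
  rewrite (mulmxA b^T a) z1 mul0mx mulmx0 (mulmxA _ a P^T) pcol0_a mul0mx mulmx0.
  rewrite (mulmxA J) (mulmxA (b^T)) z2 mul0mx mulmx0 (mulmxA P0^T) (mulmxA P0^T).
  by rewrite J_alternating mul0mx mulmx0 !addr0.
have nJs : (n *m J)^T = n *m J.
  rewrite nJ /P pcolE -/P0 mulmxDl -scalemxAl !linearD /= linearZ /= !trmx_mul !trmxK.
  by rewrite addrC (addrC (b *m P0^T)) addrA.
clearbody n; rewrite linearD /= trmx1 mulmxDr mulmx1 !mulmxDl nJn addr0.
by rewrite mul1mx Jn nJs -addrA subrr addr0.
Qed.
End Symplectic.

Lemma unip_Sp (K : fieldType) (t : K) k : (k <= m)%N -> isSp (unip t k).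
Proof.
elim: k => [|k IH] km; first by rewrite /isSp /= mul1mx trmx1 mulmx1.
rewrite /isSp /= trmx_mul !mulmxA -(mulmxA _ (unip t k)) -(mulmxA _ (unip t k *m _)).
by rewrite IH ?elem_Sp //; lia.
Qed.
End Curve.

Lemma size_sum_leq (R : nzRingType) (I : finType) (F : I -> {poly R}) n :
  (forall i, size (F i) <= n)%N -> (size (\sum_i F i)%R <= n)%N.
Proof. by move=> h; apply: leq_trans (size_sum _ _ _) _; apply/bigmax_leqP. Qed.

(** * Degrees of minors along the curve *)

Section SizeOfMinors.
Variables (K : fieldType) (m : nat) (x0 : 'I_(m.*2)) (N : nat).
Hypothesis hN : (m.*2 + 4 <= N)%N.
Local Notation L := 'I_(m.*2).
Local Notation U := (unip x0 N ('X : {poly K})).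
Local Notation nl := (nl x0).

Local Notation q i := ((pcol0 m N ('X : {poly K}) i)^T *m jm m {poly K}).

Lemma unip_step k (a b : L) : let i := (m - k.+1)%N in
  U k.+1 a b = U k a b + pcol m N 'X i a 0 * U k (nl i) b
    - (a == dualI (nl i))%:R * (q i *m U k) 0 b.
Proof.
move=> i; rewrite [U k.+1]/= /elem -/i mulmxBl mulmxDl mul1mx mxE [X in X + _]mxE [X in _ + X]mxE.
rewrite -[X in _ + X - _]/((pcol m N 'X i *m delta_mx 0 (nl i) *m U k) a b).
rewrite -(mulmxA (pcol _ _ _ _)) -rowE -(mulmxA (delta_mx _ _)).
congr (_ + _ - _); first by rewrite mxE big_ord1 [row _ _ _ _]mxE.
by rewrite mxE big_ord1 [delta_mx _ _ _ _]mxE eqxx andbT.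
Qed.

Lemma unip0 (a b : L) : U 0 a b = (a == b)%:R.
Proof. by rewrite mxE. Qed.

Lemma qE i c : q i 0 c = (if (dualI c < m)%N then 1 else -1) * pcol0 m N 'X i (dualI c) 0.
Proof.
rewrite mxE (bigD1 (dualI c)) //= big1 ?addr0 => [|d nd]; rewrite !mxE.
  by rewrite dualIK eqxx mulr1 mulrC.
rewrite (_ : (c == dualI d) = false) ?mulr0 //; apply: contraNF nd => /eqP->.
by rewrite dualIK.
Qed.

Lemma val_nl_lt i : (i < m)%N -> nl i = i :> nat.
Proof. by move=> h; rewrite val_nl //; lia. Qed.

Lemma kidx_lt_dual (a : L) i : (kidx (dualI a) < i.*2)%N = (kidx a < i.*2)%N.
Proof. by rewrite !ltnNge -kidx_dual_lt. Qed.

Lemma kidx_small (b : L) : (b < m)%N -> kidx b = b.*2.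
Proof. by rewrite /kidx => ->. Qed.

Lemma kidx_inj : injective (@kidx m).
Proof.
move=> a b; have la := ltn_ord a; have lb := ltn_ord b; rewrite /kidx.
case: ltnP => h1; case: ltnP => h2 /= e; apply: val_inj => /=; lia.
Qed.

Lemma kidx_ltn (a : L) : (kidx a < m.*2)%N.
Proof. by have la := ltn_ord a; rewrite /kidx; case: (ltnP a m) => h1 /=; lia. Qed.

Lemma unip_col k (a b : L) : (k <= m)%N -> (b < m - k)%N -> U k a b = (a == b)%:R.
Proof.
elim: k a => [|k IH] a km hb; first by rewrite unip0.
rewrite unip_step; set i := (m - k.+1)%N.
have hi : (b < i)%N by []. have im : (i < m)%N by rewrite /i; lia.
rewrite !IH; try lia.
rewrite (_ : (nl i == b) = false) ?mulr0 ?addr0; last first.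
  by apply/eqP => /(congr1 val) /=; rewrite val_nl_lt //; lia.
rewrite (_ : (q i *m U k) 0 b = 0) ?mulr0 ?subr0 // mxE (bigD1 b) //= big1 => [|c nc].
  rewrite qE mxE (_ : (i.*2.+1 < kidx (dualI b))%N = false) ?mulr0 ?mul0r ?addr0 //.
  apply/negbTE; rewrite -leqNgt; have := kidx_lt_dual b i.
  by rewrite (@kidx_small b); lia.
by rewrite IH ?(negbTE nc) ?mulr0 //; lia.
Qed.

Lemma unip_row k (a b : L) : (k <= m)%N -> (kidx a < (m - k).*2)%N -> (b < m)%N ->
  U k a b = (a == b)%:R.
Proof.
elim: k => [|k IH] km ha hb; first by rewrite unip0.
rewrite unip_step; set i := (m - k.+1)%N.
have im : (i < m)%N by rewrite /i; lia.
have [k1 k2] := kidx_i x0 im.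
rewrite IH //; try lia.
rewrite mxE (_ : (i.*2 < kidx a)%N = false) ?mul0r ?addr0; last by apply/negbTE; rewrite -leqNgt ltnW.
rewrite (_ : (a == dualI (nl i)) = false) ?mul0r ?subr0 //.
by apply: contraTF ha => /eqP->; rewrite k2 -leqNgt; apply: leqnSn.
Qed.

Lemma unip_first k (a : L) : (k < m)%N -> let i := (m - k.+1)%N in
  U k.+1 a (nl i) = (a == nl i)%:R + pcol m N 'X i a 0.
Proof.
move=> km i; have im : (i < m)%N by rewrite /i; lia.
have [k1 k2] := kidx_i x0 im.
have ik : (nl i < m - k)%N by rewrite val_nl_lt // /i; lia.
rewrite unip_step -/i !unip_col ?(ltnW km) // eqxx mulr1.
rewrite (_ : (q i *m U k) 0 _ = 0) ?mulr0 ?subr0 // mxE (bigD1 (nl i)) //= big1 => [|c nc].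
  by rewrite qE mxE k2 ltnn mulr0 mul0r addr0.
by rewrite unip_col ?(negbTE nc) ?mulr0 //; lia.
Qed.

Lemma unip_other k (a b : L) : (k < m)%N -> let i := (m - k.+1)%N in (i < b)%N -> (b < m)%N ->
  U k.+1 a b = U k a b - (a == dualI (nl i))%:R * (q i *m U k) 0 b.
Proof.
move=> km i ib bm; have im : (i < m)%N by rewrite /i; lia.
have [k1 k2] := kidx_i x0 im.
rewrite unip_step -/i (@unip_row k (nl i)) ?(ltnW km) //; last by rewrite k1 /i; lia.
rewrite (_ : (nl i == b) = false) ?mulr0 ?addr0 //.
by apply/eqP => /(congr1 val) /=; rewrite val_nl_lt //; lia.
Qed.

Lemma N_gt0 : (0 < N)%N. Proof. by move: hN; lia. Qed.

Lemma size_q k b : (k < m)%N -> (m - k <= b)%N -> (b < m)%N -> let i := (m - k.+1)%N in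
  (forall a b : L, (m - k <= b)%N -> (b < m)%N -> (size (U k a b) <= (N ^ (k * m.*2)).+1)%N) ->
  forall b' : L, b' = b :> nat ->
  (size ((q i *m U k) 0%R b') <= (N ^ (k.+1 * m.*2 - i.*2.+2) + N ^ (k * m.*2)).+1)%N.
Proof.
move=> km b1 b2 i IH b' eb; rewrite mxE; apply: size_sum_leq => c.
rewrite qE mxE; case: (ltnP i.*2.+1 (kidx (dualI c))) => h; last by rewrite mulr0 mul0r size_poly0.
apply: leq_trans (size_polyMleq _ _) _.
have h1 : (size ((if (dualI c < m)%N then 1 else -1) * 'X ^+ wt N i (dualI c) : {poly K})%R <=
   (N ^ (k.+1 * m.*2 - i.*2.+2)).+1)%N.
  apply: leq_trans (_ : size ('X ^+ wt N i (dualI c) : {poly K})%R <= _)%N.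
    by case: ifP => _; rewrite ?mulN1r ?size_polyN ?mul1r.
  rewrite size_polyXn ltnS /wt ifT; last by lia.
  rewrite (_ : (m - i)%N = k.+1); last by rewrite /i; lia.
  by rewrite leq_pexp2l ?N_gt0 // leq_sub2l.
by have := IH c b'; rewrite eb => /(_ b1 b2); move: h1; set s1 := size _; set s2 := size _; lia.
Qed.

Lemma leq_double_exp x y : (x < y)%N -> (N ^ x + N ^ x <= N ^ y)%N.
Proof.
move=> xy; rewrite addnn -mul2n; apply: (@leq_trans (N ^ x.+1)); last by rewrite leq_pexp2l ?N_gt0.
by rewrite expnS leq_mul2r; move: hN; lia.
Qed.

Lemma size_unip k (a b : L) : (k <= m)%N -> (m - k <= b)%N -> (b < m)%N ->
  (size (U k a b) <= (N ^ (k * m.*2)).+1)%N.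
Proof.
elim: k a b => [|k IH] a b km b1 b2; first by lia.
have im : (m - k.+1 < m)%N by lia.
have b01 (c : bool) : (size (c%:R : {poly K}) <= 1)%N by case: c; rewrite ?size_poly1 ?size_poly0.
move: b1; rewrite leq_eqVlt => /orP[/eqP e|b1].
  rewrite (_ : b = nl (m - k.+1)%N); last by apply: val_inj; rewrite /= val_nl_lt.
  rewrite unip_first //; apply: leq_trans (size_polyD _ _) _; rewrite geq_max.
  apply/andP; split; first by apply: leq_trans (b01 _) _.
  rewrite mxE; case: ifP => h; last by rewrite size_poly0.
  rewrite size_polyXn ltnS /wt h leq_pexp2l ?N_gt0 // (_ : (m - (m - k.+1))%N = k.+1); last by lia.
  exact: leq_subr.
rewrite unip_other //; apply: leq_trans (size_polyD _ _) _; rewrite geq_max size_polyN.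
have h1 : (m - k <= b)%N by lia.
have hx : (k * m.*2 < k.+1 * m.*2)%N by rewrite ltn_pmul2r //; lia.
apply/andP; split.
  by apply: leq_trans (IH _ _ (ltnW km) h1 b2) _; rewrite ltnS leq_pexp2l ?N_gt0 // ltnW.
case: (a == _); last by rewrite mul0r size_poly0.
rewrite mul1r; apply: leq_trans (size_q km h1 b2 _ (erefl (val b))) _; first by move=> *; apply: IH => //; lia.
rewrite ltnS; apply: (@leq_trans (N ^ (k.+1 * m.*2).-1 + N ^ (k.+1 * m.*2).-1)).
  by apply: leq_add; rewrite leq_pexp2l ?N_gt0 //; lia.
by apply: leq_double_exp; lia.
Qed.

Lemma size_det_leq p (A : 'M[{poly K}]_p) (s : 'I_p -> nat) :
  (forall r c, size (A r c) <= (s r).+1)%N -> (size (\det A) <= (\sum_r s r).+1)%N.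
Proof.
move=> hA; apply: size_sum_leq => t; rewrite size_Msign.
elim/big_ind2: _ => [|x1 x2 y1 y2 h1 h2|r _]; first by rewrite size_poly1.
  by apply: leq_trans (size_polyMleq _ _) _; lia.
exact: hA.
Qed.

(** Expansion along the first column; by induction the term of the first row has exactly the claimed
    degree. If [c ord0] is the letter [nl i], every other cofactor contains the row of that letter,
    which vanishes in the remaining columns. Otherwise the first weight is N^x, and the other terms
    have degree at most (2p+1) N^(x-1), which is below N^x since N exceeds 2m. *)
Lemma size_minor_unip p k (c : 'I_p -> L) : (p <= k)%N -> (k <= m)%N ->
  (forall r s : 'I_p, (r < s)%N -> (kidx (c r) < kidx (c s))%N) ->
  (forall r : 'I_p, ((m - k) + r).*2 <= kidx (c r))%N ->
  size (\det (\matrix_(r < p, b < p) U k (c r) (nl (m - k + b)%N))) =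
  (\sum_(r < p) wt N (m - k + r) (c r)).+1%N.
Proof.
elim: p k c => [|p IH] [|k] c pk km hinc hge //; try by rewrite det_mx00 size_poly1 big_ord0.
set i := (m - k.+1)%N; have im : (i < m)%N by rewrite /i; lia.
have ik : (m - k)%N = i.+1 by rewrite /i; lia.
have [k1 k2] := kidx_i x0 im.
set A := \matrix_(_, _) _; set D := (\sum_(r < p.+1) _)%N.
rewrite (expand_det_col A ord0) big_ord_recl.
have Acol r : A r ord0 = (c r == nl i)%:R + pcol m N 'X i (c r) 0.
  by rewrite mxE addn0 unip_first.
have hc0 := hge ord0; rewrite addn0 in hc0.
have kc (r : 'I_p.+1) : (0 < r)%N -> (kidx (c ord0) < kidx (c r))%N by move=> h; apply: hinc.
have szp a : (size (pcol m N 'X i a 0 : {poly K})%R <= (wt N i a).+1)%N.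
  by rewrite mxE /wt; case: (i.*2 < kidx a)%N; rewrite ?size_polyXn ?size_poly0.
pose Mn (r : 'I_p.+1) : 'M[{poly K}]_p := \matrix_(s < p, b < p) U k.+1 (c (lift r s)) (nl (i.+1 + b)%N).
have cof r : cofactor A r ord0 = (-1) ^+ r * \det (Mn r).
  rewrite /cofactor addn0; congr (_ * \det _); apply/matrixP => s b.
  do 3! rewrite [LHS]mxE; rewrite [RHS]mxE.
  by rewrite lift0 addnS addSn.
have nli b : (b < p)%N -> nl (i.+1 + b) = (i.+1 + b)%N :> nat.
  by move=> bp; rewrite val_nl_lt //; lia.
have t0 : size (A ord0 ord0 * cofactor A ord0 ord0) = D.+1.
  rewrite cof expr0 mul1r.
  have sM : size (polyseq (\det (Mn ord0))) =
     (\sum_(r < p) wt N (i + r.+1) (c (lift ord0 r))).+1.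
    under [X in _ = X.+1]eq_bigr => r _ do rewrite -addSnnS -ik.
    rewrite -(IH k (fun r => c (lift ord0 r))) //; [|lia| |]; last first.
    - by move=> r; have := hge (lift ord0 r); rewrite lift0 ik addnS addSn.
    - by move=> r s rs; apply: hinc; rewrite !lift0.
    congr (size (polyseq (\det _))); apply/matrixP => r b; rewrite [LHS]mxE [RHS]mxE ik unip_other //.
    - rewrite (_ : (_ == _) = false) ?mul0r ?subr0 //.
      apply/eqP => e; have := hge (lift ord0 r); rewrite e k2 lift0; lia.
    - by rewrite nli //; lia.
    - by rewrite nli // /i; have := ltn_ord b; lia.
  have sA : size (A ord0 ord0) = (wt N i (c ord0)).+1.
    rewrite Acol; case: eqP => [->|/eqP ne].
      by rewrite mxE /wt k1 ltnn addr0 size_poly1.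
    have hk : (i.*2 < kidx (c ord0))%N.
      rewrite ltn_neqAle hc0 andbT; apply: contra ne => /eqP h; apply/eqP/kidx_inj.
      by rewrite k1 h.
    by rewrite add0r mxE hk size_polyXn.
  rewrite size_mul -?size_poly_gt0 ?sA ?sM //= addnS /D big_ord_recl addn0.
  by under [X in _ = (_ + X).+1]eq_bigr => r _ do rewrite lift0.
suff hrest : (size (\sum_(r < p) A (lift ord0 r) ord0 * cofactor A (lift ord0 r) ord0)%R <= D)%N.
  by rewrite size_polyDl t0.
apply: size_sum_leq => r; rewrite cof; set rho := lift ord0 r.
have rho0 : (0 < rho)%N by rewrite lift0.
have ne a : (kidx (c ord0) < kidx a)%N -> a != nl i.
  by move=> h; apply: contraTneq h => ->; rewrite k1 -leqNgt.
(* If [c ord0] is [nl i], the weight of the first row is 0, so the other cofactors have to vanish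
   rather than be of lower degree. *)
case: (eqVneq (c ord0) (nl i)) => e0.
  have -> : \det (Mn rho) = 0.
    have [s0 es0|es0] := unliftP rho ord0; last by move: rho0; rewrite -es0.
    rewrite (expand_det_row _ s0) big1 // => b _; rewrite mxE -es0 e0.
    have vb := nli b (ltn_ord b); have ltb := ltn_ord b.
    rewrite unip_other ?vb //; [|by rewrite -/i; lia|by lia].
    rewrite unip_row ?k1 ?ik ?vb //; [|by lia..].
    rewrite (_ : (nl i == nl _) = false); last first.
      by apply/eqP => /(congr1 val) /=; rewrite vb val_nl_lt //; lia.
    rewrite (_ : (nl i == dualI _) = false) ?mul0r ?subr0 ?mul0r //.
    by apply/eqP => /(congr1 (@kidx m)); rewrite k1 k2; lia.
  by rewrite !mulr0 size_poly0.
have hk0 : (i.*2 < kidx (c ord0))%N.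
  rewrite ltn_neqAle hc0 andbT; apply: contra e0 => /eqP h; apply/eqP/kidx_inj.
  by rewrite k1 h.
pose x := ((m - i) * m.*2 - kidx (c ord0))%N.
have mi : (m - i)%N = k.+1 by rewrite /i; lia.
have hx : (0 < x)%N by rewrite /x mi mulSn; have := kidx_ltn (c ord0); lia.
have eD : (N ^ x <= D)%N by rewrite /D big_ord_recl addn0 /wt hk0 leq_addr.
have bd y : (y < x)%N -> (N ^ y <= N ^ x.-1)%N by move=> h; rewrite leq_pexp2l ?N_gt0 //; lia.
have sAr : (size (A rho ord0) <= (N ^ x.-1).+1)%N.
  rewrite Acol (negbTE (ne _ (kc _ rho0))) add0r; apply: leq_trans (szp _) _.
  rewrite ltnS /wt; case: ifP => _ //; apply: bd; rewrite /x.
  by have := kc _ rho0; have := kidx_ltn (c rho); rewrite mi mulSn; lia.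
have sMn : (size (polyseq (\det (Mn rho))) <= (\sum_(s < p) (N ^ x.-1 + N ^ x.-1)%N).+1)%N.
  apply: size_det_leq => s b; rewrite mxE.
  have vb := nli b (ltn_ord b); have ltb := ltn_ord b.
  rewrite unip_other ?vb //; [|by rewrite -/i; lia|by lia].
  have hB : (k * m.*2 < x)%N by rewrite /x mi mulSn; have := kidx_ltn (c ord0); lia.
  apply: leq_trans (size_polyD _ _) _; rewrite size_polyN geq_max; apply/andP; split.
    apply: leq_trans (size_unip _ (ltnW km) _ _) _; rewrite ?vb; try lia.
    by have := bd _ hB; lia.
  case: eqP => [ed|_]; last by rewrite mul0r size_poly0.
  rewrite mul1r; apply: leq_trans (size_q km _ _ _ (erefl (val (nl (i.+1 + b)%N)))) _.
  - by rewrite /= vb; lia.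
  - by rewrite /= vb; lia.
  - by move=> *; apply: size_unip => //; lia.
  rewrite ltnS; apply: leq_add; last exact: bd.
  apply: bd; rewrite /x mi.
  have kk : (kidx (c ord0) <= i.*2.+1)%N.
    rewrite -k2 -ed; case: (posnP (lift rho s)) => h; last by apply: ltnW; apply: kc.
    by rewrite (_ : lift rho s = ord0) //; apply: val_inj.
  by rewrite mulSn; have := kidx_ltn (c ord0); lia.
apply: leq_trans (size_polyMleq _ _) _; rewrite size_Msign.
move: sMn; rewrite sum_nat_const card_ord => sMn.
have pm : (p < m)%N by lia.
have eN : (N ^ x = N * N ^ x.-1)%N by rewrite -expnS prednK.
have e1 : (0 < N ^ x.-1)%N by rewrite expn_gt0 N_gt0.
rewrite eN in eD; move: sAr sMn eD e1 hN pm.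
set s1 := size _; set s2 := size _; move: (N ^ x.-1)%N => E; nia.
Qed.

End SizeOfMinors.

Local Close Scope ring_scope.

(** * From patterns to symplectic tableaux *)

Section PatternToTableau.
Variables (m B : nat).
Local Notation L := 'I_(m.*2).

Lemma sum_interval M a b : a <= b -> b <= M -> \sum_(j < M) ((a <= j) && (j < b)) = b - a.
Proof.
move=> ab bM; rewrite -(big_mkord xpredT (fun j => ((a <= j) && (j < b)) : nat)).
rewrite (@big_cat_nat _ _ _ b) //= [X in _ + X]big_nat_cond [X in _ + X]big1 ?addn0; last first.
  by move=> j /andP[/andP[h _] _]; rewrite ltnNge h andbF.
rewrite (@big_cat_nat _ _ _ a) //= [X in X + _]big_nat_cond [X in X + _]big1 ?add0n; last first.
  by move=> j /andP[/andP[_ h] _]; rewrite leqNgt h.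
rewrite big_nat_cond (eq_bigr (fun=> 1)) => [|j /andP[/andP[-> ->]] //].
by rewrite -big_nat_cond sum_nat_const_nat muln1.
Qed.

(** The inverse of [kidx]. *)
Definition kl (x0 : L) (l : nat) : L := nl x0 (if odd l then m.*2 - l./2.+1 else l./2).

Lemma kidx_kl x0 l : l < m.*2 -> kidx (kl x0 l) = l.
Proof.
move=> h; have := odd_double_half l; rewrite /kl; case: (odd l) => /= e.
  by rewrite /kidx /= val_nl; [case: ltnP => h'; lia | lia].
by rewrite /kidx /= val_nl; [case: ltnP => h'; lia | lia].
Qed.

(** Rows are counted from the bottom of the pattern; by truncated subtraction every [k] from 2i on
    gives the top row [lam]. *)
Definition level (i : nat) (lam : nat -> nat) (t : seq (part m B)) (k : nat) : nat -> nat :=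
  nth (fun=> 0) (lam :: map (@ext m B) t) (i.*2 - k).

Lemma gtpat_level i lam t : gtpat i lam t ->
  [/\ size t = i.*2,
      forall k, k < i.*2 -> inter m (level i lam t k) (level i lam t k.+1),
      forall k, k <= i -> level i lam t k.*2 k = 0
    & forall r, r < m.+2 -> level i lam t 0 r = 0].
Proof.
elim: i lam t => [|i IH] lam [|p [|q t]] //=.
  move=> /forallP h.
  have z r : r < m.+2 -> lam r = 0 by move=> hr; apply/eqP; exact: (h (Ordinal hr)).
  split=> // k; rewrite leqn0 => /eqP->; exact: z.
case/and4P=> /eqP l0 ip iq /IH[st hk hz h0].
have e k : k <= i.*2 -> level i.+1 lam (p :: q :: t) k = level i (ext q) t k.
  move=> ki; rewrite /level doubleS /=.
  by rewrite (_ : i.*2.+2 - k = (i.*2 - k).+2); last lia.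
have e1 : level i.+1 lam (p :: q :: t) i.*2.+1 = ext p.
  by rewrite /level doubleS (_ : _ - _ = 1); last lia.
have e2 : level i.+1 lam (p :: q :: t) i.*2.+2 = lam by rewrite /level doubleS subnn.
have e3 : level i (ext q) t i.*2 = ext q by rewrite /level subnn.
split.
- by rewrite st doubleS.
- move=> k; rewrite doubleS !ltnS => hki.
  case: (ltngtP k i.*2) => h.
  + by rewrite !e //; [exact: hk | lia].
  + by rewrite (_ : k = i.*2.+1) ?e1 ?e2 //; lia.
  + by rewrite h e1 e // e3.
- move=> k; rewrite leq_eqVlt ltnS => /orP[/eqP->|hki]; first by rewrite doubleS e2.
  by rewrite e; [exact: hz | lia].
- by move=> r; rewrite e //; exact: h0.
Qed.

Variables (lam : nat -> nat) (t : seq (part m B)).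
Local Notation G := (level m lam t).

Lemma level_top k : m.*2 <= k -> G k = lam.
Proof. by move=> h; rewrite /level (_ : m.*2 - k = 0) //; lia. Qed.

Hypotheses (gt : gtpat m lam t) (dl : decreasing lam) (lm : lam m = 0).

Lemma level_incr k r : r <= m -> G k r <= G k.+1 r.
Proof.
move=> rm; case: (ltnP k m.*2) => h; last by rewrite !level_top //; lia.
by have [_ /(_ k h)/interP/(_ r) + _ _] := gtpat_level gt; lia.
Qed.

Lemma level_mono k l r : r <= m -> k <= l -> G k r <= G l r.
Proof.
move=> rm; elim: l => [|l IH]; first by rewrite leqn0 => /eqP->.
rewrite leq_eqVlt => /orP[/eqP->//|]; rewrite ltnS => /IH h.
exact: leq_trans h (level_incr _ rm).
Qed.

(* Row [r], column [j] entry of the tableau in which the letters below [k] fill the shape [G k]. *)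
Definition ell (r j : nat) : nat := height m.*2 (fun k => j.+1 - G k.+1 r) 0.

Lemma ltn_ell k r j : r <= m -> k < m.*2 -> (k < ell r j) = (G k.+1 r <= j).
Proof.
move=> rm km; rewrite ltn_height //; first by lia.
by move=> s; have := level_incr s.+1 rm; lia.
Qed.

Lemma ell_ltn k r j : r <= m -> k <= m.*2 -> (ell r j < k) = (j < G k r).
Proof.
move=> rm; case: k => [|k] km.
  by have [_ _ _ h] := gtpat_level gt; rewrite h //; lia.
by rewrite [RHS]ltnNge -ltn_ell // -leqNgt ltnS.
Qed.

(** The lower bound is the symplectic condition on tableaux: level 2r of a pattern is zero in row
    [r]. *)
Lemma ell_bounds r j : r < m -> j < lam r -> r.*2 <= ell r j < m.*2.
Proof.
move=> rm jl; have rm' := ltnW rm.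
rewrite (ell_ltn _ rm') // level_top // jl andbT leqNgt (ell_ltn _ rm') ?leq_double //.
by have [_ _ /(_ r rm') -> _] := gtpat_level gt.
Qed.

Lemma ell_incr r j : r.+1 < m -> j < lam r.+1 -> ell r j < ell r.+1 j.
Proof.
move=> rm jl; have jl' : j < lam r by apply: leq_trans jl (dl r).
have /andP[_ h] := ell_bounds (ltnW rm) jl'.
rewrite ltn_ell //; last exact: ltnW.
have [_ /(_ _ h)/interP/(_ r) + _ _] := gtpat_level gt.
have : G (ell r j) r <= j by rewrite leqNgt -ell_ltn ?ltnn //; lia.
lia.
Qed.

Lemma ell_lt r s j : r < s -> s < m -> j < lam s -> ell r j < ell s j.
Proof.
elim: s => // s IH; rewrite ltnS leq_eqVlt => /orP[/eqP->|rs] sm jl; first exact: ell_incr.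
apply: ltn_trans (ell_incr sm jl); apply: IH => //; first exact: ltnW.
exact: leq_trans jl (dl s).
Qed.

Lemma sum_ell M k r : r < m -> k < m.*2 -> lam r <= M ->
  \sum_(j < M) ((j < lam r) && (ell r j == k)) = G k.+1 r - G k r.
Proof.
move=> rm km lM; have rm' := ltnW rm.
have h : G k.+1 r <= lam r by have := level_mono rm' km; rewrite (level_top (leqnn _)).
rewrite -(@sum_interval M) //; [|exact: level_incr|exact: leq_trans h lM].
apply: eq_bigr => j _; congr (nat_of_bool _).
have e1 := ell_ltn j rm' (ltnW km); have e2 := ell_ltn j rm' (km : k.+1 <= m.*2).
rewrite -e2 [G k r <= j]leqNgt -e1.
have := ell_ltn j rm' (leqnn m.*2); rewrite level_top //; lia.
Qed.

Definition tabcol (x0 : L) (j : nat) : seq L := [seq kl x0 (ell r j) | r <- iota 0 (height m lam j)].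
End PatternToTableau.
Local Open Scope ring_scope.

Local Close Scope ring_scope.

(** * Base-N digits and the degree of a tableau *)

Lemma digits_lt N R (d : nat -> nat) : (forall k, k < R -> d k < N) ->
  \sum_(k < R) d k * N ^ k < N ^ R.
Proof.
elim: R => [|R IH] h; first by rewrite big_ord0.
rewrite big_ord_recr /= expnS; have := IH (fun k hk => h k (ltnW hk)).
by have := h R (leqnn _); set S := \sum_(k < R) _; move: (N ^ R) => E; nia.
Qed.

Lemma digits_inj N R (d d' : nat -> nat) :
  (forall k, k < R -> d k < N) -> (forall k, k < R -> d' k < N) ->
  \sum_(k < R) d k * N ^ k = \sum_(k < R) d' k * N ^ k -> forall k, k < R -> d k = d' k.
Proof.
elim: R => [|R IH] h h' //; rewrite !big_ord_recr /= => e k.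
have l1 := digits_lt (fun k hk => h k (ltnW hk)).
have l2 := digits_lt (fun k hk => h' k (ltnW hk)).
have edR : d R = d' R.
  move: e l1 l2; set S := \sum_(k < R) _; set S' := \sum_(k < R) _.
  move: (N ^ R) => E e l1 l2; apply/eqP; rewrite eqn_leq; apply/andP; split;
    rewrite leqNgt; apply/negP => ?; nia.
rewrite ltnS leq_eqVlt => /orP[/eqP->//|]; apply: IH => [l hl|l hl|]; [exact/h/ltnW|exact/h'/ltnW|].
by move: e; rewrite edR => /addIn.
Qed.

Lemma sum_pow_digits N R (X : finType) (P : pred X) (pos : X -> nat) :
  (forall x, P x -> pos x < R) ->
  \sum_(x | P x) N ^ pos x = \sum_(k < R) (\sum_(x | P x) (pos x == k)) * N ^ k.
Proof.
move=> h; under [RHS]eq_bigr => k _ do rewrite big_distrl /=.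
rewrite exchange_big /=; apply: eq_bigr => x Px.
rewrite (bigD1 (Ordinal (h x Px))) //= eqxx mul1n big1 ?addn0 // => k.
by rewrite -(inj_eq val_inj) /= eq_sym => /negbTE->.
Qed.

Section Degrees.
Variables (m B M N : nat) (x0 : 'I_(m.*2)) (lam : nat -> nat).
Hypotheses (dl : decreasing lam) (lm : lam m = 0) (lM : lam 0 <= M) (hN : M * m < N).

Definition tdeg (t : seq (part m B)) : nat :=
  \sum_(j < M) \sum_(r < height m lam j) wt N r (kl x0 (ell lam t r j)).

Let lMr r : lam r <= M.
Proof. exact: leq_trans (decreasing_le dl (leq0n r)) lM. Qed.

Lemma tdegE t : gtpat m lam t -> tdeg t =
  \sum_(x : 'I_M * 'I_m | (x.1 < lam x.2) && (x.2.*2 < ell lam t x.2 x.1))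
     N ^ ((m - x.2) * m.*2 - ell lam t x.2 x.1).
Proof.
move=> gt; rewrite big_mkcond /= -(pair_bigA _ (fun (j : 'I_M) (r : 'I_m) =>
  if (j < lam r) && (r.*2 < ell lam t r j) then N ^ ((m - r) * m.*2 - ell lam t r j) else 0)) /=.
apply: eq_bigr => j _.
rewrite (big_ord_widen _ (fun r => wt N r (kl x0 (ell lam t r j))) (height_le m lam j)) big_mkcond.
apply: eq_bigr => r _; rewrite ltn_height //; case: ltnP => //= h.
have /andP[_ h2] := ell_bounds gt lm (ltn_ord r) h.
by rewrite /wt kidx_kl.
Qed.

(** The exponents (m-r) 2m - k with 2r < k < 2m are distinct for distinct (r, k), and there are at
    most M m < N boxes, so the base-N digits count the entries k in each row r. Descending from
    [lam], these counts recover the levels above 2r; up to level 2r the row is zero. *)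
Lemma tdeg_inj t t' : gtpat m lam t -> gtpat m lam t' -> tdeg t = tdeg t' -> t = t'.
Proof.
move=> gt gt'; rewrite !tdegE //.
have hR (u : seq (part m B)) (x : 'I_M * 'I_m) :
    (x.1 < lam x.2) && (x.2.*2 < ell lam u x.2 x.1) ->
    (m - x.2) * m.*2 - ell lam u x.2 x.1 < m * m.*2.
  move=> /andP[_ h]; have m0 : 0 < m by apply: leq_ltn_trans (ltn_ord x.2).
  apply: (@leq_trans ((m - x.2) * m.*2)); last by rewrite leq_mul2r leq_subr orbT.
  have : 0 < (m - x.2) * m.*2 by rewrite muln_gt0 subn_gt0 ltn_ord /=; lia.
  lia.
have hd (u : seq (part m B)) (k : nat) : \sum_(x : 'I_M * 'I_m | (x.1 < lam x.2) && (x.2.*2 < ell lam u x.2 x.1))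
     ((m - x.2) * m.*2 - ell lam u x.2 x.1 == k) < N.
  apply: leq_ltn_trans hN; rewrite -[M in M * m]card_ord -[m in _ * m]card_ord -card_prod.
  rewrite -sum1_card big_mkcond leq_sum //= => x _; case: ifP => // _; exact: leq_b1.
rewrite (sum_pow_digits _ (hR t)) (sum_pow_digits _ (hR t')) => e.
have {}e := digits_inj (fun k _ => hd t k) (fun k _ => hd t' k) e.
have cnt (u : seq (part m B)) r k : gtpat m lam u -> r < m -> r.*2 < k -> k < m.*2 ->
   \sum_(x : 'I_M * 'I_m | (x.1 < lam x.2) && (x.2.*2 < ell lam u x.2 x.1))
     ((m - x.2) * m.*2 - ell lam u x.2 x.1 == (m - r) * m.*2 - k) =
   level m lam u k.+1 r - level m lam u k r.
  move=> gu rm rk km; rewrite -(sum_ell gu lm rm km (lMr r)).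
  rewrite big_mkcond /= -(pair_bigA _ (fun (j : 'I_M) (r' : 'I_m) =>
    if (j < lam r') && (r'.*2 < ell lam u r' j) then
      ((m - r') * m.*2 - ell lam u r' j == (m - r) * m.*2 - k) : nat else 0)) /=.
  apply: eq_bigr => j _; rewrite (bigD1 (Ordinal rm)) //= big1 ?addn0 => [|r' ne].
    case: (ltnP j (lam r)) => h //=.
    have /andP[_ h2] := ell_bounds gu lm rm h.
    have h3 : m.*2 <= (m - r) * m.*2 by rewrite leq_pmull // subn_gt0.
    case: ltnP => h4; last by apply/esym/eqP; rewrite eqb0; lia.
    by congr (nat_of_bool _); lia.
  case: ifP => // /andP[h1 h2]; apply/eqP; rewrite eqb0.
  have /andP[_ h3] := ell_bounds gu lm (ltn_ord r') h1.
  have {}ne : r' <> r :> nat by move=> h; case/eqP: ne; apply: val_inj.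
  have hr' := ltn_ord r'; case: (ltngtP r r') => h; last by case: ne.
    have : (m - r').+1 * m.*2 <= (m - r) * m.*2 by rewrite leq_mul2r; apply/orP; right; lia.
    by rewrite mulSn; move: ((m - r') * m.*2) ((m - r) * m.*2) => a b; lia.
  have : (m - r).+1 * m.*2 <= (m - r') * m.*2 by rewrite leq_mul2r; apply/orP; right; lia.
  by rewrite mulSn; move: ((m - r') * m.*2) ((m - r) * m.*2) => a b; lia.
have [st _ hz _] := gtpat_level gt.
have [st' _ hz' _] := gtpat_level gt'.
have eG k r : r <= m -> level m lam t k r = level m lam t' k r.
  rewrite leq_eqVlt => /orP[/eqP->|rm].
    have := level_mono gt lm (leqnn m) (leq_maxl k m.*2).
    have := level_mono gt' lm (leqnn m) (leq_maxl k m.*2).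
    by rewrite !(level_top _ _ (leq_maxr _ _)) lm; lia.
  have rm' := ltnW rm.
  case: (leqP k r.*2) => rk.
    have := level_mono gt lm rm' rk; have := level_mono gt' lm rm' rk; rewrite hz // hz' //; lia.
  move ed: (m.*2 - k) => d; elim: d k ed rk => [|d IH] k ed rk.
    by rewrite !level_top; lia.
  have km : k < m.*2 by lia.
  have IHk : level m lam t k.+1 r = level m lam t' k.+1 r by apply: IH; lia.
  have l1 := level_incr gt lm k rm'; have l2 := level_incr gt' lm k rm'.
  have hpos : (m - r) * m.*2 - k < m * m.*2.
    have : (m - r) * m.*2 <= m * m.*2 by rewrite leq_mul2r leq_subr orbT.
    have : 0 < (m - r) * m.*2 by rewrite muln_gt0; apply/andP; split; lia.
    lia.
  by have := e _ hpos; rewrite !cnt //; lia.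
apply: (@eq_from_nth _ [ffun=> ord0]); first by rewrite st st'.
move=> i; rewrite st => hi; apply: ext_inj => r rm.
have := eG (m.*2 - i.+1) r rm; rewrite /level (_ : m.*2 - (m.*2 - i.+1) = i.+1) /=; last by lia.
by rewrite !(nth_map [ffun=> ord0]) ?st ?st'.
Qed.
End Degrees.
Local Open Scope ring_scope.

(** If p were nonzero, 1 + X p would be nonconstant, and at a root of it the vanishing of p would
    give 1 = 0. *)
Lemma closed_poly0 (K : closedFieldType) (p : {poly K}) : (forall x, p.[x] = 0) -> p = 0.
Proof.
move=> h; apply/eqP/negPn/negP => p0.
have s2 : size (1 + 'X * p) != 1%N.
  rewrite addrC size_polyDl; first by rewrite mulrC size_mulX // eqSS size_poly_eq0.
  by rewrite mulrC size_mulX // size_poly1 ltnS size_poly_gt0.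
have [x /rootP] := closed_rootP _ s2.
by rewrite !hornerE h mulr0 addr0 => /eqP; rewrite oner_eq0.
Qed.

Lemma size_prod_exact (K : fieldType) (I : finType) (F : I -> {poly K}) (s : I -> nat) :
  (forall i, size (F i) = (s i).+1) -> size (\prod_i F i) = (\sum_i s i).+1%N.
Proof.
move=> h; elim/big_rec2: _ => [|i y x _ e]; first by rewrite size_poly1.
by rewrite size_mul -?size_poly_gt0 ?h ?e //= addnS.
Qed.

Lemma minor_size (K : fieldType) (m : nat) (x0 : 'I_(m.*2)) (c : seq 'rV[K]_(m.*2)) k :
  size c = k -> minor x0 c = \det (\matrix_(r < k, a < k) (nth 0 c r) 0 (nl x0 a)).
Proof. by move=> <-. Qed.

(** * Independence of products of minors on Sp(V) *)

Section IndependentMinors.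
Variables (K : closedFieldType) (m B M : nat) (x0 : 'I_(m.*2)) (lam : nat -> nat).
Hypotheses (dl : decreasing lam) (lm : lam m = 0%N) (lM : (lam 0 <= M)%N).
Local Notation L := 'I_(m.*2).
Local Notation P := (m.*2.-tuple (part m B)).
(** Large enough for the degree estimate of [size_minor_unip] and for the digits in [tdeg_inj]. *)
Let N := (M * m + m.*2 + 5)%N.

Definition cvec (t : seq (part m B)) (j : nat) : seq 'rV[K]_(m.*2) :=
  map (@ev K m) (tabcol lam t x0 j).

Lemma size_cvec t j : size (cvec t j) = height m lam j.
Proof. by rewrite !size_map size_iota. Qed.

Lemma minor_cvec t j (g : 'M[K]_(m.*2)) : minor x0 (map (mulmxr g) (cvec t j)) =
  \det (\matrix_(r < height m lam j, a < height m lam j) g (kl x0 (ell lam t r j)) (nl x0 a)).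
Proof.
rewrite (@minor_size _ _ x0 _ (height m lam j)) ?size_map ?size_iota //.
congr (\det _); apply/matrixP => r a; rewrite !mxE.
rewrite (nth_map 0) ?size_cvec // /cvec (nth_map x0) ?size_map ?size_iota //.
by rewrite (nth_map 0%N) ?size_iota // nth_iota // add0n /= -rowE mxE.
Qed.

Definition tminor (t : seq (part m B)) (g : 'M[K]_(m.*2)) : K :=
  \prod_(j < M) minor x0 (map (mulmxr g) (cvec t j)).

Definition tpoly (t : seq (part m B)) : {poly K} :=
  \prod_(j < M) \det (\matrix_(r < height m lam j, a < height m lam j)
     unip x0 N ('X : {poly K}) m (kl x0 (ell lam t r j)) (nl x0 a)).

Lemma tpoly_horner t x : (tpoly t).[x] = tminor t (unip x0 N x m).
Proof.
rewrite /tpoly horner_prod; apply: eq_bigr => j _; rewrite minor_cvec.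
rewrite -[LHS]/(horner_eval x _) -det_map_mx; congr (\det _).
have := map_unip x0 N (horner_eval x) ('X : {poly K}) m; rewrite /= /horner_eval hornerX => <-.
by apply/matrixP => r a; rewrite [LHS]mxE [in LHS]mxE [RHS]mxE [RHS]mxE.
Qed.

Lemma size_tpoly t : gtpat m lam t -> size (tpoly t) = (tdeg M N x0 lam t).+1.
Proof.
move=> gt; apply: size_prod_exact => j.
have hm := height_le m lam j.
have hj r : (r < height m lam j)%N -> (r < m)%N /\ (j < lam r)%N.
  by move=> h; have rm := leq_trans h hm; rewrite -(ltn_height _ dl rm).
have := @size_minor_unip K m x0 N _ _ m (fun r : 'I_(height m lam j) => kl x0 (ell lam t r j)) hm (leqnn m).
rewrite subnn => -> //; first by rewrite /N; lia.
- move=> r s rs; have [hr1 hr2] := hj r (ltn_ord r); have [hs1 hs2] := hj s (ltn_ord s).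
  rewrite !kidx_kl; first exact: ell_lt.
    by have /andP[] := ell_bounds gt lm hs1 hs2.
  by have /andP[] := ell_bounds gt lm hr1 hr2.
- move=> r; have [hr1 hr2] := hj r (ltn_ord r).
  by have /andP[h1 h2] := ell_bounds gt lm hr1 hr2; rewrite kidx_kl.
Qed.

Lemma isSp1 : isSp (1%:M : 'M[K]_(m.*2)).
Proof. by rewrite /isSp mul1mx trmx1 mulmx1. Qed.

Lemma tdeg0 t : gtpat m lam t -> tdeg M N x0 lam t = 0%N ->
  forall j : 'I_M, cvec t j = can K x0 (height m lam j).
Proof.
move=> gt /eqP; rewrite sum_nat_eq0 => /forallP h j; have := h j.
rewrite implyTb sum_nat_eq0 => /forallP {}h; rewrite /cvec /tabcol /can -map_comp.
apply/eq_in_map => r; rewrite mem_iota add0n => /andP[_ hr] /=; congr (ev K _).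
have hm := height_le m lam j; have rm := leq_trans hr hm.
have jl : (j < lam r)%N by rewrite -(ltn_height _ dl rm).
have /andP[h1 h2] := ell_bounds gt lm rm jl.
have := h (Ordinal hr); rewrite implyTb /= /wt kidx_kl //; case: ltnP => h3.
  by rewrite expn_eq0 /N addn_eq0 andbF.
by rewrite /kl (_ : ell lam t r j = r.*2) ?odd_double ?doubleK //; lia.
Qed.

(** Along the curve distinct patterns have distinct degrees, so a positive highest degree would
    leave a nonzero leading coefficient. The constant [d] is there because invariance modulo W only
    says that such a sum does not change with g. *)
Theorem minors_independent (c : P -> K) (d : K) :
  d = 0 \/ (exists j : 'I_M, 0 < height m lam j)%N ->
  (forall g, isSp g -> \sum_(t : P | gtpat m lam t) c t * tminor t g = d) ->
  forall t : P, gtpat m lam t -> c t = 0.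
Proof.
move=> hd hg t0 gt0; apply/eqP/negPn/negP => c0.
pose Q (t : P) := gtpat m lam t && (c t != 0).
have Q0 : Q t0 by rewrite /Q gt0.
pose t := [arg max_(t > t0 | Q t) tdeg M N x0 lam t]%N.
have [{}t /andP[gt ct] tmax] := @arg_maxnP _ t0 Q (fun t => tdeg M N x0 lam t) Q0.
pose p := \sum_(t : P | gtpat m lam t) c t *: tpoly t - d%:P.
have p0 : p = 0.
  apply: closed_poly0 => x; rewrite /p hornerD hornerN hornerC horner_sum.
  rewrite (eq_bigr (fun t : P => c t * tminor t (unip x0 N x m))).
    by rewrite hg ?subrr //; apply: unip_Sp.
  by move=> u _; rewrite hornerZ tpoly_horner.
have MN : (M * m < N)%N by rewrite /N; lia.
(* Only the canonical filling has degree 0. Its product of minors is 1 at the identity; at J it is 0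
   for a nonempty shape, because J sends v_0 out of the first m coordinates. *)
case: (posnP (tdeg M N x0 lam t)) => dt.
  have z (u : P) : gtpat m lam u -> u != t -> c u = 0.
    move=> gu ne; apply/eqP/negPn/negP => cu; case/eqP: ne; apply: val_inj.
    apply: (tdeg_inj (x0 := x0) dl lm lM MN) => //; apply/eqP; rewrite dt -leqn0 -dt.
    by apply: tmax; rewrite /Q gu.
  have hg' g : isSp g -> c t * tminor t g = d.
    move=> /hg; rewrite (bigD1 t) //= big1 ?addr0 // => u /andP[gu ne].
    by rewrite z // mul0r.
  have hW := tdeg0 gt dt.
  have m1 : tminor t 1%:M = 1.
    rewrite /tminor big1 // => j _; rewrite hW.
    rewrite (@minor_size _ _ x0 _ (height m lam j)) ?size_map ?size_iota //.
    rewrite -[RHS](@det1 _ (height m lam j)); congr (\det _); apply/matrixP => r a; rewrite !mxE.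
    have hm := height_le2 m lam j.
    rewrite (nth_map 0) ?size_can // /can (nth_map 0%N) ?size_iota // nth_iota // add0n /= mulmx1 evE.
    rewrite -[r == a](inj_eq val_inj) /=; congr (nat_of_bool _)%:R; apply/eqP/eqP => [/nl_inj e|->//].
    by apply/esym/e; exact: leq_trans hm.
  have cd : c t = d by rewrite -(hg' _ isSp1) m1 mulr1.
  case: hd => [d0|[j hj]]; first by rewrite cd d0 eqxx in ct.
  have mJ : tminor t (Jmx K m) = 0.
    rewrite /tminor (bigD1 j) //= hW (@minor_size _ _ x0 _ (height m lam j)) ?size_map ?size_iota //.
    rewrite (expand_det_row _ (Ordinal hj)) big1 ?mul0r // => a _; rewrite mxE.
    have hm := height_le m lam j.
    rewrite (nth_map 0) ?size_can // /can (nth_map 0%N) ?size_iota // nth_iota // add0n /= -rowE !mxE.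
    rewrite /form (_ : (_ == dualI _) = false) ?mulr0 ?mul0r //.
    apply/eqP => /(congr1 val) /=; have la := ltn_ord a.
    by rewrite !val_nl; lia.
  by move: ct; rewrite cd -(hg' _ (isSp_J K m)) mJ mulr0 eqxx.
have := congr1 (fun p : {poly K} => p`_(tdeg M N x0 lam t)) p0.
rewrite /p coefB coefC (gtn_eqF dt) subr0 coef0 coef_sum (bigD1 t) //= big1 ?addr0.
  have st := size_tpoly gt.
  rewrite coefZ => /eqP; rewrite mulf_eq0 (negbTE ct) /=.
  rewrite (_ : _`_ _ = lead_coef (tpoly t)); last by rewrite lead_coefE st.
  by rewrite lead_coef_eq0 -size_poly_eq0 st.
move=> u /andP[gu ne]; rewrite coefZ.
case: (eqVneq (c u) 0) => [->|cu]; first by rewrite mul0r.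
rewrite nth_default ?mulr0 // size_tpoly //.
have : (tdeg M N x0 lam u <= tdeg M N x0 lam t)%N by apply: tmax; rewrite /Q gu.
rewrite leq_eqVlt => /orP[/eqP e|//].
by case/eqP: ne; apply: val_inj; apply: (tdeg_inj (x0 := x0) dl lm lM MN).
Qed.
End IndependentMinors.

(** * The characteristic-free basis of the tensor power *)

Section Basis.
Variables (K : closedFieldType) (m T : nat) (x0 : 'I_(m.*2)).
Local Notation L := 'I_(m.*2).
Local Notation P := (m.*2.-tuple (part m T.+1)).
Local Notation word := (T.-tuple L).

Definition good (x : word * P) : bool := lat x.1 && gtpat m (sh x.1) x.2.

Definition ybas (g : 'M[K]_(m.*2)) (w : seq L) (t : seq (part m T.+1)) (I : seq L) : K :=
  ytens T (hist w) (fun j => map (mulmxr g) (cvec K x0 (sh w) t j)) I.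

Lemma card_good : #|[set x | good x]| = #|{: word}|.
Proof.
rewrite card_tuple card_ord -(@sum_lat_gtc m T.+1 T) // -sum1_card.
rewrite (eq_bigl good) => [|x]; last by rewrite inE.
rewrite big_mkcond /= -(pair_bigA _ (fun (w : word) (t : P) => if lat w && gtpat m (sh w) t then 1%N else 0%N)) /=.
rewrite [RHS]big_mkcond; apply: eq_bigr => w _.
case: ifP => lw /=; last by rewrite big1.
by rewrite -card_gtpat; apply: eq_bigr => t _; case: gtpat.
Qed.

(* [T]-words are compared by letter sum, then by decreasing [enc]. *)
Definition wkey (w : seq L) : nat := (tsum w * m.*2 ^ T + (m.*2 ^ T - enc w).-1)%N.

(** [ytens_top] reduces to the canonical columns, whose tensor is supported on words with the letter
    sum of [w] and [enc] at most that of [w]; the hypothesis on keys then leaves only [w] itself. *)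
Lemma ybas_top w w' t g : lat w -> size w = T -> size w' = T -> gtpat m (sh w) t ->
  (wkey w' <= wkey w)%N ->
  ybas g w t w' = if w == w' then
    tminor T x0 (sh w) t g * ytens T (hist w) (Wcan K x0 (sh w)) w else 0.
Proof.
move=> lw sw sw' gt hk.
have l1 := enc_lt w; have l2 := enc_lt w'; rewrite sw in l1; rewrite sw' in l2.
have ts : (tsum w' <= tsum w)%N.
  by rewrite leqNgt; apply/negP => h; move: hk l1 l2; rewrite /wkey; move: (m.*2 ^ T)%N => E; nia.
have sT : (size w <= T)%N by rewrite sw.
have e : ybas g w t w' = tminor T x0 (sh w) t g * ytens T (hist w) (Wcan K x0 (sh w)) w'.
  rewrite /ybas (ytens_top x0 lw) // ?sw ?sw' // => j.
  by rewrite size_map size_cvec.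
rewrite e; case: eqP => [<-//|ne].
case: (eqVneq (ytens T (hist w) (Wcan K x0 (sh w)) w') 0) => [->|h]; first by rewrite mulr0.
case: ne; apply: enc_inj; rewrite ?sw ?sw' //.
have e1 := tsum_can lw sT (etrans sw' (esym sw)) h.
have e2 := leading_enc lw sT (etrans sw' (esym sw)) h.
by move: hk l1 l2; rewrite /wkey e1; move: (m.*2 ^ T)%N => E; lia.
Qed.

(** Triangularity: among the pairs with nonzero coefficient, take one whose word has the least key.
    At this word the tensors of all other words vanish, and a relation between products of minors
    remains. *)
Lemma ybas_separation (c : word * P -> K) (R : pred word) :
  (forall w : word, lat w -> R w -> exists e : K, (e = 0 \/ exists j : 'I_T, (0 < height m (sh w) j)%N) /\
     forall g, isSp g -> \sum_(x | good x && R x.1) c x * ybas g x.1 x.2 w = e) ->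
  forall x, good x -> R x.1 -> c x = 0.
Proof.
move=> H z gz Rz; apply/eqP/negPn/negP => cz.
pose Q x := [&& good x, R x.1 & c x != 0].
have Qz : Q z by rewrite /Q gz Rz.
have [[w t] /= /and3P[gx Rx cx] xmin] := @arg_minnP _ z Q (fun x => wkey x.1) Qz.
have /andP[/= lw gt] := gx.
have [e [he H']] := H w lw Rx.
have [d z0] := lat_sh lw.
pose u := ytens T (hist w) (Wcan K x0 (sh w)) w.
have u0 : u != 0 by apply: leading_word; rewrite ?size_tuple.
have lM : (sh w 0 <= T)%N by have := sh_le_size w 0; rewrite size_tuple.
suff c0 : c (w, t) = 0 by rewrite c0 eqxx in cx.
apply: (@minors_independent K m T.+1 T x0 (sh w) d z0 lM (fun t => c (w, t)) (e / u)) gt => [|g sg].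
- by case: he => [->|]; [left; rewrite mul0r|right].
- apply: (mulIf u0); rewrite divfK // -(H' g sg) mulr_suml.
  pose Fn (w' : word) (t' : P) : K :=
    if good (w', t') && R w' then c (w', t') * ybas g w' t' w else 0.
  have -> : \sum_(x | good x && R x.1) c x * ybas g x.1 x.2 w = \sum_p Fn p.1 p.2.
    by rewrite big_mkcond; apply: eq_bigr => -[].
  rewrite -(pair_bigA _ Fn) /Fn /= (bigD1 w) //= [X in _ + X]big1 ?addr0.
    rewrite [LHS]big_mkcond; apply: eq_bigr => t' _; rewrite /good /= lw Rx andbT.
    case: ifP => // gt'; by rewrite ybas_top ?size_tuple // eqxx mulrA.
  move=> w' nw; rewrite big1 // => t' _; case: ifP => // /andP[g' R'].
  case: (eqVneq (c (w', t')) 0) => [->|cw]; first by rewrite mul0r.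
  have /andP[/= lw' gt'] := g'.
  rewrite ybas_top ?size_tuple //; last by apply: (xmin (w', t')); rewrite /Q g' R'.
  by case: (val w' =P val w) nw => [/val_inj->|_ _]; rewrite ?eqxx ?mulr0.
Qed.

Lemma ybas_equivariant g w t I : isSp g -> lat w -> size w = T -> size I = T ->
  ybas g w t I = tact g T (ybas 1%:M w t) I.
Proof.
move=> sg lw sw sI; have sT : (size w <= T)%N by rewrite sw.
have := @ytens_equivariant K m T g (hist w) (cvec K x0 (sh w) t) I sg.
rewrite size_hist sw sI /ybas => /(_ erefl (hist_cols sT lw)) <-.
rewrite /tact; apply: eq_bigr => I' _; congr (_ * _); apply: eq_ytens => j _.
by rewrite -[LHS]map_id; apply: eq_map => x /=; rewrite mulmx1.
Qed.

(** By equivariance a relation at the identity holds for every g, so [ybas_separation] makes the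
    rows of [A] independent; by [card_good] the matrix is square, hence invertible. *)
Lemma ybas_span (F : seq L -> K) : exists c : word * P -> K,
  forall w : word, F w = \sum_(x | good x) c x * ybas 1%:M x.1 x.2 w.
Proof.
pose GS := [set x | good x].
pose A : 'M[K]_(#|GS|, #|{: word}|) := \matrix_(i < #|GS|, j < #|{: word}|)
  let x : word * P := enum_val i in ybas 1%:M x.1 x.2 (enum_val j : word).
pose co (u : 'rV[K]_#|GS|) (x : word * P) : K := \sum_i u 0 i * (x == enum_val i)%:R.
have coE u i : co u (enum_val i) = u 0 i.
  rewrite /co (bigD1 i) //= eqxx mulr1 big1 ?addr0 // => k nk.
  by rewrite (inj_eq enum_val_inj) eq_sym (negbTE nk) mulr0.
have sumE u (w : word) : \sum_(x | good x) co u x * ybas 1%:M x.1 x.2 w =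
   (u *m A) 0 (enum_rank w).
  rewrite (eq_bigl (fun x => x \in GS)) => [|x]; last by rewrite inE.
  rewrite big_enum_val mxE; apply: eq_bigr => i _.
  by rewrite coE mxE enum_rankK.
have freeA : row_free A.
  apply: inj_row_free => u uA; apply/rowP => i; rewrite mxE -coE.
  have gi : good (enum_val i) by have := enum_valP i; rewrite inE.
  apply: (@ybas_separation (co u) predT) => // w lw _.
  exists 0; split=> [|g sg]; first by left.
  under eq_bigl => x do rewrite andbT.
  rewrite (eq_bigr (fun x => \sum_(I' : word) co u x * (ybas 1%:M x.1 x.2 I' * gw g I' w))).
    rewrite exchange_big /= big1 // => I' _.
    under eq_bigr => x _ do rewrite mulrA.
    by rewrite -mulr_suml sumE uA mxE mul0r.
  move=> x /andP[lx gx]; rewrite ybas_equivariant ?size_tuple //.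
  by rewrite /tact mulr_sumr.
have fullA : row_full A.
  by rewrite /row_full; move: freeA; rewrite /row_free => /eqP->; rewrite card_good.
pose Fr : 'rV[K]_#|{: word}| := \row_(j < #|{: word}|) F (enum_val j : word).
have /submxP[D eD] := submx_full Fr fullA.
exists (co D) => w; rewrite sumE -eD mxE enum_rankK //.
Qed.
End Basis.

(** * Words returning to the empty shape *)

Section ClosedWords.
Variables (m r n f : nat).
Local Notation L := 'I_(m.*2).

Definition returning (w : seq L) : bool := [forall i : 'I_m, sh w i == 0%N].
(** Words are processed from their last letter, so [drop r w], the part lying in W, is itself a
    lattice word. *)
Definition closedw (w : seq L) : bool :=
  [&& lat w, rems (drop r w) < f & returning w]%N.

Lemma returning_height (w : seq L) j : returning w -> height m (sh w) j = 0%N.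
Proof.
move=> /forallP h; apply/eqP; rewrite -leqn0 leqNgt -has_count; apply/hasPn => i.
by rewrite mem_iota add0n => /andP[_ im]; rewrite (eqP (h (Ordinal im))).
Qed.

Lemma not_returning (w : seq L) M : lat w -> (size w <= M)%N -> ~~ returning w ->
  exists j : 'I_M, (0 < height m (sh w) j)%N.
Proof.
move=> lw sw; rewrite negb_forall => /existsP[i]; rewrite -lt0n => hi.
have jM : (0 < M)%N by apply: leq_trans hi (leq_trans (sh_le_size _ _) sw).
exists (Ordinal jM); rewrite -has_count; apply/hasP; exists (val i) => //.
by rewrite mem_iota add0n ltn_ord.
Qed.
End ClosedWords.

(** * Invariants modulo the subspace W *)

Section Lifting.
Variables (K : closedFieldType) (m r n f : nat) (x0 : 'I_(m.*2)).
Local Notation L := 'I_(m.*2).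
Local Notation V := 'rV[K]_(m.*2).
Local Notation T := (r + n)%N.
Local Notation word := (T.-tuple L).

(* [Wp] stands for V^(x)n B^(f); only these closure properties matter here. *)
Variable Wp : (seq L -> K) -> Prop.
Hypothesis Wext : forall F G : seq L -> K,
  (forall I, size I = n -> F I = G I) -> Wp F -> Wp G.
Hypothesis Wlin : forall (a : K) (F G : seq L -> K), Wp F -> Wp G -> Wp (fun I => a * F I + G I).
Hypothesis W0 : Wp (fun=> 0).
Hypothesis Wrems : forall F I, Wp F -> size I = n -> (rems I < f)%N -> F I = 0.
Hypothesis Wtens : forall w : seq L, lat w -> size w = n -> (f <= rems w)%N ->
  forall U : nat -> seq V, Wp (ytens T (hist w) U).

Definition WT (F : seq L -> K) : Prop := forall I2, size I2 = r -> Wp (fun I1 => F (I2 ++ I1)).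

Lemma Wp_ad (F : seq V -> seq L -> K) pre c b :
  (forall c, Wp (F c)) -> Wp (fun I => ad (fun c => F c I) pre c b).
Proof.
move=> h; elim: c pre => [|x c IH] pre //=.
apply: (Wext (F := fun I => x 0 b * F (pre ++ c) I +
   (-1 * ad (fun c => F c I) (rcons pre x) c b + 0))).
  by move=> I _; rewrite addr0 mulN1r.
by apply: Wlin (h _) _; apply: Wlin (IH _) W0.
Qed.

(** The steps of the first tensor factor peel off as contractions and insertions, which change only
    the vector arguments; what remains belongs to the suffix of [w] and lies in W by [Wtens]. *)
Lemma WT_tens (w : seq L) (U : nat -> seq V) : lat w -> size w = T -> (f <= rems (drop r w))%N ->
  WT (ytens T (hist w) U).
Proof.
move=> lw sw fw I2.
have sT : (size w <= T)%N by rewrite sw.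
have : (size w = size I2 + n)%N -> lat w -> (f <= rems (drop (size I2) w))%N ->
    Wp (fun I1 => ytens T (hist w) U (I2 ++ I1)).
  move=> {lw fw} ; elim: I2 w U sT {sw} => [|b I2 IH] w U sT.
    by move=> sw lw; rewrite drop0 => fw; exact: (Wtens lw sw fw U).
  case: w sT => [|a w] sT //= sw.
  move: sw => [sw] /andP[lw la] fw.
  have sT' : (size w <= T)%N by rewrite ltnW.
  have {}IH U' := IH w U' sT' sw lw fw.
  case: ifP la => am la.
    have jM : (sh w a < T)%N by apply: leq_ltn_trans sT; apply: sh_le_size.
    apply: (Wext (F := fun I1 => ad (fun c => ytens T (hist w) (upd U (sh w a) c) (I2 ++ I1))
       [::] (U (sh w a)) b)) => [I1 _|]; first by rewrite ytens_add.
    by apply: (Wp_ad (F := fun c I1 => ytens T (hist w) (upd U (sh w a) c) (I2 ++ I1))).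
  set j := (sh w _).-1.
  have jM : (j < T)%N by apply: leq_ltn_trans sT; apply: leq_trans (leq_pred _) (sh_le_size _ _).
  apply: (Wext (F := fun I1 => ytens T (hist w) (upd U j (rcons (U j) (dv K b))) (I2 ++ I1))) => //.
  by move=> I1 _; rewrite ytens_rem.
by move=> h sI; apply: h; rewrite ?sI ?sw.
Qed.

Lemma WT_sum (I : finType) (Q : pred I) (a : I -> K) (F : I -> seq L -> K) :
  (forall i, Q i -> WT (F i)) -> WT (fun w => \sum_(i | Q i) a i * F i w).
Proof.
move=> h I2 s2; elim: (index_enum I) => [|i l IH].
  by apply: Wext W0 => I1 _; rewrite big_nil.
case: (boolP (Q i)) => Qi; last by apply: Wext IH => I1 _; rewrite big_cons (negbTE Qi).
by apply: Wext (Wlin (a i) (h i Qi I2 s2) IH) => I1 _; rewrite big_cons Qi.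
Qed.

Lemma WT_eval (F : seq L -> K) (w : word) : WT F -> (rems (drop r w) < f)%N -> F w = 0.
Proof.
move=> hF hw; have := hF (take r w); rewrite size_take size_tuple.
rewrite (_ : (if _ then _ else _) = r); last by case: ltnP; lia.
by move=> /(_ erefl) /Wrems /(_ _ hw); rewrite cat_take_drop size_drop size_tuple addKn; apply.
Qed.

Lemma WT_ext (F G : seq L -> K) : (forall w : word, F w = G w) -> WT F -> WT G.
Proof.
move=> e hF I2 s2; apply: Wext (hF I2 s2) => I1 s1.
have sT : size (I2 ++ I1) == T by rewrite size_cat s1 s2.
exact: (e (Tuple sT)).
Qed.

Lemma WT_lin a (F G : seq L -> K) : WT F -> WT G -> WT (fun w => a * F w + G w).
Proof. by move=> hF hG I2 s2; apply: Wlin; [apply: hF|apply: hG]. Qed.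

Notation y0 w := (ytens T (hist w) (fun=> [::] : seq V)).

Lemma ybas_returning g (w : word) (t : seq (part m T.+1)) I : lat w -> returning w -> ybas x0 g w t I = y0 w I.
Proof.
move=> lw rw; apply: eq_ytens => j _; apply/size0nil.
by rewrite size_map size_cvec returning_height.
Qed.

(** Basis tensors with at least [f] removals in the suffix lie in WT. At words with fewer than [f]
    such removals every element of WT vanishes, so there the sum of the other basis terms does not
    depend on g. Tensors of returning words are constant in g, and [ybas_separation] kills the
    coefficients of the non-returning ones. *)
Lemma lift_invariant (F : seq L -> K) :
  (forall g, isSp g -> WT (fun w => tact g T F w - F w)) ->
  exists c : word -> K, WT (fun w => F w - \sum_(v : word | closedw r f v) c v * y0 v w).
Proof.
move=> hF; have [c ec] := ybas_span T x0 F.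
pose R (w : word) := (rems (drop r w) < f)%N && ~~ returning w.
have hc : forall x, good x -> R x.1 -> c x = 0.
  apply: (@ybas_separation K m T x0) => w lw /andP[hw rw].
  (* The constant is the value at the identity. *)
  exists (\sum_(x | good x && R x.1) c x * ybas x0 1%:M x.1 x.2 w); split.
    by right; apply: not_returning rw; rewrite ?size_tuple.
  move=> g sg; apply/eqP; rewrite -subr_eq0 -sumrB; apply/eqP.
  have : WT (fun w => \sum_(x | good x && ~~ (rems (drop r x.1) < f)%N)
     c x * (ybas x0 g x.1 x.2 w - ybas x0 1%:M x.1 x.2 w)).
    apply: WT_sum => -[v t] /= /andP[/andP[/= lv gt]]; rewrite -leqNgt => hv.
    have h g' : WT (ybas x0 g' v t) by apply: WT_tens; rewrite ?size_tuple.
    by apply: WT_ext (WT_lin (-1) (h 1%:M) (h g)) => u; rewrite mulN1r addrC.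
  move=> /(WT_lin (-1)) /(_ (hF g sg)) /WT_eval /(_ hw) /eqP; rewrite mulN1r addrC subr_eq0.
  have -> : tact g T F w = \sum_(x | good x) c x * ybas x0 g x.1 x.2 w.
    rewrite (eq_bigr (fun x => \sum_(I' : word) c x * (ybas x0 1%:M x.1 x.2 I' * gw g I' w))).
      rewrite exchange_big /=; apply: eq_bigr => I' _; rewrite ec mulr_suml.
      by apply: eq_bigr => x _; rewrite mulrA.
    move=> x /andP[lx gx]; rewrite ybas_equivariant ?size_tuple //.
    by rewrite /tact mulr_sumr.
  rewrite ec -sumrB (bigID (fun x : word * _ => (rems (drop r x.1) < f)%N)) /= => /eqP.
  under [X in _ = X]eq_bigr => x _ do rewrite mulrBr.
  move=> /eqP; rewrite -subr_eq0 addrK => /eqP.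
  rewrite (bigID (fun x : word * _ => returning x.1)) /= [X in X + _]big1 ?add0r => [e|x].
    by rewrite -[RHS]e; apply: eq_bigl => x; rewrite /R -!andbA.
  by move=> /andP[/andP[/andP[lx gx] _] rx]; rewrite !ybas_returning // subrr.
(* The tensor of a returning word does not involve the pattern, so the coefficients of its patterns
   are added up. *)
exists (fun v : word => \sum_(t : m.*2.-tuple (part m T.+1) | gtpat m (sh v) t) c (v, t)).
apply: (WT_ext (F := fun w => \sum_(x | good x && ~~ (rems (drop r x.1) < f)%N)
     c x * ybas x0 1%:M x.1 x.2 w)).
  move=> w; rewrite ec [in RHS](bigID (fun x : word * _ => (rems (drop r x.1) < f)%N)) /=.
  rewrite addrAC -[LHS]add0r; congr (_ + _); apply/esym/eqP; rewrite subr_eq0; apply/eqP.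
  rewrite (bigID (fun x : word * _ => returning x.1)) /= [X in _ + X]big1 ?addr0 => [|x].
    under [RHS]eq_bigr => v _ do rewrite mulr_suml.
    rewrite pair_big_dep /=; apply: eq_big => [[v t]|[v t]] /=.
      by rewrite /good /closedw /=; case: lat; case: gtpat; rewrite /= ?andbT ?andbF.
    by move=> /andP[/andP[/andP[lv gt] _] rv]; rewrite ybas_returning.
  by move=> /andP[/andP[gx fx] rx]; rewrite hc ?mul0r // /R fx.
apply: WT_sum => -[v t] /= /andP[/andP[/= lv gt]]; rewrite -leqNgt => hv.
by apply: WT_tens; rewrite ?size_tuple.
Qed.

(** At the closed word of largest [enc] with nonzero coefficient, [leading_enc] makes the tensors of
    all others vanish. *)
Lemma lift_unique (c : word -> K) :
  WT (fun w => \sum_(v : word | closedw r f v) c v * y0 v w) ->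
  forall v : word, closedw r f v -> c v = 0.
Proof.
move=> h v hv; apply/eqP/negPn/negP => cv.
pose Q (u : word) := closedw r f u && (c u != 0).
have Qv : Q v by rewrite /Q hv.
have [u /andP[cu nu] umax] := @arg_maxnP _ v Q (fun u => enc u) Qv.
have /and3P[lu fu ru] := cu.
have yE (w : word) : returning w -> forall I, y0 w I = ytens T (hist w) (Wcan K x0 (sh w)) I.
  move=> rw I; apply: eq_ytens => j _; apply/esym/size0nil.
  by rewrite size_can returning_height.
have := WT_eval h fu; rewrite (bigD1 u) //= big1 ?addr0.
  have : y0 u u != 0 by rewrite yE //; apply: leading_word; rewrite ?size_tuple.
  by move=> yu /eqP; rewrite mulf_eq0 (negbTE nu) (negbTE yu).
move=> w /andP[cw wu]; have /and3P[lw fw rw] := cw.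
case: (eqVneq (c w) 0) => [->|nw]; first by rewrite mul0r.
have e1 : (enc w <= enc u)%N by apply: umax; rewrite /Q cw.
rewrite yE //; case: (eqVneq (ytens T (hist w) (Wcan K x0 (sh w)) u) 0) => [->|hy].
  by rewrite mulr0.
have e2 : (enc u <= enc w)%N by apply: (leading_enc lw _ _ hy); rewrite !size_tuple.
case/eqP: wu; apply/val_inj/enc_inj; rewrite ?size_tuple //.
by apply/eqP; rewrite eqn_leq e1.
Qed.
End Lifting.

(** * Matrices of Brauer algebra elements *)

Section BrauerMatrices.
Variables (K : fieldType) (m n : nat) (x0 : 'I_(m.*2)).
Local Notation L := 'I_(m.*2).
Local Notation M := 'M[K]_(dimT m n).
Local Notation idx := (idx m n).

Definition rk (I : idx) : 'I_(dimT m n) := enum_rank I.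
Definition ent (A : M) (I J : idx) : K := A (rk I) (rk J).

Lemma rkK : cancel rk ixT. Proof. exact: enum_rankK. Qed.
Lemma ixTK : cancel ixT rk. Proof. exact: enum_valK. Qed.

Lemma eq_ent A B : (forall I J, ent A I J = ent B I J) -> A = B.
Proof. by move=> h; apply/matrixP => i j; rewrite -[i]ixTK -[j]ixTK; apply: h. Qed.

Lemma big_rk (F : 'I_(dimT m n) -> K) : \sum_i F i = \sum_I F (rk I).
Proof. by apply: reindex; apply: onW_bij; exists ixT; [exact: rkK|exact: ixTK]. Qed.

Lemma ent_mul A B I J : ent (A *m B) I J = \sum_H ent A I H * ent B H J.
Proof. by rewrite /ent mxE big_rk. Qed.

Lemma ent_scale c A I J : ent (c *: A) I J = c * ent A I J.
Proof. by rewrite /ent mxE. Qed.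

Lemma ent1 I J : ent 1%:M I J = (I == J)%:R.
Proof. by rewrite /ent mxE (can_eq rkK). Qed.

Lemma ent_tens g I J : ent (tensmx n g) I J = \prod_(k < n) g (I k) (J k).
Proof. by rewrite /ent mxE !rkK. Qed.

Lemma tensmxM g h : tensmx n (g *m h) = tensmx n g *m tensmx n h :> M.
Proof.
apply: eq_ent => I J; rewrite ent_mul ent_tens.
rewrite (eq_bigr (fun k => \sum_a g (I k) a * h a (J k))) => [|k _]; last by rewrite mxE.
rewrite bigA_distr_bigA /=; apply: eq_bigr => H _.
by rewrite !ent_tens -big_split.
Qed.

Lemma tensmx1 : tensmx n 1%:M = 1%:M :> M.
Proof.
apply: eq_ent => I J; rewrite ent_tens ent1; case: (eqVneq I J) => [->|ne].
  by rewrite big1 // => k _; rewrite mxE eqxx.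
have /existsP[k nk] : [exists k, I k != J k].
  by rewrite -negb_forall; apply: contraNN ne => /forallP h; apply/eqP/ffunP => k; apply/eqP.
by rewrite (bigD1 k) //= mxE (negbTE nk) mul0r.
Qed.

(* The action of place permutations, without the sign of [smx]. *)
Definition pact (s : 'S_n) (I : idx) : idx := [ffun k => I (s k)].
Definition pm (s : 'S_n) : M := \matrix_(i, j) (ixT j == pact s (ixT i))%:R.

Lemma ent_pm s I J : ent (pm s) I J = (J == pact s I)%:R.
Proof. by rewrite /ent mxE !rkK. Qed.

Lemma pactK s I : pact s (pact s^-1 I) = I.
Proof. by apply/ffunP => k; rewrite !ffunE permK. Qed.

Lemma pactKV s I : pact s^-1 (pact s I) = I.
Proof. by apply/ffunP => k; rewrite !ffunE permKV. Qed.

Lemma ent_pml s A I J : ent (pm s *m A) I J = ent A (pact s I) J.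
Proof.
rewrite ent_mul (bigD1 (pact s I)) //= ent_pm eqxx mul1r big1 ?addr0 // => H ne.
by rewrite ent_pm (negbTE ne) mul0r.
Qed.

Lemma ent_pmr s A I J : ent (A *m pm s^-1) I J = ent A I (pact s J).
Proof.
rewrite ent_mul (bigD1 (pact s J)) //= ent_pm pactKV eqxx mulr1 big1 ?addr0 // => H ne.
rewrite ent_pm; case: eqP => [e|_]; rewrite ?mulr0 //.
by case/eqP: ne; rewrite e pactK.
Qed.

Lemma pmM s t : pm s *m pm t = pm (t * s)%g.
Proof.
apply: eq_ent => I J; rewrite ent_pml !ent_pm; congr (nat_of_bool (J == _))%:R.
by apply/ffunP => k; rewrite !ffunE permM.
Qed.

Lemma pm1 : pm 1%g = 1%:M.
Proof.
apply: eq_ent => I J; rewrite ent_pm ent1 eq_sym; congr (nat_of_bool (_ == J))%:R.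
by apply/ffunP => k; rewrite ffunE perm1.
Qed.

Lemma wordmx_cat w1 w2 : wordmx K m (w1 ++ w2) = wordmx K m w1 *m wordmx K m w2 :> M.
Proof. by elim: w1 => [|x w IH] /=; rewrite ?mul1mx // IH mulmxA. Qed.

Lemma ent_smx (p q : 'I_n) I J : val q = (val p).+1 ->
  ent (smx K m n p) I J = - (J == pact (tperm p q) I)%:R.
Proof.
move=> pq; rewrite /ent mxE !rkK; congr (- (nat_of_bool _)%:R).
have npq : p != q by rewrite -(inj_eq val_inj) pq /=; lia.
have np k : (val k == val p) = (k == p) by rewrite (inj_eq val_inj).
have nq k : (val k == (val p).+1) = (k == q) by rewrite -pq (inj_eq val_inj).
apply/andP/eqP => [[/forallP h1 /forallP h2]|->].
  apply/ffunP => k; rewrite ffunE; have := h1 p => /forallP/(_ q).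
  rewrite np nq !eqxx /= => /andP[/eqP e1 /eqP e2].
  case: tpermP => [->|->|/eqP kp /eqP kq] //.
  by have := h2 k; rewrite np nq kp kq /= => /eqP.
split.
  apply/forallP => k; apply/forallP => k'; rewrite np nq; apply/implyP => /andP[/eqP-> /eqP->].
  by rewrite !ffunE tpermL tpermR !eqxx.
apply/forallP => k; rewrite np nq; apply/implyP => /andP[kp kq].
by rewrite ffunE tpermD // eq_sym.
Qed.

Lemma ent_emx (p q : 'I_n) I J : val q = (val p).+1 ->
  ent (emx K m n p) I J =
  - (form K (I p) (I q) * form K (J p) (J q) * [forall k, (k != p) && (k != q) ==> (J k == I k)]%:R).
Proof.
move=> pq; rewrite /ent mxE !rkK; congr (- (_ * (nat_of_bool _)%:R)); last first.
  by apply: eq_forallb => k; rewrite -pq !(inj_eq val_inj).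
rewrite (bigD1 p) //= (big_pred1 q) => [|k]; last first.
  by rewrite eqxx -pq (inj_eq val_inj).
rewrite [X in _ + X]big1 ?addr0 // => k np; rewrite big_pred0 // => k'.
by rewrite -[val k == _]/(val k == val p) (inj_eq val_inj) (negbTE np).
Qed.

Lemma pm_word s : exists c w, pm s = c *: (wordmx K m w : M).
Proof.
move: s; apply: adjacent_perm_ind.
- by exists 1, [::]; rewrite scale1r pm1.
- move=> s t [c [w ew]] [d [v ev]]; exists (d * c), (v ++ w).
  by rewrite -pmM ew ev wordmx_cat -scalemxAl -scalemxAr scalerA.
move=> p q pq; have hp : (val p < n.-1)%N.
  by have := ltn_ord q; rewrite [nat_of_ord q]pq; lia.
exists (-1), [:: (Ordinal hp, false)]; rewrite /= mulmx1.
by apply: eq_ent => I J; rewrite ent_scale ent_pm (ent_smx _ _ pq) mulN1r opprK.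
Qed.

Definition it (I : idx) (k : nat) : L := nth x0 (codom I) k.
Definition mk (F : nat -> L) : idx := [ffun k : 'I_n => F k].

Lemma it_ord I (k : 'I_n) : it I k = I k.
Proof.
rewrite /it codomE (nth_map k); first by rewrite nth_ord_enum.
by rewrite size_enum_ord.
Qed.

Lemma it_mk F k : (k < n)%N -> it (mk F) k = F k.
Proof. by move=> kn; rewrite -[k]/(val (Ordinal kn)) it_ord ffunE. Qed.

Lemma eq_idx I J : (forall k, (k < n)%N -> it I k = it J k) -> I = J.
Proof. by move=> h; apply/ffunP => k; rewrite -!it_ord h. Qed.

Lemma Efmx_rcons g : Efmx K m n g.+1 = Efmx K m n g *m emx K m n g.*2.
Proof.
rewrite /Efmx -[g.+1]addn1 iotaD foldr_cat /= mulmx1.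
elim: (iota 0 g) => [|i l IH] /=; first by rewrite mul1mx.
by rewrite IH mulmxA.
Qed.

Definition caps g (I : idx) : K := \prod_(l < g) form K (it I l.*2) (it I l.*2.+1).

Lemma ent_Efmx g I J : (g.*2 <= n)%N ->
  ent (Efmx K m n g) I J =
  (-1) ^+ g * caps g I * caps g J * [forall k : 'I_n, (g.*2 <= k)%N ==> (J k == I k)]%:R.
Proof.
elim: g I J => [|g IH] I J hg.
  rewrite /caps !big_ord0 !mul1r ent1 eq_sym; congr (nat_of_bool _)%:R.
  by apply/eqP/forallP => [-> k|h]; [rewrite eqxx implybT | apply/ffunP => k; have /eqP := h k].
have pn : (g.*2 < n)%N by lia.
have qn : (g.*2.+1 < n)%N by lia.
set p := Ordinal pn; set q := Ordinal qn.
have ee H : ent (emx K m n g.*2) H J = - (form K (H p) (H q) * form K (J p) (J q) *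
   [forall k, (k != p) && (k != q) ==> (J k == H k)]%:R) by exact: (@ent_emx p q H J erefl).
pose H0 := mk (fun k => if (k < g.*2)%N then it J k else it I k).
rewrite Efmx_rcons ent_mul (bigD1 H0) //= big1 ?addr0 => [|H /negP nH]; last first.
  rewrite IH ?ee; last by lia.
  case: forallP => [h2|_]; last by rewrite !(mulr0, oppr0).
  case: forallP => [h1|_]; last by rewrite !(mulr0, mul0r).
  case: nH; apply/eqP/eq_idx => k kn; rewrite it_mk // -[k]/(val (Ordinal kn)) !it_ord.
  set k' := Ordinal kn; have := h1 k'; have := h2 k'; rewrite -!(inj_eq val_inj) /=.
  case: ltnP => [lt /implyP h _|_ _ /implyP h]; last exact/val_inj/eqP/h.
  by apply/esym/val_inj/eqP; apply: h; lia.
have e0 (k : 'I_n) : H0 k = if (k < g.*2)%N then J k else I k by rewrite ffunE !it_ord.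
rewrite IH ?ee; last by lia.
have -> : [forall k : 'I_n, (g.*2 <= k)%N ==> (H0 k == I k)].
  by apply/forallP => k; rewrite e0; case: ltnP => //= _; rewrite eqxx.
have -> : caps g H0 = caps g J.
  apply: eq_bigr => l _; have := ltn_ord l => lg.
  by rewrite !it_mk ?ifT //; lia.
have ip H : it H g.*2 = H p by exact: (it_ord H p).
have iq H : it H g.*2.+1 = H q by exact: (it_ord H q).
rewrite /caps !big_ord_recr /= !ip !iq !e0 /= ltnn ltnNge leqnSn /= exprS mulr1.
have -> : [forall k, (k != p) && (k != q) ==> (J k == H0 k)]
   = [forall k : 'I_n, (g.+1.*2 <= k)%N ==> (J k == I k)].
  apply: eq_forallb => k; rewrite e0 -!(inj_eq val_inj) /= .
  case: ltnP => h.
    have -> : (g.+1.*2 <= k)%N = false by rewrite doubleS; lia.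
    by rewrite eqxx implybT.
  have -> // : (g.+1.*2 <= k = (k != g.*2 :> nat) && (k != g.*2.+1 :> nat))%N.
  by rewrite doubleS; lia.
rewrite mulN1r; ring.
Qed.

Definition rem_count (I : idx) : nat := \sum_(k < n) (m <= I k).

Lemma form_rem (a b : L) : form K a b != 0 -> ((m <= a) + (m <= b) = 1)%N.
Proof.
rewrite /form; case: (eqVneq b (dualI a)) => [->|_]; last by rewrite mulr0 eqxx.
by rewrite val_dualI => _; have := ltn_ord a; case: leqP; case: leqP; lia.
Qed.

(** Transpositions only permute the letters, and both the pair contracted and the pair inserted by
    e_j contain exactly one letter of the second half. *)
Lemma genmx_rem x I J : ent (genmx K m x : M) I J != 0 -> rem_count J = rem_count I.
Proof.
case: x => p b; have hp := ltn_ord p; have pn : (p < n)%N by lia.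
have qn : (p.+1 < n)%N by lia.
set p' := Ordinal pn; set q := Ordinal qn; have pq : val q = (val p').+1 by [].
have npq : q != p' by rewrite -(inj_eq val_inj) /=; lia.
rewrite /genmx /=; case: b; rewrite -[val p]/(val p').
  rewrite (ent_emx _ _ pq) oppr_eq0 2!mulf_eq0 2!negb_or => /andP[/andP[hI hJ]].
  case: forallP => [h _|]; last by rewrite eqxx.
  rewrite /rem_count (bigD1 p') //= (bigD1 q) //= addnA (form_rem hJ).
  rewrite [RHS](bigD1 p') //= [in RHS](bigD1 q) //= addnA (form_rem hI); congr addn.
  by apply: eq_bigr => k hk; have /implyP/(_ hk)/eqP -> := h k.
rewrite (ent_smx _ _ pq) oppr_eq0; case: (eqVneq J (pact (tperm p' q) I)) => [-> _|_]; last by rewrite eqxx.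
rewrite /rem_count [RHS](reindex_perm (tperm p' q)); apply: eq_bigr => k _.
by rewrite ffunE.
Qed.

Lemma wordmx_rem w I J : ent (wordmx K m w : M) I J != 0 -> rem_count J = rem_count I.
Proof.
elim: w I => [|x w IH] I /=; first by rewrite ent1; case: (eqVneq I J) => [->|]; rewrite ?eqxx.
rewrite ent_mul; apply: contraTeq => ne; rewrite negbK; apply/eqP/big1 => H _.
case: (eqVneq (ent (wordmx K m w) H J) 0) => [->|h]; first by rewrite mulr0.
case: (eqVneq (ent (genmx K m x) I H) 0) => [->|h']; first by rewrite mul0r.
by rewrite (IH _ h) (genmx_rem h') eqxx in ne.
Qed.

Lemma caps_rem g I : (g.*2 <= n)%N -> caps g I != 0 -> (g <= rem_count I)%N.
Proof.
move=> hg h.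
have -> : rem_count I = (\sum_(0 <= k < n) (m <= it I k))%N.
  by rewrite big_mkord; apply: eq_bigr => k _; rewrite it_ord.
rewrite (big_cat_nat _ hg) //=; apply: leq_trans (leq_addr _ _).
elim: g hg h => [|g IH] hg //; rewrite /caps big_ord_recr /= mulf_eq0 negb_or => /andP[h1 h2].
by rewrite doubleS !big_nat_recr //= -addnA (form_rem h2) addn1 ltnS IH //; lia.
Qed.
End BrauerMatrices.

(** * Arcs, the ideal and Brauer diagrams *)

Definition flat (T : Type) (A : seq (T * T)) : seq T := flatten [seq [:: x.1; x.2] | x <- A].

Lemma size_flat T (A : seq (T * T)) : size (flat A) = (size A).*2.
Proof. by elim: A => //= x A; rewrite /flat /= => ->. Qed.

Lemma nth_flat T (z : T) A l :
  nth z (flat A) l.*2 = (nth (z, z) A l).1 /\ nth z (flat A) l.*2.+1 = (nth (z, z) A l).2.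
Proof. by elim: A l => [|x A IH] [|l] //=; rewrite !nth_nil. Qed.

Section Arcs.
Variables (K : fieldType) (m n : nat) (x0 : 'I_(m.*2)).
Local Notation L := 'I_(m.*2).
Local Notation M := 'M[K]_(dimT m n).
Local Notation idx := (idx m n).
Local Notation row := 'rV[K]_(dimT m n).
Local Notation it := (it x0).

Lemma eq_row (u v : row) : (forall I, u 0 (rk I) = v 0 (rk I)) -> u = v.
Proof. by move=> h; apply/rowP => i; rewrite -[i]ixTK. Qed.

Lemma row_mul_ent (u : row) (A : M) J : (u *m A) 0 (rk J) = \sum_H u 0 (rk H) * ent A H J.
Proof. by rewrite mxE big_rk. Qed.

Section Ideal.
Variable f : nat.

Lemma inW_base (p : row) w : inW f (p *m Efmx K m n f *m wordmx K m w).
Proof. by exists [:: (p, ([::], w))]; rewrite big_seq1 /= mulmx1. Qed.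

Lemma inW0 : inW f (0 : row).
Proof. by exists [::]; rewrite big_nil. Qed.

Lemma inW_lin a (u v : row) : inW f u -> inW f v -> inW f (a *: u + v).
Proof.
move=> [l ->] [l' ->]; exists ([seq (a *: p.1, p.2) | p <- l] ++ l').
rewrite big_cat big_map /= scaler_sumr; congr (_ + _).
by apply: eq_bigr => p _; rewrite -!scalemxAl.
Qed.

Lemma inWZ a (u : row) : inW f u -> inW f (a *: u).
Proof. by move=> h; rewrite -[_ *: _]addr0; apply: inW_lin (h) inW0. Qed.

Lemma inWD (u v : row) : inW f u -> inW f v -> inW f (u + v).
Proof. by move=> hu hv; rewrite -[u]scale1r; apply: inW_lin. Qed.

Lemma inW_sum (I : Type) (r : seq I) (P : pred I) (F : I -> row) :
  (forall i, P i -> inW f (F i)) -> inW f (\sum_(i <- r | P i) F i).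
Proof. by move=> h; apply: big_ind => //; [exact: inW0|exact: inWD]. Qed.

Lemma inW_word (u : row) w : inW f u -> inW f (u *m wordmx K m w).
Proof.
move=> [l ->]; exists [seq (p.1, (p.2.1, p.2.2 ++ w)) | p <- l].
rewrite big_map mulmx_suml; apply: eq_bigr => p _ /=.
by rewrite wordmx_cat -!mulmxA.
Qed.

Lemma inW_Bimg (u : row) (B : M) : inW f u -> inBimg B -> inW f (u *m B).
Proof.
move=> hu [l ->]; rewrite mulmx_sumr; apply: inW_sum => p _.
by rewrite -scalemxAr; apply/inWZ/inW_word.
Qed.

Lemma inW_rem (v : row) J : (f.*2 <= n)%N -> inW f v -> (rem_count J < f)%N -> v 0 (rk J) = 0.
Proof.
move=> hf [l ->] hJ; rewrite summxE big1 // => p _.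
rewrite row_mul_ent big1 // => H _.
case: (eqVneq (ent (wordmx K m p.2.2) H J) 0) => [->|h]; first by rewrite mulr0.
rewrite row_mul_ent big1 ?mul0r // => H' _; rewrite (ent_Efmx K x0) //.
case: (eqVneq (caps K x0 f H) 0) => [->|h']; first by rewrite mulr0 mul0r mulr0.
by have := caps_rem hf h'; rewrite -(wordmx_rem h) leqNgt hJ.
Qed.
End Ideal.

Lemma list_perm (l : seq nat) : uniq l -> size l = n -> all (fun k => k < n)%N l ->
  exists s : 'S_n, forall k : 'I_n, s k = nth 0%N l k :> nat.
Proof.
move=> ul sl al.
have hl (k : 'I_n) : (nth 0%N l k < n)%N by apply: (all_nthP 0%N al); rewrite sl.
have ij : injective (fun k : 'I_n => Ordinal (hl k)).
  by move=> k k' [/eqP]; rewrite nth_uniq ?sl // => /eqP/val_inj.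
by exists (perm ij) => k; rewrite permE.
Qed.

Lemma it_pact (s : 'S_n) l I k : (forall k : 'I_n, s k = nth 0%N l k :> nat) -> (k < n)%N ->
  it (pact s I) k = it I (nth 0%N l k).
Proof.
move=> h kn; rewrite -[k in LHS]/(val (Ordinal kn)) it_ord ffunE.
by rewrite -(it_ord x0) h.
Qed.

Lemma caps_flat (s : 'S_n) (A : seq (nat * nat)) l I :
  (forall k : 'I_n, s k = nth 0%N (flat A ++ l) k :> nat) -> ((size A).*2 <= n)%N ->
  caps K x0 (size A) (pact s I) = \prod_(x <- A) form K (it I x.1) (it I x.2).
Proof.
move=> h hA; rewrite (big_nth (0, 0)%N) big_mkord; apply: eq_bigr => i _.
have hi := ltn_ord i; rewrite !(it_pact _ h) ?nth_cat ?size_flat; try lia.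
have [e1 e2] := nth_flat 0%N A i.
by rewrite !ifT ?e1 ?e2 //; lia.
Qed.

(** A place permutation bringing the arcs to the first places turns the tensor into an image of
    [Efmx]. *)
Lemma inW_arcs (v : row) (A : seq (nat * nat)) (R : idx -> K) :
  uniq (flat A) -> all (fun k => k < n)%N (flat A) ->
  (forall I J : idx, (forall k : 'I_n, val k \notin flat A -> I k = J k) -> R I = R J) ->
  (forall J, v 0 (rk J) = \prod_(x <- A) form K (it J x.1) (it J x.2) * R J) ->
  inW (size A) v.
Proof.
move=> uA aA hR hv; set f := size A.
pose pts := flat A ++ [seq k <- iota 0 n | k \notin flat A].
have pp : perm_eq pts (iota 0 n).
  rewrite uniq_perm ?iota_uniq // /pts.
    rewrite cat_uniq uA filter_uniq ?iota_uniq // andbT /=.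
    by apply/hasPn => k; rewrite mem_filter => /andP[].
  move=> k; rewrite mem_cat mem_filter mem_iota add0n /=.
  by case: (boolP (k \in _)) => //= /(allP aA) ->.
have sp : size pts = n by rewrite (perm_size pp) size_iota.
have [|//||s hs] := @list_perm pts.
  - by rewrite (perm_uniq pp) iota_uniq.
  - by rewrite (perm_all _ pp); apply/allP => k; rewrite mem_iota.
have hf : (f.*2 <= n)%N by rewrite -sp size_cat size_flat; apply: leq_addr.
pose H0 (J : idx) := mk n (fun k => if (k < f.*2)%N then if odd k then dualI x0 else x0 else it (pact s J) k).
(* A preimage with invertible contraction: [x0] and its dual alternate on the first 2f places, where
   [caps] is then the unit [eps K x0 ^+ f]. *)
pose p : row := \row_i ([forall k : 'I_n, (k < f.*2)%N ==> (ixT i k == if odd k then dualI x0 else x0)]%:R *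
   R (pact s^-1 (ixT i))).
have [c [w ew]] := pm_word K m (s^-1)%g.
have := inWZ ((-1) ^+ f * eps K x0 ^+ f * c) (inW_base f p w).
rewrite -scalerA scalemxAr -ew; congr inW; apply: eq_row => J.
rewrite mxE row_mul_ent (bigD1 (pact s J)) //= ent_pm pactKV eqxx mulr1.
rewrite [X in _ + X]big1 ?addr0 => [|H nH]; last first.
  rewrite ent_pm; case: eqP => [e|_]; last by rewrite mulr0.
  by case/eqP: nH; rewrite e pactK.
rewrite row_mul_ent (bigD1 (H0 J)) //= [X in _ + X]big1 ?addr0 => [|H nH]; last first.
  rewrite mxE rkK (ent_Efmx K x0) //.
  case: forallP => [h1|_]; last by rewrite !mul0r.
  case: forallP => [h2|_]; last by rewrite !mulr0.
  case/negP: nH; apply/eqP/(eq_idx (x0 := x0)) => k kn; rewrite it_mk //.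
  rewrite -[k in it H k]/(val (Ordinal kn)) it_ord.
  have /= := h1 (Ordinal kn); have /= := h2 (Ordinal kn).
  case: ltnP => [_ _ /eqP -> //|_ /eqP <- _].
  by rewrite -(it_ord x0).
have e0 (k : 'I_n) : H0 J k = if (k < f.*2)%N then if odd k then dualI x0 else x0 else pact s J k.
  by rewrite ffunE it_ord.
rewrite mxE rkK (ent_Efmx K x0) //.
have -> : [forall k : 'I_n, (k < f.*2)%N ==> (H0 J k == if odd k then dualI x0 else x0)].
  by apply/forallP => k; rewrite e0; case: ltnP => //= _; rewrite eqxx.
have -> : [forall k : 'I_n, (f.*2 <= k)%N ==> (pact s J k == H0 J k)].
  by apply/forallP => k; rewrite e0; case: ltnP => //= _; rewrite eqxx.
have -> : caps K x0 f (H0 J) = eps K x0 ^+ f.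
  rewrite /caps -[in RHS](card_ord f) -prodr_const; apply: eq_bigr => l _; have hl := ltn_ord l.
  have h1 : (l.*2 < f.*2)%N by lia.
  have h2 : (l.*2.+1 < f.*2)%N by lia.
  by rewrite !it_mk ?h1 ?h2 ?(leq_trans h1) ?(leq_trans h2) //= odd_double /form eqxx mulr1.
rewrite (caps_flat J hs hf) hv.
have -> : R (pact s^-1 (H0 J)) = R J.
  apply: hR => k nk; rewrite ffunE e0; case: ltnP => [lt|_]; last by rewrite ffunE permKV.
  have := hs (s^-1 k)%g; rewrite permKV nth_cat size_flat ifT //= => ek.
  by case/negP: nk; rewrite [val k]ek mem_nth // size_flat.
have e1 : (-1) ^+ f * (-1) ^+ f = 1 :> K by rewrite -exprMn mulrNN mul1r expr1n.
have e2 : eps K x0 ^+ f * eps K x0 ^+ f = 1 by rewrite -exprMn epsM expr1n.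
rewrite mulr1 mul1r; set P := \prod_(_ <- _) _; set a := _ ^+ f in e1 *; set b := _ ^+ f in e2 *.
by transitivity ((a * a) * (b * b) * (P * R J)); [ring | rewrite e1 e2 !mul1r].
Qed.

Lemma Efmx_word g : (g.*2 <= n)%N -> exists w, Efmx K m n g = wordmx K m w.
Proof.
elim: g => [|g IH] hg; first by exists [::].
have [|w ew] := IH; first by lia.
have hp : (g.*2 < n.-1)%N by lia.
exists (w ++ [:: (Ordinal hp, true)]).
by rewrite wordmx_cat Efmx_rcons ew /= mulmx1.
Qed.

Lemma inBimg_scale c w : inBimg (c *: wordmx K m w : M).
Proof. by exists [:: (c, w)]; rewrite big_seq1. Qed.

(** [TT], [BB] and [MX] are the top arcs, bottom arcs and vertical strings of a Brauer diagram; it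
    factors as a permutation, [Efmx] and a permutation. *)
Lemma inBimg_matching (B : M) (TT BB MX : seq (nat * nat)) c :
  perm_eq (flat TT ++ map fst MX) (iota 0 n) -> perm_eq (flat BB ++ map snd MX) (iota 0 n) ->
  (forall I J, ent B I J = c * \prod_(x <- TT) form K (it I x.1) (it I x.2) *
     \prod_(x <- BB) form K (it J x.1) (it J x.2) * (all (fun x => it J x.2 == it I x.1) MX)%:R) ->
  inBimg B.
Proof.
move=> pT pB hB.
have get l : perm_eq l (iota 0 n) -> exists s : 'S_n, forall k : 'I_n, s k = nth 0%N l k :> nat.
  move=> p; apply: list_perm.
  - by rewrite (perm_uniq p) iota_uniq.
  - by rewrite (perm_size p) size_iota.
  - by rewrite (perm_all _ p); apply/allP => k; rewrite mem_iota.
have [s hs] := get _ pT; have [t ht] := get _ pB.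
have szf (A : seq (nat * nat)) : size (flat A) = (size A).*2 by exact: size_flat.
have := perm_size pT; rewrite size_iota size_cat szf size_map => zT.
have := perm_size pB; rewrite size_iota size_cat szf size_map => zB.
have eTB : size BB = size TT by lia.
have hg : ((size TT).*2 <= n)%N by lia.
have [w1 e1] := Efmx_word hg.
have [c1 [v1 f1]] := pm_word K m s; have [c2 [v2 f2]] := pm_word K m (t^-1)%g.
have -> : B = (c * (-1) ^+ size TT) *: (pm K m s *m Efmx K m n (size TT) *m pm K m t^-1).
  apply: eq_ent => I J; rewrite hB ent_scale ent_pmr ent_pml (ent_Efmx K x0) //.
  have cB : caps K x0 (size TT) (pact t J) = \prod_(x <- BB) form K (it J x.1) (it J x.2).
    by rewrite -eTB (caps_flat J ht) // eTB.
  rewrite (caps_flat I hs hg) cB.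
  have -> : [forall k : 'I_n, ((size TT).*2 <= k)%N ==> (pact t J k == pact s I k)]
            = all (fun x => it J x.2 == it I x.1) MX.
    have ee l (r : 'S_n) (H : idx) (k : 'I_n) : (forall k : 'I_n, r k = nth 0%N l k :> nat) ->
        pact r H k = it H (nth 0%N l k).
      by move=> h; rewrite ffunE -(it_ord x0) h.
    apply/forallP/(all_nthP (0, 0)%N) => [h k hk|h k].
      have kn : ((size TT).*2 + k < n)%N by lia.
      have := h (Ordinal kn); rewrite (ee _ _ _ _ hs) (ee _ _ _ _ ht) /= leq_addr /=.
      rewrite !nth_cat !szf eTB ltnNge leq_addr /= addKn.
      by rewrite !(nth_map (0, 0)%N).
    apply/implyP; rewrite (ee _ _ _ _ hs) (ee _ _ _ _ ht) !nth_cat !szf eTB ltnNge => h2.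
    rewrite h2 /=; have kn := ltn_ord k.
    have hk' : (k - (size TT).*2 < size MX)%N by lia.
    by rewrite !(nth_map (0, 0)%N) // h.
  have e : (-1) ^+ size TT * (-1) ^+ size TT = 1 :> K by rewrite -exprMn mulrNN mul1r expr1n.
  set a := _ ^+ _ in e *; set P := \prod_(_ <- TT) _; set Q := \prod_(_ <- BB) _.
  by transitivity (c * (a * a) * P * Q * (all (fun x => it J x.2 == it I x.1) MX)%:R); [rewrite e mulr1 | ring].
rewrite f1 f2 e1 -!scalemxAl -scalemxAr -!wordmx_cat !scalerA; exact: inBimg_scale.
Qed.

(** Points below [n] are places of the output [J], the remaining ones places of the input [I]. *)
Definition pt (I J : idx) (t : nat) : L := if (t < n)%N then it J t else it I (t - n).
Definition dualx (I : idx) : idx := [ffun k => dualI (I k)].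

Lemma it_dualx I k : (k < n)%N -> it (dualx I) k = dualI (it I k).
Proof. by move=> kn; rewrite -[k]/(val (Ordinal kn)) !it_ord ffunE. Qed.

(** A pair is a top arc, a bottom arc or a vertical string. The factors [eps] turn pairing with a
    dual letter into equality of letters, up to signs collected in [c]. *)
Lemma classify_pairs (ps : seq (nat * nat)) : all (fun t => t < n + n)%N (flat ps) ->
  exists c TT BB MX,
  [/\ perm_eq (flat TT ++ map fst MX) [seq t - n | t <- flat ps & (n <= t)]%N,
      perm_eq (flat BB ++ map snd MX) [seq t <- flat ps | t < n]%N &
      forall I J, \prod_(t <- flat ps | (n <= t)%N) eps K (it I (t - n)) *
          \prod_(x <- ps) form K (pt (dualx I) J x.1) (pt (dualx I) J x.2) =
        c * \prod_(x <- TT) form K (it I x.1) (it I x.2) *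
        \prod_(x <- BB) form K (it J x.1) (it J x.2) * (all (fun x => it J x.2 == it I x.1) MX)%:R].
Proof.
elim: ps => [|[a b] ps IH] /=.
  by exists 1, [::], [::], [::]; split=> // I J; rewrite /flat !big_nil /= !mulr1.
case/and3P=> ha hb /IH[c [TT [BB [MX [pT pB e]]]]].
have E I J : \prod_(t <- [:: a, b & flat ps] | (n <= t)%N) eps K (it I (t - n)) *
   \prod_(x <- (a, b) :: ps) form K (pt (dualx I) J x.1) (pt (dualx I) J x.2) =
   ((if (n <= a)%N then eps K (it I (a - n)) else 1) *
    (if (n <= b)%N then eps K (it I (b - n)) else 1) *
     form K (pt (dualx I) J a) (pt (dualx I) J b)) *
    (c * \prod_(x <- TT) form K (it I x.1) (it I x.2) *
        \prod_(x <- BB) form K (it J x.1) (it J x.2) * (all (fun x => it J x.2 == it I x.1) MX)%:R).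
  rewrite -e !big_cons; case: (n <= a)%N; case: (n <= b)%N; rewrite /=; ring.
rewrite /flat /= -/(flat ps).
have pF k l (X Y Z : seq nat) : perm_eq (X ++ Y) Z -> perm_eq ([:: k, l & X] ++ Y) [:: k, l & Z].
  by rewrite /= !perm_cons.
have pM k (X Y Z : seq nat) : perm_eq (X ++ Y) Z -> perm_eq (X ++ k :: Y) (k :: Z).
  by move=> h; rewrite perm_catC /= perm_cons perm_catC.
case: (leqP n a) E => na E; case: (leqP n b) E => nb E.
- exists c, ((a - n, b - n)%N :: TT), BB, MX; split=> //= [|I J].
  + by rewrite /= /flat /= -/(flat TT); apply: (pF _ _ _ _ _ pT).
  rewrite E big_cons /pt ltnNge na ltnNge nb /= !it_dualx; try lia.
  set i := it I _; set j := it I _.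
  have -> : eps K i * eps K j * form K (dualI i) (dualI j) = form K i j.
    rewrite /form (inj_eq (inv_inj (@dualIK m))) eps_dual; case: (eqVneq j (dualI i)) => [->|_].
      rewrite eps_dual !mulr1; have := epsM K i; set e1 := eps K i => h.
      by transitivity (e1 * e1 * e1); [ring | rewrite h; ring].
    by rewrite !mulr0.
  ring.
- exists (- c), TT, BB, ((a - n, b)%N :: MX); split=> /= [||I J].
  + exact: pM.
  + exact: pM.
  rewrite E /pt ltnNge na nb /= mulr1 it_dualx; last by lia.
  set i := it I _; set j := it J _.
  have -> : eps K i * form K (dualI i) j = - (j == i)%:R.
    by rewrite /form eps_dual dualIK mulrA mulrN epsM mulN1r.
  by rewrite -mulnb natrM; ring.
- exists c, TT, BB, ((b - n, a)%N :: MX); split=> /= [||I J].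
  + exact: pM.
  + exact: pM.
  rewrite E /pt na ltnNge nb /= mul1r it_dualx; last by lia.
  set i := it I _; set j := it J _.
  have -> : eps K i * form K j (dualI i) = (j == i)%:R.
    by rewrite form_skew /form eps_dual dualIK mulrN mulrA mulrN epsM mulNr mul1r opprK.
  by rewrite -mulnb natrM; ring.
- exists c, TT, ((a, b)%N :: BB), MX; split=> //= [|I J].
  + by rewrite /flat /= -/(flat BB); apply: (pF _ _ _ _ _ pB).
  rewrite E big_cons /pt na nb /=; ring.
Qed.

Lemma inBimg_pairs (B : M) (ps : seq (nat * nat)) : perm_eq (flat ps) (iota 0 (n + n)) ->
  (forall I J, ent B I J =
    \prod_(k < n) eps K (I k) * \prod_(x <- ps) form K (pt (dualx I) J x.1) (pt (dualx I) J x.2)) ->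
  inBimg B.
Proof.
move=> pp hB.
have [|c [TT [BB [MX [pT pB e]]]]] := @classify_pairs ps.
  by rewrite (perm_all _ pp); apply/allP => k; rewrite mem_iota add0n.
have io : iota 0 (n + n) = iota 0 n ++ iota n n by rewrite iotaD.
have f1 : [seq t <- iota 0 n | (t < n)%N] = iota 0 n.
  by apply/all_filterP/allP => k; rewrite mem_iota.
have f2 : [seq t <- iota n n | (t < n)%N] = [::].
  by apply/eqP; rewrite -[_ == _]negbK -has_filter; apply/hasPn => k; rewrite mem_iota -leqNgt => /andP[].
have f3 : [seq t <- iota 0 n | (n <= t)%N] = [::].
  by apply/eqP; rewrite -[_ == _]negbK -has_filter; apply/hasPn => k; rewrite mem_iota add0n -ltnNge => /andP[].
have f4 : [seq t <- iota n n | (n <= t)%N] = iota n n.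
  by apply/all_filterP/allP => k; rewrite mem_iota => /andP[].
apply: (@inBimg_matching B TT BB MX c).
- apply: (perm_trans pT); apply: (perm_trans (perm_map _ (perm_filter _ pp))).
  by rewrite io filter_cat f3 f4 cat0s -[X in iota X]addn0 iotaDl -map_comp
    (eq_map (g := id)) ?map_id // => k /=; rewrite addKn.
- apply: (perm_trans pB); apply: (perm_trans (perm_filter _ pp)).
  by rewrite io filter_cat f1 f2 cats0.
move=> I J; rewrite hB -e; congr (_ * _).
apply: esym; rewrite (perm_big _ pp) /= -big_filter io filter_cat f3 f4 cat0s.
rewrite -[X in iota X]addn0 iotaDl big_map -[in iota _ _](subn0 n) -/(index_iota 0 n) big_mkord.
by apply: eq_bigr => k _; rewrite addKn it_ord.
Qed.
End Arcs.

(** * Expansion of tensors over matchings *)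

Section Columns.
Variables (D : eqType) (M : nat).

Definition cols (c : nat -> seq D) : seq D := flatten [seq c k | k <- iota 0 M].
Definition setcol (c : nat -> seq D) (j : nat) (x : seq D) : nat -> seq D :=
  fun k => if k == j then x else c k.

Lemma cols_setcol c j x : (j < M)%N -> perm_eq (cols (setcol c j x)) (x ++ cols (setcol c j [::])).
Proof.
rewrite /cols => jM; have := iota_uniq 0 M; have : j \in iota 0 M by rewrite mem_iota.
elim: (iota 0 M) => [|k l IH] //=; rewrite inE => /orP[/eqP <- /andP[nj _]|jl /andP[nk ul]].
  rewrite /setcol eqxx cat0s perm_cat2l.
  rewrite (_ : [seq _ | i <- l] = [seq (if i == j then [::] else c i) | i <- l]) //.
  by apply/eq_in_map => i il; case: eqP => // e; rewrite -e il in nj.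
have kj : (k == j) = false by apply/eqP => e; rewrite e jl in nk.
rewrite {1}/setcol /= kj; apply: (perm_trans (y := c k ++ x ++ flatten [seq setcol c j [::] i | i <- l])).
  by rewrite perm_cat2l; apply: IH.
by rewrite {2}/setcol kj !catA perm_cat2r perm_catC.
Qed.

Lemma cols_split c j : (j < M)%N -> perm_eq (cols c) (c j ++ cols (setcol c j [::])).
Proof.
move=> jM; apply: perm_trans (cols_setcol c (c j) jM).
rewrite (_ : cols (setcol c j (c j)) = cols c) //; congr flatten; apply/eq_map => k.
by rewrite /setcol; case: eqP => [->|].
Qed.
End Columns.

Section MatchingExpansion.
Variables (K : fieldType) (m M : nat) (x0 : 'I_(m.*2)).
Local Notation L := 'I_(m.*2).
Local Notation V := 'rV[K]_(m.*2).

Fixpoint steps (b : bool) (p : nat) (s : seq (nat * bool)) : seq nat :=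
  if s is x :: s' then if x.2 == b then p :: steps b p.+1 s' else steps b p.+1 s' else [::].

Lemma perm_steps p s : perm_eq (steps true p s ++ steps false p s) (iota p (size s)).
Proof.
elim: s p => [|[j [|]] s IH] p //=; first by rewrite perm_cons.
by apply/seq.permP => a; have /seq.permP/(_ a) := IH p.+1; rewrite !count_cat /=; lia.
Qed.

Lemma size_steps b p s : size (steps b p s) = count (fun x => x.2 == b) s.
Proof. by elim: s p => //= x s IH p; case: eqP => /= _; rewrite IH. Qed.

(* A vector occupying a box: either inserted at a shrinking step, or given at the start. *)
Definition slot := (nat + V)%type.
Definition slotv (I : seq L) (d : slot) : V :=
  match d with inl t => dv K (nth x0 I t) | inr v => v end.

Definition mterm (I : seq L) (x : K * seq (nat * slot)) : K :=
  x.1 * \prod_(y <- x.2) slotv I y.2 0 (nth x0 I y.1).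

(** A growing step contracts its letter with one entry of the column, either an initial vector or
    one inserted at a shrinking step. Choosing an entry at each such step pairs the growing places
    with the slots bijectively. *)
Lemma ytens_matchings p s (c : nat -> seq slot) : all (fun q => q.1 < M)%N s ->
  exists l : seq (K * seq (nat * slot)),
  (forall x, x \in l -> perm_eq (map fst x.2) (steps true p s) /\
     perm_eq (map snd x.2) (map inl (steps false p s) ++ cols M c)) /\
  (forall I, size I = (p + size s)%N ->
     ytens M s (fun j => map (slotv I) (c j)) (drop p I) = \sum_(x <- l) mterm I x).
Proof.
elim: s p c => [|[j d] s IH] p c /=.
  move=> _; exists (if [forall j : 'I_M, nilp (c j)] then [:: (1, [::])] else [::]); split=> [x|I sI].
    case: forallP => // h; rewrite inE => /eqP-> /=; split=> //.
    rewrite /cols (_ : flatten _ = [::]) //; apply/size0nil; rewrite size_flatten /shape -map_comp.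
    apply/eqP; rewrite sumnE big_map -leqn0 big_seq big1 // => k; rewrite mem_iota => /andP[_ kM].
    exact/eqP/(h (Ordinal kM)).
  rewrite drop_oversize ?sI ?addn0 // ytens_nil.
  rewrite (eq_forallb (P2 := fun j : 'I_M => nilp (c j))) => [|j]; last by rewrite /nilp size_map.
  by case: forallP => _; rewrite /= ?big_nil // big_seq1 /mterm big_nil mulr1.
case/andP=> jM hs; case: d => /=.
  (* [pre] and [q] are the entries of column [j] already passed by [ad] and those still to come. *)
  suff H pre q : exists l : seq (K * seq (nat * slot)),
    (forall x, x \in l -> perm_eq (map fst x.2) (p :: steps true p.+1 s) /\
     perm_eq (map snd x.2) (map inl (steps false p.+1 s) ++ (pre ++ q) ++ cols M (setcol c j [::]))) /\
    (forall I, size I = (p + (size s).+1)%N ->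
     ad (fun c' => ytens M s (upd (fun j => map (slotv I) (c j)) j c') (drop p.+1 I))
       (map (slotv I) pre) (map (slotv I) q) (nth x0 I p) = \sum_(x <- l) mterm I x).
    have [l [h1 h2]] := H [::] (c j); exists l; split=> [x /h1[p1 p2]|I sI].
      split=> //; apply: (perm_trans p2); rewrite perm_cat2l perm_sym; exact: cols_split.
    by rewrite (drop_nth x0) ?ytens_add //= ?h2 // sI; lia.
  elim: q pre => [|x q IHq] pre /=; first by exists [::]; split=> // I _; rewrite big_nil.
  have [l2 [h3 h4]] := IHq (rcons pre x).
  have [l1 [h1 h2]] := IH p.+1 (setcol c j (pre ++ q)) hs.
  exists ([seq (y.1, (p, x) :: y.2) | y <- l1] ++ [seq (- y.1, y.2) | y <- l2]); split=> [y|I sI].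
    rewrite mem_cat => /orP[] /mapP[z]; last first.
      by move=> /h3[p1 p2] -> /=; split=> //; rewrite -cat_rcons.
    move=> /h1[p1 p2] -> /=; split; first by rewrite perm_cons.
    apply/seq.permP => a; have /seq.permP/(_ a) := cols_setcol c (pre ++ q) jM.
    by have /seq.permP/(_ a) := p2; rewrite /= !count_cat /=; lia.
  have {}h4 := h4 I sI; have {}h2 := h2 I (etrans sI (esym (addSnnS _ _))).
  rewrite big_cat !big_map /=; congr (_ + _).
    transitivity (slotv I x 0 (nth x0 I p) * \sum_(y <- l1) mterm I y); last first.
      by rewrite mulr_sumr; apply: eq_bigr => y _; rewrite /mterm big_cons /=; ring.
    rewrite -map_cat -h2; congr (_ * _); apply: eq_ytens => k _.
    by rewrite /setcol /upd; case: eqP.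
  rewrite -map_rcons h4 -sumrN; apply: eq_bigr => y _; by rewrite /mterm mulNr.
have [l [h1 h2]] := IH p.+1 (setcol c j (rcons (c j) (inl p))) hs.
exists l; split=> [x /h1[p1 p2]|I sI].
  split=> //; apply/seq.permP => a; have /seq.permP/(_ a) := cols_setcol c (rcons (c j) (inl p)) jM.
  have /seq.permP/(_ a) := cols_split c jM; have /seq.permP/(_ a) := p2.
  by rewrite /= -cats1 !count_cat /=; lia.
rewrite (drop_nth x0) ?ytens_rem //= -?h2; try by rewrite sI; lia.
by apply: eq_ytens => k _; rewrite /setcol /upd; case: eqP => // _; rewrite map_rcons.
Qed.
End MatchingExpansion.

(** * Tensors as row vectors and as matrices *)

Section TensorsAsMatrices.
Variables (K : fieldType) (m n : nat) (x0 : 'I_(m.*2)).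
Local Notation L := 'I_(m.*2).
Local Notation V := 'rV[K]_(m.*2).
Local Notation idx := (idx m n).
Local Notation row := 'rV[K]_(dimT m n).

Definition trow (F : seq L -> K) : row := \row_i F (codom (ixT i)).

Lemma trow_rk F (J : idx) : trow F 0 (rk J) = F (codom J).
Proof. by rewrite mxE rkK. Qed.

Lemma size_codom_idx (J : idx) : size (codom J) = n.
Proof. by rewrite size_codom card_ord. Qed.

Lemma rem_count_codom (J : idx) : rem_count J = rems (codom J).
Proof.
rewrite /rems codomE count_map -sum1_count big_mkcond big_enum /=.
by apply: eq_bigr => k _; case: leqP.
Qed.

Lemma cols_map (D D' : eqType) (h : D -> D') M (c : nat -> seq D) :
  cols M (fun j => map h (c j)) = map h (cols M c).
Proof. by rewrite /cols map_flatten -map_comp. Qed.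

Lemma inW_mono f g (v : row) : (f <= g)%N -> (g.*2 <= n)%N -> inW g v -> inW f v.
Proof.
move=> /subnKC <-; elim: (g - f)%N v => [|k IH] v; first by rewrite addn0.
rewrite addnS => hk [l ->]; apply: IH; first by lia.
apply: inW_sum => p _; have hp : ((f + k).*2 < n.-1)%N by lia.
rewrite Efmx_rcons; have := inW_base (f + k) (p.1 *m wordmx K m p.2.1) ((Ordinal hp, true) :: p.2.2).
by rewrite /= !mulmxA.
Qed.

Definition arcs_of (y : seq (nat * slot K m)) : seq (nat * nat) :=
  pmap (fun z => if z.2 is inl t then Some (z.1, t) else None) y.
Definition ends_of (y : seq (nat * slot K m)) : seq (nat * V) :=
  pmap (fun z => if z.2 is inr v then Some (z.1, v) else None) y.

Lemma count_arcs_ends (a : pred nat) y :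
  (count a (flat (arcs_of y)) + count a (map fst (ends_of y)) =
   count a (map fst y) + count (fun d : slot K m => if d is inl t then a t else false) (map snd y))%N.
Proof.
elim: y => [|[p [t|v]] y IH] //=; rewrite /flat /= -/(flat _); first by move: IH; rewrite /flat; lia.
by move: IH; rewrite /flat; lia.
Qed.

Lemma prod_arcs_ends (I : seq L) y :
  \prod_(z <- y) slotv x0 I z.2 0 (nth x0 I z.1) =
  \prod_(z <- arcs_of y) form K (nth x0 I z.1) (nth x0 I z.2) * 
  \prod_(z <- ends_of y) z.2 0 (nth x0 I z.1).
Proof.
elim: y => [|[p [t|v]] y IH]; first by rewrite !big_nil mulr1.
  by rewrite !big_cons /= IH mxE mulrA.
by rewrite !big_cons /= IH; ring.
Qed.

Lemma size_arcs_of y : size (arcs_of y) = count (fun d : slot K m => if d is inl _ then true else false) (map snd y).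
Proof. by elim: y => [|[p [t|v]] y IH] //=; rewrite IH. Qed.

Lemma size_ends_of y : size (ends_of y) = count (fun d : slot K m => if d is inl _ then false else true) (map snd y).
Proof. by elim: y => [|[p [t|v]] y IH] //=; rewrite IH. Qed.

Lemma perm_arcs_ends (s : seq (nat * bool)) (c : seq V) y :
  perm_eq (map fst y) (steps true 0 s) ->
  perm_eq (map snd y) (map inl (steps false 0 s) ++ map inr c) ->
  [/\ perm_eq (flat (arcs_of y) ++ map fst (ends_of y)) (iota 0 (size s)),
      size (arcs_of y) = count (fun q => ~~ q.2) s & size (ends_of y) = size c].
Proof.
move=> p1 p2; have ps := perm_steps 0 s; split.
- apply/seq.permP => a; rewrite count_cat count_arcs_ends; have /seq.permP/(_ a) := ps.
  have /seq.permP/(_ a) := p1.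
  have /seq.permP/(_ (fun d : slot K m => if d is inl t then a t else false)) := p2.
  by rewrite !count_cat (count_map inl) (count_map inr) /= count_pred0 addn0 => -> -> <-.
- rewrite size_arcs_of; move/seq.permP/(_ (fun d => if d is inl t then true else false)): p2 => ->.
  rewrite count_cat !count_map /= count_predT size_steps count_pred0 addn0.
  by apply: eq_count => q; rewrite eqbF_neg.
rewrite size_ends_of; move/seq.permP/(_ (fun d => if d is inl t then false else true)): p2 => ->.
by rewrite count_cat !count_map /= count_predT count_pred0.
Qed.

(** In every matching of the expansion the arcs are as many as the removed boxes, and [inW_arcs]
    puts such a term in the ideal. *)
Lemma inW_ytens M f (w : seq L) (U : nat -> seq V) : (f.*2 <= n)%N -> (n <= M)%N ->
  lat w -> size w = n -> (f <= rems w)%N -> inW f (trow (ytens M (hist w) U)).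
Proof.
move=> hf nM lw sw fw; have hs : all (fun p => p.1 < M)%N (hist w) by apply: hist_cols; rewrite ?sw.
have [l [h1 h2]] := @ytens_matchings K m M x0 0 (hist w) (fun j => map inr (U j)) hs.
have -> : trow (ytens M (hist w) U) = \sum_(x <- l) trow (fun I => mterm x0 I x).
  apply: eq_row => J; rewrite trow_rk summxE.
  under eq_bigr => x _ do rewrite trow_rk.
  rewrite -h2; last by rewrite size_codom_idx size_hist.
  by rewrite drop0; apply: eq_ytens => j _; rewrite -map_comp map_id.
rewrite big_seq; apply: inW_sum => x /h1[p1]; rewrite cols_map => p2.
have [] := perm_arcs_ends p1 p2; rewrite size_hist sw => pA sA _.
have {}sA : (f <= size (arcs_of x.2))%N by rewrite sA count_rem_hist.
have hn : ((size (arcs_of x.2)).*2 <= n)%N.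
  by have := perm_size pA; rewrite size_cat size_flat size_iota => <-; apply: leq_addr.
have := iota_uniq 0 n; rewrite -(perm_uniq pA) cat_uniq => /and3P[uA /hasPn dA _].
have ltn k : k \in flat (arcs_of x.2) ++ map fst (ends_of x.2) -> (k < n)%N.
  by rewrite (perm_mem pA) mem_iota.
apply: (inW_mono sA) => //.
apply: (@inW_arcs K m n x0 _ (arcs_of x.2) (fun J => x.1 * \prod_(z <- ends_of x.2) z.2 0 (it x0 J z.1))) => //.
- by apply/allP => k hk; apply: ltn; rewrite mem_cat hk.
- move=> I J h; congr (_ * _); apply: eq_big_seq => z hz.
  have zE : z.1 \in map fst (ends_of x.2) by apply: map_f.
  have zn : (z.1 < n)%N by apply: ltn; rewrite mem_cat zE orbT.
  congr (z.2 0 _); rewrite -[z.1]/(val (Ordinal zn)) !it_ord; apply: h; exact: dA.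
by move=> J; rewrite trow_rk /mterm prod_arcs_ends /it; ring.
Qed.

Definition idx2 (I J : idx) : seq L := codom I ++ codom J.
Definition fmat (B : 'M[K]_(dimT m n)) (w : seq L) : K :=
  ent B (mk n (nth x0 w)) (mk n (fun k => nth x0 w (n + k))).
Definition mfun (F : seq L -> K) : 'M[K]_(dimT m n) := \matrix_(i, j) F (idx2 (ixT i) (ixT j)).

Lemma ent_mfun F I J : ent (mfun F) I J = F (idx2 I J).
Proof. by rewrite /ent mxE !rkK. Qed.

Lemma nth_idx2 I J k : nth x0 (idx2 I J) k = if (k < n)%N then it x0 I k else it x0 J (k - n).
Proof. by rewrite nth_cat size_codom_idx. Qed.

Lemma fmat_idx2 B I J : fmat B (idx2 I J) = ent B I J.
Proof.
congr (ent B); apply: (@eq_idx m n x0) => k kn; rewrite it_mk // nth_idx2 ?kn //.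
by rewrite ltnNge leq_addr /= addKn.
Qed.

Lemma idx2_exists (w : (n + n).-tuple L) : exists I J, w = idx2 I J :> seq L.
Proof.
exists (mk n (nth x0 w)), (mk n (fun k => nth x0 w (n + k))).
apply: (@eq_from_nth _ x0) => [|k]; first by rewrite size_cat !size_codom_idx size_tuple.
rewrite size_tuple => kn; rewrite nth_idx2; case: ltnP => h; first by rewrite it_mk.
by rewrite it_mk ?subnKC //; lia.
Qed.

Lemma size_idx2 I J : size (idx2 I J) == (n + n)%N.
Proof. by rewrite size_cat !size_codom_idx. Qed.

Lemma gw_idx2 (g : 'M[K]_(m.*2)) (I J I' J' : idx) : gw g (idx2 I' J') (idx2 I J) =
  ent (tensmx n g) I' I * ent (tensmx n g) J' J.
Proof.
have gwE (s t : seq L) : size s = size t -> gw g s t = \prod_(k < size s) g (nth x0 s k) (nth x0 t k).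
  elim: s t => [|a s IH] [|b t] //=; first by rewrite big_ord0.
  by move=> [/IH ->]; rewrite big_ord_recl.
rewrite gwE ?(eqP (size_idx2 _ _)) // big_split_ord /= !ent_tens; congr (_ * _).
  by apply: eq_bigr => k _; rewrite !nth_idx2 ltn_ord !it_ord.
by apply: eq_bigr => k _; rewrite !nth_idx2 ltnNge leq_addr /= addKn !it_ord.
Qed.

Lemma tact_fmat (g : 'M[K]_(m.*2)) B I J : tact g (n + n) (fmat B) (idx2 I J) =
  ent ((tensmx n g)^T *m B *m tensmx n g) I J.
Proof.
pose h (p : idx * idx) : (n + n).-tuple L := Tuple (size_idx2 p.1 p.2).
have hb : bijective h.
  exists (fun w : (n + n).-tuple L => (mk n (nth x0 w), mk n (fun k => nth x0 w (n + k)))) => [[I' J']|w].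
    congr pair; apply: (@eq_idx m n x0) => k kn; rewrite it_mk // nth_idx2 ?kn //.
    by rewrite ltnNge leq_addr /= addKn.
  apply/val_inj; apply: (@eq_from_nth _ x0) => /= [|k]; first by rewrite (eqP (size_idx2 _ _)) size_tuple.
  rewrite (eqP (size_idx2 _ _)) => kn; rewrite nth_idx2; case: ltnP => hk; first by rewrite it_mk.
  by rewrite it_mk ?subnKC //; lia.
rewrite /tact (reindex h) /=; last exact: onW_bij.
rewrite -(pair_bigA _ (fun I' J' => fmat B (idx2 I' J') * gw g (idx2 I' J') (idx2 I J))) /=.
rewrite ent_mul exchange_big; apply: eq_bigr => J' _; rewrite ent_mul mulr_suml.
apply: eq_bigr => I' _; rewrite fmat_idx2 gw_idx2 /ent [(_^T) _ _]mxE; ring.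
Qed.
End TensorsAsMatrices.

(** * Closed tensors in the image of the Brauer algebra *)

Section ClosedTensors.
Variables (K : fieldType) (m n : nat) (x0 : 'I_(m.*2)).
Local Notation L := 'I_(m.*2).
Local Notation M := 'M[K]_(dimT m n).
Local Notation idx := (idx m n).
Local Notation JJ := (tensmx n (Jmx K m) : M).
Local Notation T := (n + n)%N.
Local Notation y0 v := (ytens T (hist v) (fun=> [::] : seq 'rV[K]_(m.*2))).

Lemma tensmx_tr g : tensmx n g^T = (tensmx n g)^T :> M.
Proof.
by apply/matrixP => i j; rewrite !mxE; apply: eq_bigr => k _; rewrite mxE.
Qed.

Lemma tensJ_tr : JJ *m JJ^T = 1%:M.
Proof. by rewrite -tensmx_tr -tensmxM JmxT mulmxN JmxK opprK tensmx1. Qed.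

Lemma tensJ_trK : JJ^T *m JJ = 1%:M.
Proof. exact/mulmx1C/tensJ_tr. Qed.

Lemma isSp_inv (g : 'M[K]_(m.*2)) : isSp g -> exists h : 'M[K]_(m.*2),
  [/\ g *m h = 1%:M, h *m g = 1%:M, Jmx K m *m g^T = h *m Jmx K m &
      g^T *m (Jmx K m)^T = (Jmx K m)^T *m h].
Proof.
move=> sg; pose h := - (Jmx K m *m g^T *m Jmx K m); exists h.
have gh : g *m h = 1%:M by rewrite mulmxN !mulmxA sg JmxK opprK.
split=> //; first exact: mulmx1C.
  by rewrite /h mulNmx -[_ *m Jmx K m *m _]mulmxA JmxK mulmxN mulmx1 opprK.
by rewrite JmxT /h mulmxN mulNmx mulmxN opprK !mulmxA JmxK !mulNmx mul1mx.
Qed.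

(* The second tensor factor of [V^(x)2n] is identified with the dual of the first. *)
Definition ymat (F : seq L -> K) : M := JJ *m mfun n F.

Lemma ent_ymat F I J : ent (ymat F) I J = \prod_(k < n) eps K (I k) * F (idx2 (dualx I) J).
Proof.
rewrite ent_mul (bigD1 (dualx I)) //= big1 ?addr0 => [|H nH].
  rewrite ent_mfun ent_tens; congr (_ * _); apply: eq_bigr => k _.
  by rewrite mxE /form ffunE eqxx mulr1.
have /existsP[k nk] : [exists k, H k != dualI (I k)].
  rewrite -negb_forall; apply: contraNN nH => /forallP h; apply/eqP/ffunP => k.
  by rewrite ffunE; apply/eqP.
by rewrite ent_tens (bigD1 k) //= mxE /form (negbTE nk) mulr0 !mul0r.
Qed.

Lemma ent_sum (I : Type) (r : seq I) (P : pred I) (F : I -> M) (H J : idx) :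
  ent (\sum_(i <- r | P i) F i) H J = \sum_(i <- r | P i) ent (F i) H J.
Proof. by rewrite /ent summxE. Qed.

Lemma inB_sum (I : Type) (r : seq I) (P : pred I) (F : I -> M) :
  (forall i, P i -> inBimg (F i)) -> inBimg (\sum_(i <- r | P i) F i).
Proof.
move=> h; apply: big_ind => //; first by exists [::]; rewrite big_nil.
by move=> A B [l ->] [l' ->]; exists (l ++ l'); rewrite big_cat.
Qed.

Lemma inBZ a (A : M) : inBimg A -> inBimg (a *: A).
Proof.
move=> [l ->]; exists [seq (a * p.1, p.2) | p <- l]; rewrite big_map scaler_sumr.
by apply: eq_bigr => p _; rewrite scalerA.
Qed.

(** With empty initial columns there are no free ends, so each term of the expansion is a perfect
    matching of the 2n points. *)
Lemma inB_ymat (v : seq L) : lat v -> size v = T -> inBimg (ymat (y0 v)).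
Proof.
move=> lv sv; have hs : all (fun p => p.1 < T)%N (hist v) by apply: hist_cols; rewrite ?sv.
have [l [h1 h2]] := @ytens_matchings K m T x0 0 (hist v) (fun j => map inr [::]) hs.
have -> : ymat (y0 v) = \sum_(x <- l) ymat (fun I => mterm x0 I x).
  apply: eq_ent => I J; rewrite ent_ymat ent_sum.
  under [RHS]eq_bigr => x _ do rewrite ent_ymat.
  rewrite -mulr_sumr -h2; last by rewrite size_hist sv (eqP (size_idx2 _ _)).
  by rewrite drop0.
rewrite big_seq; apply: inB_sum => x /h1[p1]; rewrite cols_map => p2.
have [] := perm_arcs_ends p1 p2; rewrite size_hist sv => pA _.
rewrite (_ : cols _ _ = [::]); last by rewrite /cols; elim: (iota _ _).
move=> /size0nil e0; rewrite e0 cats0 in pA.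
(* [idx2] lists the input places first and [pt] the output places first; [sw] exchanges the
   halves. *)
pose sw t := if (t < n)%N then (t + n)%N else (t - n)%N.
pose ps := [seq (sw y.1, sw y.2) | y <- arcs_of x.2].
have flat_ps : flat ps = map sw (flat (arcs_of x.2)).
  by rewrite /ps /flat map_flatten -!map_comp.
have lt y : y \in arcs_of x.2 -> (y.1 < T)%N /\ (y.2 < T)%N.
  move=> hy; have sub : {subset [:: y.1; y.2] <= iota 0 T}.
    move=> k hk; rewrite -(perm_mem pA); apply/flattenP; exists [:: y.1; y.2] => //.
    by apply/mapP; exists y.
  by have := sub y.1; have := sub y.2; rewrite !mem_iota !inE !eqxx orbT /= => -> // ->.
rewrite (_ : ymat _ = x.1 *: ymat (fun I => \prod_(z <- arcs_of x.2) form K (nth x0 I z.1) (nth x0 I z.2))); last first.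
  apply: eq_ent => I J; rewrite ent_scale !ent_ymat /mterm prod_arcs_ends e0 big_nil mulr1; ring.
apply/inBZ/(@inBimg_pairs K m n x0 _ ps) => [|I J].
  rewrite flat_ps; apply: (perm_trans (perm_map sw pA)).
  rewrite iotaD map_cat perm_catC add0n.
  have -> : iota n n = map (addn n) (iota 0 n) by rewrite -iotaDl addn0.
  rewrite -map_comp [map (sw \o _) _]map_id_in => [|t _]; last by rewrite /= /sw ltnNge leq_addr addKn.
  rewrite perm_cat2l (_ : map sw _ = map (addn n) (iota 0 n)) ?perm_refl //.
  by apply/eq_in_map => t; rewrite mem_iota add0n /sw addnC => /= ->.
rewrite ent_ymat big_map; congr (_ * _); apply: eq_big_seq => y /lt[l1 l2].
have ptE t : (t < T)%N -> nth x0 (idx2 (dualx I) J) t = pt x0 (dualx I) J (sw t).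
  move=> tT; rewrite nth_idx2 /pt /sw; case: (ltnP t n) => h; first by rewrite ltnNge leq_addl /= addnK.
  by rewrite ifT //; lia.
by rewrite /= !ptE.
Qed.
End ClosedTensors.

(** * Endomorphisms of the quotient *)

Section QuotientEndomorphisms.
Variables (K : closedFieldType) (m n f : nat) (x0 : 'I_(m.*2)).
Hypothesis hf : (f.*2 <= n)%N.
Local Notation L := 'I_(m.*2).
Local Notation M := 'M[K]_(dimT m n).
Local Notation JJ := (tensmx n (Jmx K m) : M).
Local Notation T := (n + n)%N.
Local Notation word := (T.-tuple L).
Local Notation y0 v := (ytens T (hist v) (fun=> [::] : seq 'rV[K]_(m.*2))).
Local Notation Wp := (fun F : seq L -> K => inW f (trow n F)).
Local Notation null := (@nullQ K m n f).

Lemma nullQ_mul (P A : M) : null A -> null (P *m A).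
Proof. by move=> hA v; rewrite mulmxA. Qed.

Lemma WT_fmat (B : M) : WT n Wp (fmat x0 B) <-> null B.
Proof.
have e (I : idx m n) : trow n (fun I1 => fmat x0 B (codom I ++ I1)) = row (rk I) B.
  by apply: eq_row => J; rewrite trow_rk mxE fmat_idx2.
split=> [h v|h I2 s2].
  rewrite mulmx_sum_row; apply: inW_sum => i _; apply: inWZ.
  by rewrite -[i]ixTK -e; apply: h; rewrite size_codom_idx.
have -> : I2 = codom (mk n (nth x0 I2) : idx m n).
  apply: (@eq_from_nth _ x0) => [|k]; rewrite ?size_codom_idx // s2 => kn.
  by rewrite -/(it x0 _ _) it_mk.
by rewrite e rowE; apply: h.
Qed.

Let Wext (F G : seq L -> K) : (forall I, size I = n -> F I = G I) -> Wp F -> Wp G.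
Proof.
by move=> e; congr inW; apply: eq_row => J; rewrite !trow_rk e ?size_codom_idx.
Qed.

Let Wlin (a : K) (F G : seq L -> K) : Wp F -> Wp G -> Wp (fun I => a * F I + G I).
Proof.
move=> hF hG; rewrite /= (_ : trow n _ = a *: trow n F + trow n G); first exact: inW_lin.
by apply: eq_row => J; rewrite !mxE.
Qed.

Let W0 : Wp (fun=> 0).
Proof. by rewrite /= (_ : trow n _ = 0); [exact: inW0 | apply: eq_row => J; rewrite trow_rk mxE]. Qed.

Let Wrems F I : Wp F -> size I = n -> (rems I < f)%N -> F I = 0.
Proof.
move=> hF sI hI; have eI : codom (mk n (nth x0 I) : idx m n) = I.
  apply: (@eq_from_nth _ x0) => [|k]; rewrite size_codom_idx // => kn.
  by rewrite -/(it x0 _ _) it_mk.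
rewrite -eI -trow_rk; apply: (inW_rem x0 hf hF).
by rewrite rem_count_codom eI.
Qed.

Let Wtens (w : seq L) : lat w -> size w = n -> (f <= rems w)%N ->
  forall U : nat -> seq 'rV[K]_(m.*2), Wp (ytens T (hist w) U).
Proof. by move=> lw sw fw U; apply: inW_ytens => //; apply: leq_addr. Qed.

Lemma fmat_mfun (F : seq L -> K) (w : word) : fmat x0 (mfun n F) w = F w.
Proof.
by have [I [J e]] := idx2_exists x0 w; rewrite e fmat_idx2 ent_mfun.
Qed.

Lemma tact_ext (g : 'M[K]_(m.*2)) (F G : seq L -> K) I : (forall w : word, F w = G w) -> tact g T F I = tact g T G I.
Proof. by move=> e; apply: eq_bigr => w _; rewrite e. Qed.

(** With G the action of g and J that of the form, G^T J^T = J^T G^-1. So g turns J^T A into J^T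
    G^-1 A G, and the difference J^T G^-1 (A G - G A) is null. *)
Lemma isSpEndQ_fmat (A : M) g : isSpEndQ f A -> isSp g ->
  WT n Wp (fun w => tact g T (fmat x0 (JJ^T *m A)) w - fmat x0 (JJ^T *m A) w).
Proof.
move=> [_ hA] sg; have [h [gh hg _ e]] := isSp_inv sg.
set G := tensmx n g; set H := tensmx n h : M.
have GJ : G^T *m JJ^T = JJ^T *m H by rewrite -!tensmx_tr -!tensmxM e.
have HG : H *m G = 1%:M by rewrite -tensmxM hg tensmx1.
apply: (WT_ext Wext (F := fmat x0 ((JJ^T *m H) *m (A *m G - G *m A)))) => [w|].
  have [I [J ew]] := idx2_exists x0 w; rewrite ew tact_fmat !fmat_idx2.
  rewrite -/G !mulmxA GJ mulmxBr -!mulmxA [H *m (G *m A)]mulmxA HG mul1mx.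
  by rewrite /ent !mxE.
by apply/WT_fmat; apply: nullQ_mul => v; apply: hA.
Qed.

Lemma isSpEndQ_lift (A : M) : isSpEndQ f A -> exists c : word -> K,
  null (A - \sum_(v : word | closedw n f v) c v *: ymat n (y0 v)).
Proof.
move=> hA; have [c hc] := lift_invariant x0 Wext Wlin W0 Wrems Wtens (fun g sg => isSpEndQ_fmat hA sg).
exists c.
suff /WT_fmat h : WT n Wp (fmat x0 (JJ^T *m A - \sum_(v : word | closedw n f v) c v *: mfun n (y0 v))).
  have := nullQ_mul JJ h; rewrite mulmxBr mulmxA tensJ_tr mul1mx mulmx_sumr.
  by under eq_bigr => v _ do rewrite -scalemxAr.
apply: (WT_ext Wext) hc => w; have [I [J ew]] := idx2_exists x0 w.
rewrite ew !fmat_idx2 /ent !mxE summxE; congr (_ - _); apply: eq_bigr => v _.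
by rewrite mxE -[mfun _ _ _ _]/(ent _ _ _) ent_mfun.
Qed.

(** A closed tensor has no vector arguments, so equivariance makes it invariant and [ymat] commutes
    with Sp(V) exactly, not only modulo W. *)
Lemma isSpEndQ_ymat (v : seq L) : lat v -> size v = T -> isSpEndQ f (ymat n (y0 v)).
Proof.
move=> lv sv; split=> [u hu|g sg u]; first exact/inW_Bimg/inB_ymat.
rewrite (_ : _ - _ = 0) ?mulmx0; first exact: inW0.
have [h [gh hg e _]] := isSp_inv sg.
set G := tensmx n g; set H := tensmx n h : M.
have JG : JJ *m G^T = H *m JJ by rewrite -!tensmx_tr -!tensmxM e.
have GH : G *m H = 1%:M by rewrite -tensmxM gh tensmx1.
have E : G^T *m mfun n (y0 v) *m G = mfun n (y0 v).
  apply: eq_ent => I J; rewrite -(tact_fmat x0) (tact_ext _ _ (G := y0 v)); last exact: fmat_mfun.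
  rewrite ent_mfun; have := @ytens_equivariant K m T g (hist v) (fun=> [::]) (idx2 I J) sg.
  rewrite size_hist sv; apply; first exact/eqP/size_idx2.
  by apply: hist_cols => //; rewrite sv.
have E' : H *m ymat n (y0 v) *m G = ymat n (y0 v).
  by rewrite /ymat mulmxA -JG -!mulmxA; congr (_ *m _); rewrite mulmxA.
by rewrite -{2}E' !mulmxA GH mul1mx subrr.
Qed.

Lemma ymat_unique (c : word -> K) :
  null (\sum_(v : word | closedw n f v) c v *: ymat n (y0 v)) ->
  forall v : word, closedw n f v -> c v = 0.
Proof.
move=> h; apply: (lift_unique x0 Wrems).
have := nullQ_mul JJ^T h; rewrite mulmx_sumr => /WT_fmat; apply: (WT_ext Wext) => w.
have [I [J ew]] := idx2_exists x0 w; rewrite ew !fmat_idx2 ent_sum; apply: eq_bigr => v _.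
by rewrite -scalemxAr mulmxA tensJ_trK mul1mx ent_scale ent_mfun.
Qed.

Lemma dimEndQ_closed : dimEndQ K m n f #|[set v : word | closedw n f v]|.
Proof.
set CW := [set v | _]; have cE (i : 'I_#|CW|) : closedw n f (enum_val i : word).
  by have := enum_valP i; rewrite /= inE.
pose Y (v : word) := ymat n (y0 v).
have sumE (c : word -> K) : \sum_(v : word | closedw n f v) c v *: Y v =
    \sum_(i < #|CW|) c (enum_val i) *: tnth [tuple Y (enum_val i) | i < #|CW|] i.
  rewrite (eq_bigl (fun v => v \in CW)) => [|v]; last by rewrite inE.
  by rewrite big_enum_val; apply: eq_bigr => i _; rewrite tnth_mktuple.
exists [tuple Y (enum_val i) | i < #|CW|]; split=> [i|]; last split=> [A hA|c hc i].
- rewrite tnth_mktuple; have /and3P[lv _ _] := cE i.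
  by apply: isSpEndQ_ymat; rewrite ?size_tuple.
- have [c hc] := isSpEndQ_lift hA; exists (fun i => c (enum_val i)).
  by rewrite -sumE.
pose c' (v : word) := \sum_j c j * (v == enum_val j)%:R.
have c'E j : c' (enum_val j) = c j.
  rewrite /c' (bigD1 j) //= eqxx mulr1 big1 ?addr0 // => k nk.
  by rewrite (inj_eq enum_val_inj) eq_sym (negbTE nk) mulr0.
rewrite -c'E; apply: ymat_unique => //; rewrite sumE.
by under eq_bigr => j _ do rewrite c'E.
Qed.

Lemma phi_surj_closed : phi_surj K m n f.
Proof.
move=> A /isSpEndQ_lift[c hc]; exists (\sum_(v : word | closedw n f v) c v *: ymat n (y0 v)).
split=> //; apply: inB_sum => v /and3P[lv _ _]; apply: inBZ.
by apply: inB_ymat => //; rewrite size_tuple.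
Qed.
End QuotientEndomorphisms.

Unset Implicit Arguments.
Local Close Scope ring_scope.

Theorem theorem1p7 (m n f : nat) :
  (0 < m)%N -> (0 < n)%N -> (1 <= f)%N -> (f <= n./2)%N ->
  (exists d : nat, forall K : closedFieldType, dimEndQ K m n f d) /\
  (forall K : closedFieldType, phi_surj K m n f).
Proof.
move=> m0 _ _ fn; have hf : (f.*2 <= n)%N by rewrite -geq_half_double.
have x0 : 'I_(m.*2) by exists 0; rewrite double_gt0.
split; last by move=> K; apply: phi_surj_closed.
(* The dimension is the number of closed words, an expression free of [K]. *)
by eexists => K; apply: dimEndQ_closed.
Qed.
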